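(* For any integer $n>0$ and partition $\lambda$, and for generic values of the parameters, $$\tilde K_\lambda(x_1^{\pm1},\dots,x_n^{\pm1};q,t,t^n;t_0,t_1,t_2,t_3)=\begin{cases}K^{(n)}_\lambda(x_1,\dots,x_n;q,t;t_0,t_1,t_2,t_3)&\ell(\lambda)\le n\\0&\text{otherwise.}\end{cases}$$
   Context: $t_0,\dots,t_3$ are generic (e.g. indeterminates over $\mathbb F=\mathbb Q(q,t)$), with $T$ specialized to $t^n$ before any other specialization. $f(x_1^{\pm1},\dots,x_n^{\pm1})$ denotes the symmetric function $f$ in the $2n$ variables $x_1,1/x_1,\dots,x_n,1/x_n$. For a partition $\lambda$: $\lambda'$ is the conjugate, $\ell(\lambda)$ the number of nonzero parts, $n(\lambda)=\sum_i(i-1)\lambda_i$; $(i,j)\in\lambda$ means $1\le i$, $1\le j\le\lambda_i$; $\lambda\subset\mu$ means $\lambda_i\le\mu_i$ for all $i$. Dominance: $\mu\le\lambda$ iff $\mu_1+\dots+\mu_k\le\lambda_1+\dots+\lambda_k$ for all $k\ge1$ (sizes may differ). Put $C^0_\lambda(x;q,t)=\prod_{(i,j)\in\lambda}(1-q^{j-1}t^{1-i}x)$, $C^-_\lambda(x;q,t)=\prod_{(i,j)\in\lambda}(1-q^{\lambda_i-j}t^{\lambda'_j-i}x)$, $C^+_\lambda(x;q,t)=\prod_{(i,j)\in\lambda}(1-q^{\lambda_i+j-1}t^{2-\lambda'_j-i}x)$ (several arguments before the semicolon indicate a product), and $$k^0_\lambda(q,t,T;t_0{:}t_1,t_2,t_3)=(t_0T/t)^{-|\lambda|}t^{n(\lambda)}\frac{C^0_\lambda(T,Tt_0t_1/t,Tt_0t_2/t,Tt_0t_3/t;q,t)}{C^-_\lambda(t;q,t)\,C^+_\lambda(T^2t_0t_1t_2t_3/(qt^2);q,t)}.$$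 Lifted interpolation polynomials: $\tilde P^*_\lambda(;q,t,T;s)$ is the unique family of symmetric functions with coefficients in $\mathbb F(s,T)$ such that $\tilde P^*_\lambda=m_\lambda+{}$a combination of monomial symmetric functions $m_\mu$, $\mu<\lambda$, and $\tilde P^*_\lambda(\langle\mu\rangle_{q,t,T;s};q,t,T;s)=0$ for $\mu<\lambda$, where $f\mapsto f(\langle\mu\rangle_{q,t,T;s})$ is the homomorphism given on power sums by $$p_k\mapsto\sum_{1\le i\le\ell(\mu)}\Bigl((q^{k\mu_i}-1)t^{-ki}(sT)^k+(q^{-k\mu_i}-1)t^{ki}(sT)^{-k}\Bigr)+s^k\frac{1-T^k}{1-t^k}+s^{-k}\frac{1-1/T^k}{1-1/t^k}.$$ Interpolation polynomials and binomial coefficients: $BC_n$ is the group of permutations of $x_1,\dots,x_n$ and inversions $x_i\mapsto x_i^{-1}$; write $m^{BC}_\lambda$ for the $BC_n$-orbit sum of $\prod_ix_i^{\lambda_i}$. For $\ell(\lambda)\le n$, $\bar P^{*(n)}_\lambda(;q,t,s)$ is the unique $BC_n$-symmetric Laurent polynomial $m^{BC}_\lambda+\sum_{\mu<\lambda}c_{\lambda\mu}m^{BC}_\mu$ over $\mathbb F(s)$ whose value $\bar P^{*(n)}_\lambda(\mu;q,t,s)$ at $x_i=q^{\mu_i}t^{n-i}s$ is $0$ for all $\mu<\lambda$, $\ell(\mu)\le n$ (it is then $0$ whenever $\lambda\not\subset\mu$, and nonzero for $\mu=\lambda$); and, independently of $n\ge\ell(\lambda),\ell(\mu)$, $$\genfrac[]{0pt}{}{\lambda}{\mu}_{q,t,s}=\frac{\bar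 P^{*(n)}_\mu(\lambda;q,t,t^{1-n}s)}{\bar P^{*(n)}_\mu(\mu;q,t,t^{1-n}s)},$$ depending on $s$ only through $s^2$. Lifted Koornwinder polynomials: $$\tilde K_\lambda(;q,t,T;t_0,t_1,t_2,t_3)=\sum_{\mu\subset\lambda}\genfrac[]{0pt}{}{\lambda}{\mu}_{q,t,(T/t)\sqrt{t_0t_1t_2t_3/q}}\frac{k^0_\lambda(q,t,T;t_0{:}t_1,t_2,t_3)}{k^0_\mu(q,t,T;t_0{:}t_1,t_2,t_3)}\tilde P^*_\mu(;q,t,T;t_0).$$ Koornwinder polynomials: $\{K^{(n)}_\lambda(;q,t;t_0,t_1,t_2,t_3)\}$ is the unique family of $BC_n$-symmetric Laurent polynomials, indexed by partitions with at most $n$ parts, such that $K^{(n)}_\lambda=m^{BC}_\lambda+{}$a combination of $m^{BC}_\mu$, $\mu<\lambda$, and for all $\mu<\lambda$ $$\frac{K^{(n)}_\lambda(q^{\mu_i}t^{n-i}t_0;q,t;t_0,t_1,t_2,t_3)}{k^0_\lambda(q,t,t^n;t_0{:}t_1,t_2,t_3)}=\frac{K^{(n)}_\mu(q^{\lambda_i}t^{n-i}\hat t_0;q,t;\hat t_0,\hat t_1,\hat t_2,\hat t_3)}{k^0_\mu(q,t,t^n;\hat t_0{:}\hat t_1,\hat t_2,\hat t_3)},$$ where $K(q^{\mu_i}t^{n-i}t_0;\dots)$ means evaluation at $x_i=q^{\mu_i}t^{n-i}t_0$, $\hat t_0=\sqrt{t_0t_1t_2t_3/q}$ and $\hat t_i=t_0t_i/\hat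 t_0$ for $i=1,2,3$. *)

(* Defs.v *)
From HB Require Import structures.
From Stdlib Require Import ClassicalEpsilon.
From mathcomp Require Import all_boot all_fingroup all_algebra.
From mathcomp Require Import freeg mpoly.

Set Implicit Arguments.
Unset Strict Implicit.
Unset Printing Implicit Defensive.

Import GRing.Theory.
Local Open Scope ring_scope.

Definition is_part (s : seq nat) : bool := sorted geq s && (0%N \notin s).

Record intpart := IntPart { parts :> seq nat; _ : is_part parts }.

HB.instance Definition _ := [isSub for parts].
HB.instance Definition _ := [Choice of intpart by <:].

(* The indices [i] and [j] below start at 1; [size la] is the length of [la]. *)
Definition part (la : intpart) (i : nat) : nat := nth 0%N la i.-1.
Definition conj_part (la : intpart) (j : nat) : nat := count (leq j) la.

Definition weight (la : intpart) : nat := sumn la.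

Definition nstat (la : intpart) : nat :=
  (\sum_(1 <= i < (size la).+1) (i - 1) * part la i)%N.

Definition part_incl (mu la : intpart) : Prop :=
  forall i : nat, (1 <= i)%N -> (part mu i <= part la i)%N.

(* Dominance compares partitions of possibly different weights. *)
Definition dom_le (mu la : intpart) : Prop :=
  forall k : nat, (1 <= k)%N ->
    (\sum_(1 <= i < k.+1) part mu i <= \sum_(1 <= i < k.+1) part la i)%N.
Definition dom_lt (mu la : intpart) : Prop := dom_le mu la /\ mu <> la.

Fixpoint bounded_seqs (s : seq nat) : seq (seq nat) :=
  if s is m :: s' then
    [::] :: [seq k :: r | k <- iota 1 m, r <- bounded_seqs s']
  else [:: [::]].

(* The duplicate-free list of the partitions contained in [la]:
   see [subparts_uniq] and [mem_subparts]. *)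
Definition subparts (la : intpart) : seq intpart :=
  pmap insub (bounded_seqs la).

Lemma bounded_seqs_uniq (s : seq nat) : uniq (bounded_seqs s).
Proof.
elim: s => [|m s IHs] //=; rewrite (introN idP); last first.
  by case/allpairsP => [[k r] []].
rewrite allpairs_uniq ?iota_uniq //.
by move=> [k r] [k' r'] _ _ /= [-> ->].
Qed.

Lemma mem_bounded_seqs (s r : seq nat) :
  0%N \notin r ->
  reflect (forall i, (nth 0%N r i <= nth 0%N s i)%N) (r \in bounded_seqs s).
Proof.
elim: s r => [|m s IHs] [|k r] //=; rewrite !inE ?negb_or.
- by move=> _; apply: ReflectT => i.
- case/andP=> k_gt0 _; apply: ReflectF => /(_ 0%N) /=.
  by rewrite leqn0 eq_sym (negPf k_gt0).
- by move=> _; apply: ReflectT => i; rewrite nth_nil.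
case/andP=> k_gt0 r_gt0; apply: (iffP allpairsP) => [[[k' r'] /= []]|le_rs].
  rewrite mem_iota add1n ltnS => /andP[_ le_k] r'_in [-> def_r].
  by case=> [|i] //=; apply/(IHs r r_gt0): i; rewrite def_r.
exists (k, r); split=> //=.
  by rewrite mem_iota add1n ltnS lt0n eq_sym k_gt0; apply: (le_rs 0%N).
by apply/(IHs r r_gt0) => i; apply: (le_rs i.+1).
Qed.

Lemma subparts_uniq (la : intpart) : uniq (subparts la).
Proof. exact/pmap_sub_uniq/bounded_seqs_uniq. Qed.

Lemma mem_subparts (mu la : intpart) :
  reflect (part_incl mu la) (mu \in subparts la).
Proof.
rewrite mem_pmap_sub /=.
have mu_gt0 : 0%N \notin (mu : seq nat) by case: mu => s /= /andP[].
apply: (iffP (mem_bounded_seqs _ mu_gt0)) => [le_mu [//|i] _ | le_mu i].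
  exact: le_mu.
exact: (le_mu i.+1).
Qed.

Section Constants.
Variables (R : fieldType) (q t : R).

Definition cell_prod (la : intpart) (w : nat -> nat -> R) : R :=
  \prod_(1 <= i < (size la).+1) \prod_(1 <= j < (part la i).+1) w i j.

Definition C0 (la : intpart) (x : R) : R :=
  cell_prod la (fun i j => 1 - q ^ (j%:Z - 1) * t ^ (1 - i%:Z) * x).

Definition Cminus (la : intpart) (x : R) : R :=
  cell_prod la (fun i j =>
    1 - q ^ ((part la i)%:Z - j%:Z) * t ^ ((conj_part la j)%:Z - i%:Z) * x).

Definition Cplus (la : intpart) (x : R) : R :=
  cell_prod la (fun i j =>
    1 - q ^ ((part la i)%:Z + j%:Z - 1)
        * t ^ (2 - (conj_part la j)%:Z - i%:Z) * x).

Definition k0 (T t0 t1 t2 t3 : R) (la : intpart) : R :=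
  (t0 * T / t) ^- weight la * t ^+ nstat la
  * (C0 la T * C0 la (T * t0 * t1 / t) * C0 la (T * t0 * t2 / t)
     * C0 la (T * t0 * t3 / t))
  / (Cminus la t
     * Cplus la (T ^+ 2 * t0 * t1 * t2 * t3 / (q * t ^+ 2))).

End Constants.

(* A symmetric function is given by its coefficients in the basis of
   monomial symmetric functions: [<< mu >>] stands for [m_mu]. *)
Definition symfun (R : fieldType) := {freeg intpart / R}.

(* The rearrangements of (la_1, ..., la_N); none if la has more than N parts. *)
Definition rearrangements (N : nat) (la : intpart) : seq (seq nat) :=
  if (size la <= N)%N then permutations (la ++ nseq (N - size la) 0%N)
  else [::].

Definition monomial_sympoly (R : fieldType) (N : nat) (la : intpart) :
    {mpoly R[N]} :=
  \sum_(a <- rearrangements N la) 'X_[[multinom nth 0%N a i | i < N]].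

Definition sympoly (R : fieldType) (N : nat) (f : symfun R) : {mpoly R[N]} :=
  \sum_(mu <- dom f) coeff mu f *: monomial_sympoly R N mu.

Definition power_sum (R : fieldType) (N k : nat) : {mpoly R[N]} :=
  \sum_(i < N) 'X_i ^+ k.

(* [f = g(p_1, ..., p_d)] in the ring of symmetric functions. *)
Definition power_sum_expansion (R : fieldType) (f : symfun R) (d : nat)
    (g : {mpoly R[d]}) : Prop :=
  forall N : nat, g \mPo [tuple power_sum R N i.+1 | i < d] = sympoly N f.

(* The value at f of the homomorphism p_k |-> a k (k >= 1).  In
   characteristic 0 the ring of symmetric functions is the polynomial ring
   in the p_k, so this value exists and is unique. *)
Definition sym_hom (R : fieldType) (a : nat -> R) (f : symfun R) : R :=
  epsilon (inhabits 0) (fun v : R =>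
    exists (d : nat) (g : {mpoly R[d]}),
      power_sum_expansion f g /\ v = g.@[fun i : 'I_d => a i.+1]).

(* [<< v >>] stands for the monomial x_1^(v 0) ... x_n^(v (n-1)). *)
Definition laurent (n : nat) (R : fieldType) := {freeg {ffun 'I_n -> int} / R}.

Definition laurent_eval (R : fieldType) (n : nat) (p : laurent n R)
    (x : 'I_n -> R) : R :=
  \sum_(v <- dom p) coeff v p * \prod_(i < n) x i ^ v i.

(* f(x_1^{+-1}, ..., x_n^{+-1}): in the polynomial in 2n variables, the first n
   variables become the x_i and the last n the 1/x_i. *)
Definition sym_pm (R : fieldType) (n : nat) (f : symfun R) : laurent n R :=
  \sum_(m <- msupp (sympoly (n + n) f))
    (sympoly (n + n) f)@_m
    *: << [ffun i : 'I_n => (m (lshift n i))%:Z - (m (rshift n i))%:Z] >>.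

Definition bc_act (n : nat) (s : {perm 'I_n}) (e : {ffun 'I_n -> bool})
    (v : {ffun 'I_n -> int}) : {ffun 'I_n -> int} :=
  [ffun i => if e i then - v (s i) else v (s i)].

Definition bc_orbit (n : nat) (v : {ffun 'I_n -> int}) :
    seq {ffun 'I_n -> int} :=
  undup [seq bc_act s e v | s <- enum {perm 'I_n},
                            e <- enum {ffun 'I_n -> bool}].

(* Meaningful only if la has at most n parts. *)
Definition mBC (R : fieldType) (n : nat) (la : intpart) : laurent n R :=
  \sum_(v <- bc_orbit [ffun i : 'I_n => (part la i.+1)%:Z]) << v >>.

(* The orbit sums make p invariant under BC_n. *)
Definition bc_monic (R : fieldType) (n : nat) (la : intpart)
    (p : laurent n R) : Prop :=
  exists c : {freeg intpart / R},
    (forall mu, mu \in dom c -> dom_lt mu la /\ (size mu <= n)%N)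
    /\ p = mBC R n la + \sum_(mu <- dom c) coeff mu c *: mBC R n mu.

(* [i : 'I_n] starts at 0, so it is the index of x_{i+1}. *)
Definition interp_point (R : fieldType) (n : nat) (q t s : R) (mu : intpart) :
    'I_n -> R :=
  fun i => q ^+ part mu i.+1 * t ^+ (n - i.+1) * s.

(* "The unique object such that" is rendered below by [epsilon], which chooses
   an object with the property. *)

Section Interpolation.
Variables (R : fieldType) (q t : R).

Definition is_interp (n : nat) (s : R) (la : intpart) (p : laurent n R) :
    Prop :=
  bc_monic la p
  /\ forall mu : intpart, dom_lt mu la -> (size mu <= n)%N ->
       laurent_eval p (interp_point q t s mu) = 0.

Definition interp (n : nat) (s : R) (la : intpart) : laurent n R :=
  epsilon (inhabits 0) (is_interp s la).

(* The quotient does not depend on the number n of variables, provided n is at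
   least the lengths of both partitions. *)
Definition binom (s : R) (la mu : intpart) : R :=
  let n := maxn (size la) (size mu) in
  let s' := t ^ (1 - n%:Z) * s in
  laurent_eval (interp n s' mu) (interp_point q t s' la)
  / laurent_eval (interp n s' mu) (interp_point q t s' mu).

(* p_k(<mu>_{q,t,T;s}). *)
Definition lifted_power_sum (T s : R) (mu : intpart) (k : nat) : R :=
  \sum_(1 <= i < (size mu).+1)
     ((q ^+ (k * part mu i) - 1) * t ^- (k * i) * (s * T) ^+ k
      + (q ^- (k * part mu i) - 1) * t ^+ (k * i) * (s * T) ^- k)
  + s ^+ k * ((1 - T ^+ k) / (1 - t ^+ k))
  + s ^- k * ((1 - T ^- k) / (1 - t ^- k)).

Definition is_lifted_interp (T s : R) (la : intpart) (f : symfun R) : Prop :=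
  (exists c : symfun R,
     (forall mu, mu \in dom c -> dom_lt mu la) /\ f = << la >> + c)
  /\ forall mu : intpart, dom_lt mu la ->
       sym_hom (lifted_power_sum T s mu) f = 0.

Definition lifted_interp (T s : R) (la : intpart) : symfun R :=
  epsilon (inhabits 0) (is_lifted_interp T s la).

(* [h] is a square root of t0 t1 t2 t3 / q. *)
Definition lifted_koornwinder (T t0 t1 t2 t3 h : R) (la : intpart) :
    symfun R :=
  \sum_(mu <- subparts la)
    (binom (T / t * h) la mu
     * (k0 q t T t0 t1 t2 t3 la / k0 q t T t0 t1 t2 t3 mu))
    *: lifted_interp T t0 mu.

End Interpolation.

(* Algebraic independence over the rationals; in particular R has
   characteristic 0. *)
Definition generic (R : fieldType) (q t t0 t1 t2 t3 : R) : Prop :=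
  forall p : {mpoly int[6]}, p != 0 ->
    mmap intr (tnth [tuple q; t; t0; t1; t2; t3]) p != 0.

Section Koornwinder.
Variables (R : fieldType) (n : nat) (q t : R).

Definition koornwinder_family := R -> R -> R -> R -> intpart -> laurent n R.

(* Duality relates the parameters (t0, t1, t2, t3) to
   (h, t0 t1 / h, t0 t2 / h, t0 t3 / h), so the members of the family with
   different parameters are characterized together. *)
Definition is_koornwinder (K : koornwinder_family) : Prop :=
  forall t0 t1 t2 t3 h : R,
    generic q t t0 t1 t2 t3 -> h ^+ 2 = t0 * t1 * t2 * t3 / q ->
    let h1 := t0 * t1 / h in
    let h2 := t0 * t2 / h in
    let h3 := t0 * t3 / h in
    forall la : intpart, (size la <= n)%N ->
      bc_monic la (K t0 t1 t2 t3 la)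
      /\ forall mu : intpart, dom_lt mu la -> (size mu <= n)%N ->
           laurent_eval (K t0 t1 t2 t3 la) (interp_point q t t0 mu)
             / k0 q t (t ^+ n) t0 t1 t2 t3 la
           = laurent_eval (K h h1 h2 h3 mu) (interp_point q t h la)
             / k0 q t (t ^+ n) h h1 h2 h3 mu.

Definition koornwinder : koornwinder_family :=
  epsilon (inhabits (fun _ _ _ _ _ => 0)) is_koornwinder.

End Koornwinder.

Notation ratfun R := {fraction {poly R}}.

Definition ratfunC (R : fieldType) (c : R) : ratfun R := tofrac c%:P.
Definition ratfunT (R : fieldType) : ratfun R := tofrac 'X.

(* r is regular at T = a, with value v. *)
Definition ratfun_value (R : fieldType) (r : ratfun R) (a v : R) : Prop :=
  exists p d : {poly R},
    [/\ d.[a] != 0, r = tofrac p / tofrac d & v = p.[a] / d.[a]].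

Definition specializes_to (R : fieldType) (f : symfun (ratfun R)) (a : R)
    (g : symfun R) : Prop :=
  forall mu : intpart, ratfun_value (coeff mu f) a (coeff mu g).

(* Main.v *)
Require Import Defs.
From Stdlib Require Import ClassicalEpsilon.
From mathcomp Require Import all_boot all_fingroup all_algebra.
From mathcomp Require Import freeg mpoly.
From mathcomp Require Import zify ring.

Set Implicit Arguments.
Unset Strict Implicit.
Unset Printing Implicit Defensive.

Import GRing.Theory.
Local Open Scope ring_scope.

(** Both sides of the theorem are binomial sums.

    In n variables, consider the sum over mu of the binomial coefficient of la
    and mu, times k0_la / k0_mu, times the interpolation Laurent polynomial of mu
    with parameter t0, where T = t^n.  Divided by k0_la, its value at the point of
    mu is a sum over the partitions nu inside la and mu, by extra vanishing
    (extra_vanishing).  Each term is a product of a value at la for the parameter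
    h and a value at mu for the parameter t0, and the closed form of the diagonal
    values (interpz_diag, interp_val_k0_dual) shows that exchanging la with mu and
    t0 with h does not change it.  So these sums satisfy the duality equations that
    define Koornwinder polynomials.  The equations have only one solution, by
    induction along dominance, because interpolation below la is nonsingular
    (interp_nonsing) and because dual parameters are again generic (generic_dual).
    Hence the sum is the Koornwinder polynomial (koornwinderE).

    It remains to compare with the lifted sum, term by term.  At T = t^n the lifted
    point of mu is the alphabet formed by the coordinates of the interpolation point
    of mu and their inverses, if mu has at most n parts (lifted_eval_tn).  So in the
    variables x_i and 1/x_i the lifted interpolation polynomial of mu satisfies the
    conditions that characterize the interpolation Laurent polynomial, and it is
    equal to it, or to zero when mu has more than n parts (sym_pm_lifted).  It is
    regular at T = t^n since the linear system that defines it stays nonsingular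
    there (lifted_eval_mx_unit); binomial coefficients are regular for the same
    reason.  Finally, k0_la vanishes at T = t^n exactly when la has more than n
    parts, and k0_la / k0_mu has no pole for mu inside la (reg_k0_ratio).  If la has
    at most n parts, the lifted sum therefore becomes the sum above; otherwise each
    of its terms becomes zero.

    The interpolation theory is developed for symmetric polynomials in
    z_i = x_i + 1/x_i.  Fixing the last variable and dividing by a product of linear
    factors, which removes a column from the diagrams, give inductions on the number
    of variables and on the weight; they prove nonsingularity and the formula for
    the diagonal values.  Extra vanishing follows from a difference operator that
    maps interpolation polynomials to interpolation polynomials.  On the side of
    symmetric functions, the homomorphism given on power sums makes sense because
    power sums generate freely in characteristic 0 (psums_indep, expandableU). *)

(** * Partitions, inclusion and dominance *)

Section Partitions.
Implicit Types (la mu nu : intpart) (s : seq nat).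
Local Open Scope nat_scope.

Lemma intpart_sorted la : sorted geq la.
Proof. by case: la => s /= /andP[]. Qed.

Lemma intpart_neq0 la : 0 \notin (la : seq nat).
Proof. by case: la => s /= /andP[]. Qed.

Lemma part_pos la i : 0 < i -> (0 < part la i) = (i <= size la).
Proof.
case: i => // i _; rewrite /part /=; apply/idP/idP => [|lt_i].
  by apply: contraTT; rewrite -ltnNge ltnS => ge_i; rewrite nth_default.
rewrite lt0n; apply/eqP => part0; have := intpart_neq0 la.
by rewrite -part0 mem_nth.
Qed.

Lemma part_default la i : size la < i -> part la i = 0.
Proof. by case: i => // i; rewrite ltnS => ?; rewrite /part nth_default. Qed.

Lemma leq_part la i j : 0 < i -> i <= j -> part la j <= part la i.
Proof.
case: i j => // i [|j] // _; rewrite ltnS => le_ij; rewrite /part /=.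
have [lt_j|ge_j] := ltnP j (size la); last by rewrite nth_default.
have trans_geq : transitive geq by move=> y x z /= xy /leq_trans; apply.
have refl_geq : reflexive geq by move=> x /=.
by apply: (sorted_leq_nth trans_geq refl_geq _ (intpart_sorted la)) => //;
  rewrite inE ?(leq_ltn_trans le_ij).
Qed.

Lemma part_inj la mu : (forall i, 0 < i -> part la i = part mu i) -> la = mu.
Proof.
move=> eq_part; apply/val_inj/(@eq_from_nth _ 0) => /= [|i _]; last first.
  exact: (eq_part i.+1).
apply/eqP; rewrite eqn_leq; apply/andP; split.
  have [->//|lt0] := posnP (size la); rewrite -part_pos // -eq_part //.
  by rewrite part_pos.
have [->//|lt0] := posnP (size mu); rewrite -part_pos // eq_part //.
by rewrite part_pos.
Qed.

Lemma leq_part_conj la i j : 0 < i -> 0 < j ->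
  (j <= part la i) = (i <= conj_part la j).
Proof.
case: i => // i _ j_gt0; rewrite /part /conj_part /=.
have := intpart_sorted la; elim: (la : seq nat) i => [|a s IHs] i /= path_s.
  by rewrite nth_nil leqNgt j_gt0.
have le_s : {in s, forall b, b <= a}.
  by apply/allP; apply: order_path_min path_s => y x z /= xy h; apply: leq_trans h xy.
case: i => [|i] /=.
  case: (leqP j a) => [_|lt_aj] //=; rewrite add0n.
  apply/esym/negbTE; rewrite -has_count.
  by apply/hasPn => b /le_s le_ba; rewrite -ltnNge (leq_ltn_trans le_ba).
rewrite IHs ?(path_sorted path_s) //; case: (leqP j a) => [_|lt_aj] //.
have -> : count (leq j) s = 0.
  apply/eqP; rewrite -leqn0 leqNgt -has_count; apply/hasPn => b /le_s le_ba.
  by rewrite -ltnNge (leq_ltn_trans le_ba).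
by rewrite ltn0.
Qed.

Lemma part_incl_conj mu la :
  part_incl mu la <-> forall j, 0 < j -> conj_part mu j <= conj_part la j.
Proof.
split=> [incl j j_gt0|le_conj i i_gt0].
  have [->//|c_gt0] := posnP (conj_part mu j).
  by rewrite -leq_part_conj // (leq_trans _ (incl _ _)) // leq_part_conj.
have [->//|p_gt0] := posnP (part mu i).
by rewrite leq_part_conj // (leq_trans _ (le_conj _ _)) // -leq_part_conj.
Qed.

Lemma part_incl_trans nu la mu :
  part_incl la nu -> part_incl nu mu -> part_incl la mu.
Proof. by move=> h1 h2 i i_gt0; apply: leq_trans (h1 i _) (h2 i _). Qed.

Lemma part_incl_anti la mu : part_incl la mu -> part_incl mu la -> la = mu.
Proof.
move=> h1 h2; apply: part_inj => i i_gt0.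
by apply/eqP; rewrite eqn_leq h1 ?h2.
Qed.

Lemma conj_inj la mu :
  (forall j, 0 < j -> conj_part la j = conj_part mu j) -> la = mu.
Proof.
by move=> eq_conj; apply: part_incl_anti; apply/part_incl_conj => j /eq_conj->.
Qed.

Lemma part_incl_size mu la : part_incl mu la -> size mu <= size la.
Proof.
move=> incl; have [->//|s_gt0] := posnP (size mu).
by rewrite -part_pos // (leq_trans _ (incl _ _)) // part_pos.
Qed.

Fact mkpart_subproof s : is_part (sort geq [seq x <- s | 0 < x]).
Proof.
rewrite /is_part mem_sort mem_filter ltnn /= andbT.
by apply: sort_sorted => x y /=; apply: leq_total.
Qed.

Definition mkpart s : intpart := IntPart (mkpart_subproof s).

Lemma conj_mkpart s j : 0 < j -> conj_part (mkpart s) j = count (leq j) s.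
Proof.
move=> j_gt0; rewrite /conj_part /=.
rewrite (seq.permP (permEl (perm_sort _ _))) count_filter; apply: eq_count => x /=.
by case: (leqP j x) => // le_jx; rewrite (leq_trans j_gt0).
Qed.

Lemma size_mkpart s : size (mkpart s) <= size s.
Proof. by rewrite /= size_sort size_filter count_size. Qed.

Lemma mkpart_eq s mu :
  (forall j, 0 < j -> count (leq j) s = conj_part mu j) -> mkpart s = mu.
Proof. by move=> eq_c; apply: conj_inj => j j_gt0; rewrite conj_mkpart ?eq_c. Qed.

Lemma mkpart_nseq0 la k : mkpart (la ++ nseq k 0) = la.
Proof.
apply: mkpart_eq => j j_gt0.
by rewrite count_cat count_nseq leqNgt j_gt0 mul0n addn0.
Qed.

Lemma mkpart_perm s1 s2 : perm_eq s1 s2 -> mkpart s1 = mkpart s2.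
Proof.
by move=> /seq.permP eq_c; apply: conj_inj => j j_gt0; rewrite !conj_mkpart.
Qed.

Lemma perm_mkpart s : perm_eq s (mkpart s ++ nseq (size s - size (mkpart s)) 0).
Proof.
have -> : nseq (size s - size (mkpart s)) 0 = [seq x <- s | ~~ (0 < x)].
  rewrite /= size_sort size_filter -(count_predC (leq 1) s) addKn.
  by elim: s => //= x s <-; case: x.
rewrite -{1}(perm_filterC (leq 1) s) perm_cat2r.
by rewrite perm_sym (permEl (perm_sort _ _)).
Qed.

Lemma mkpart_perm_eq s1 s2 : size s1 = size s2 -> mkpart s1 = mkpart s2 ->
  perm_eq s1 s2.
Proof.
move=> eq_sz eq_p; rewrite (perm_trans (perm_mkpart s1)) // eq_p eq_sz.
by rewrite perm_sym perm_mkpart.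
Qed.

Definition psum la k := \sum_(1 <= i < k.+1) part la i.

Lemma psumS la k : psum la k.+1 = psum la k + part la k.+1.
Proof. by rewrite /psum big_nat_recr. Qed.

Lemma psum0 la : psum la 0 = 0.
Proof. by rewrite /psum big_geq. Qed.

Lemma dom_leP mu la : dom_le mu la <-> forall k, psum mu k <= psum la k.
Proof. by split=> [h [|k]|h k _]; rewrite ?psum0 //; apply: h. Qed.

Lemma psum_weight la k : size la <= k -> psum la k = weight la.
Proof.
move=> le_k; rewrite /psum /weight sumnE.
rewrite big_add1 /= (big_cat_nat (n := size la)) //=.
rewrite [X in _ + X]big_nat [X in _ + X]big1 ?addn0; last first.
  by move=> i /andP[le_i _]; rewrite part_default.
by rewrite [RHS](big_nth 0).
Qed.

Lemma psum_conj la k M : part la 1 <= M ->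
  psum la k = \sum_(1 <= j < M.+1) minn k (conj_part la j).
Proof.
move=> le_M; rewrite /psum.
transitivity (\sum_(1 <= i < k.+1) \sum_(1 <= j < M.+1) (j <= part la i)).
  rewrite big_nat [RHS]big_nat; apply: eq_bigr => i /andP[i_gt0 _].
  have le_iM : part la i <= M by apply: leq_trans (leq_part _ _ _) le_M.
  rewrite (big_cat_nat (n := (part la i).+1)) //= [X in _ + X]big_nat.
  rewrite [X in _ + X]big1 ?addn0 => [|j /andP[lt_j _]]; last by rewrite leqNgt lt_j.
  rewrite big_nat (eq_bigr (fun=> 1)) => [|j /andP[_]]; last first.
    by rewrite ltnS => ->.
  by rewrite -big_nat sum_nat_const_nat muln1 subn1.
rewrite exchange_big_nat /=; rewrite big_nat [RHS]big_nat.
apply: eq_bigr => j /andP[j_gt0 _].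
rewrite big_nat (eq_bigr (fun i => (i <= conj_part la j) : nat)) => [|i /andP[? _]];
  last by rewrite leq_part_conj.
rewrite -big_nat; elim: k => [|k IHk]; first by rewrite big_geq ?min0n.
by rewrite big_nat_recr //= IHk; lia.
Qed.

Lemma psum_le_conj mu la :
  (forall j, 0 < j -> conj_part mu j <= conj_part la j) ->
  forall k, psum mu k <= psum la k.
Proof.
by move=> /part_incl_conj incl k; rewrite /psum !big_nat;
  apply: leq_sum => i /andP[? _]; apply: incl.
Qed.

Lemma incl_dom_le mu la : part_incl mu la -> dom_le mu la.
Proof. by move=> /part_incl_conj h; apply/dom_leP/psum_le_conj. Qed.

Lemma dom_le_refl la : dom_le la la.
Proof. by []. Qed.

Lemma dom_le_trans nu mu la : dom_le mu nu -> dom_le nu la -> dom_le mu la.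
Proof. by move=> h1 h2 k k_gt0; apply: leq_trans (h1 k _) (h2 k _). Qed.

Lemma psum_inj mu la : (forall k, psum mu k = psum la k) -> mu = la.
Proof.
move=> eq_psum; apply: part_inj => [[//|i]] _.
by apply/eqP; rewrite -(eqn_add2l (psum mu i)) -psumS eq_psum psumS eq_psum.
Qed.

Lemma dom_le_anti mu la : dom_le mu la -> dom_le la mu -> mu = la.
Proof.
move=> /dom_leP h1 /dom_leP h2; apply: psum_inj => k.
by apply/eqP; rewrite eqn_leq h1 h2.
Qed.

Lemma dom_le_weight mu la : dom_le mu la -> weight mu <= weight la.
Proof.
move=> /dom_leP le_p; have := le_p (maxn (size mu) (size la)).
by rewrite !psum_weight ?leq_maxl ?leq_maxr.
Qed.

Lemma dom_le_lt_trans nu mu la : dom_le mu nu -> dom_lt nu la -> dom_lt mu la.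
Proof.
move=> h1 [h2 ne]; split; first exact: dom_le_trans h1 h2.
by move=> eq_mu; apply: ne; apply: dom_le_anti => //; rewrite -eq_mu.
Qed.

Lemma dom_lt_trans nu mu la : dom_lt mu nu -> dom_lt nu la -> dom_lt mu la.
Proof. by move=> [h1 _]; apply: dom_le_lt_trans. Qed.

Lemma dom_le_eqVlt mu la : dom_le mu la -> mu = la \/ dom_lt mu la.
Proof. by move=> le; case: (eqVneq mu la) => [|/eqP ne]; [left|right]. Qed.

Lemma incl_dom_lt mu la : part_incl mu la -> mu <> la -> dom_lt mu la.
Proof. by move=> /incl_dom_le. Qed.

Lemma size_weight la : size la <= weight la.
Proof.
rewrite -(psum_weight (leqnn _)) /psum.
rewrite -[X in X <= _](_ : \sum_(1 <= i < (size la).+1) 1 = _); last first.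
  by rewrite sum_nat_const_nat muln1 subn1.
rewrite big_nat [X in _ <= X]big_nat; apply: leq_sum => i /andP[i_gt0 le_i].
by rewrite part_pos.
Qed.

Lemma part_weight la i : 0 < i -> part la i <= weight la.
Proof.
move=> i_gt0; rewrite -(psum_weight (leq_maxl (size la) i)).
have -> : i = i.-1.+1 by case: i i_gt0.
apply: leq_trans (_ : psum la i.-1.+1 <= _); first by rewrite psumS leq_addl.
rewrite /psum [X in _ <= X](big_cat_nat (n := i.-1.+2)) ?leq_addr //.
by rewrite ltnS leq_maxr.
Qed.

Lemma incl_weight mu la : part_incl mu la -> weight mu <= weight la.
Proof. by move=> /incl_dom_le/dom_le_weight. Qed.

Lemma incl_weight_eq mu la :
  part_incl mu la -> weight la <= weight mu -> mu = la.
Proof.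
move=> incl le_w; apply: part_inj => i i_gt0.
apply/eqP; rewrite eqn_leq incl //=; rewrite leqNgt; apply/negP => lt_i.
have le_sz := part_incl_size incl.
move: le_w; rewrite -!(psum_weight (leq_maxl _ i)) leqNgt => /negP; apply.
have le_mu : size mu <= maxn (size la) i by rewrite leq_max le_sz.
rewrite (psum_weight (leq_maxl _ _)) -(psum_weight le_mu).
rewrite /psum.
have in_i : i \in index_iota 1 (maxn (size la) i).+1.
  by rewrite mem_index_iota i_gt0 ltnS leq_maxr.
rewrite !(big_rem i in_i) /= -addSn leq_add //.
rewrite !big_seq; apply: leq_sum => j /mem_rem.
by rewrite mem_index_iota => /andP[j_gt0 _]; apply: incl.
Qed.

Definition rank N la := \sum_(0 <= k < N.+1) psum la k.

(** This makes induction along dominance possible, also between partitions of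
    different weights. *)
Lemma rank_lt N mu la : weight la <= N -> dom_lt mu la -> rank N mu < rank N la.
Proof.
move=> le_N [le_mu ne]; have /dom_leP le_p := le_mu.
have w_mu := dom_le_weight le_mu.
rewrite ltn_neqAle; apply/andP; split; last first.
  by rewrite /rank; apply: leq_sum => k _; apply: le_p.
apply/eqP => eq_r; apply: ne; apply: psum_inj => k.
have [le_k|lt_k] := leqP k N; last first.
  rewrite !psum_weight.
  + apply/eqP; rewrite eqn_leq w_mu /= -(@psum_weight la N).
      rewrite -(@psum_weight mu N); last by rewrite (leq_trans (size_weight _)) ?(leq_trans w_mu).
      have /eqP := eq_r; rewrite /rank !big_nat_recr //=.
      have := leq_sum (index_iota 0 N) (P := xpredT) (fun k _ => le_p k).
      by have := le_p N; lia.
    exact: leq_trans (size_weight _) le_N.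
  + by apply: leq_trans (size_weight _) (leq_trans le_N (ltnW lt_k)).
  + by apply: leq_trans (size_weight _) (leq_trans w_mu (leq_trans le_N (ltnW lt_k))).
apply/eqP; rewrite eqn_leq le_p /=.
have in_k : k \in index_iota 0 N.+1 by rewrite mem_index_iota ltnS.
have rank_rem nu : rank N nu = psum nu k
    + \sum_(j <- rem k (index_iota 0 N.+1)) psum nu j.
  by rewrite /rank (big_rem k in_k).
move: eq_r; rewrite !rank_rem.
have := leq_sum (rem k (index_iota 0 N.+1)) (P := xpredT) (fun k _ => le_p k).
by lia.
Qed.

Definition as_bool (P : Prop) : bool :=
  if excluded_middle_informative P then true else false.

Lemma as_boolP P : reflect P (as_bool P).
Proof. by rewrite /as_bool; case: excluded_middle_informative => h; constructor. Qed.

Fact box_subproof w : is_part (nseq w w).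
Proof.
rewrite /is_part mem_nseq; case: w => //= w; rewrite andbT.
by elim: w w.+1 => //= w IHw a; rewrite leqnn IHw.
Qed.

Definition box w := IntPart (box_subproof w).

Lemma incl_box w la : weight la <= w -> part_incl la (box w).
Proof.
move=> le_w i i_gt0; rewrite /part [box _ : seq nat]/= nth_nseq.
case: ltnP => [_|ge]; first exact: leq_trans (part_weight _ i_gt0) le_w.
rewrite nth_default // (leq_trans (size_weight _)) //.
by rewrite (leq_trans le_w).
Qed.

(** Lists of partitions index the square matrices below; a bound on the weight
    makes any class of partitions finite. *)
Definition parts_with w (P : intpart -> Prop) : seq intpart :=
  [seq mu <- subparts (box w) | as_bool (P mu /\ weight mu <= w)].

Lemma parts_with_uniq w P : uniq (parts_with w P).
Proof. by rewrite filter_uniq ?subparts_uniq. Qed.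

Lemma mem_parts_with w P mu :
  reflect (P mu /\ weight mu <= w) (mu \in parts_with w P).
Proof.
rewrite mem_filter; apply: (iffP andP) => [[/as_boolP//]|h].
by split; [apply/as_boolP|apply/mem_subparts/incl_box; case: h].
Qed.

Definition mnm_part n la : 'X_{1..n} := [multinom part la i.+1 | i < n].
Definition part_mnm n (m : 'X_{1..n}) : intpart := mkpart m.

Lemma count_mnm n (m : 'X_{1..n}) (a : pred nat) :
  count a m = \sum_(i < n) a (m i).
Proof.
rewrite -sum1_count big_mkcond big_tuple /=.
by apply: eq_bigr => i _; rewrite -mnm_tnth; case: (a _).
Qed.

Lemma conj_part_mnm n (m : 'X_{1..n}) j : 0 < j ->
  conj_part (part_mnm m) j = \sum_(i < n) (j <= m i).
Proof. by move=> j_gt0; rewrite conj_mkpart // count_mnm. Qed.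

Lemma size_part_mnm n (m : 'X_{1..n}) : size (part_mnm m) <= n.
Proof. by apply: leq_trans (size_mkpart _) _; rewrite size_tuple. Qed.

Lemma val_mnm_part n la : size la <= n ->
  mnm_part n la = la ++ nseq (n - size la) 0 :> seq nat.
Proof.
move=> le_n; apply: (@eq_from_nth _ 0).
  by rewrite size_tuple size_cat size_nseq subnKC.
rewrite size_tuple => i lt_i.
rewrite -(mnm_nth 0 _ (Ordinal lt_i)) mnmE /part /= nth_cat nth_nseq.
by case: ltnP => // ge; rewrite nth_default //; case: ifP.
Qed.

Lemma mnm_partK n la : size la <= n -> part_mnm (mnm_part n la) = la.
Proof. by move=> le_n; rewrite /part_mnm val_mnm_part ?mkpart_nseq0. Qed.

Lemma part_mnm_incl n (m1 m2 : 'X_{1..n}) :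
  (forall i, m1 i <= m2 i) -> part_incl (part_mnm m1) (part_mnm m2).
Proof.
move=> le_m; apply/part_incl_conj => j j_gt0; rewrite !conj_part_mnm //.
apply: leq_sum => i _; case: (leqP j (m1 i)) => // le_j.
by rewrite (leq_trans le_j (le_m i)).
Qed.

Lemma part_mnm_perm n (m : 'X_{1..n}) (s : 'S_n) :
  part_mnm [multinom m (s i) | i < n] = part_mnm m.
Proof.
apply: conj_inj => j j_gt0; rewrite !conj_part_mnm //.
rewrite [RHS](reindex_inj (@perm_inj _ s)).
by apply: eq_bigr => i _; rewrite mnmE.
Qed.

Lemma part_mnm_eq n (m1 m2 : 'X_{1..n}) : part_mnm m1 = part_mnm m2 ->
  exists s : 'S_n, m1 = [multinom m2 (s i) | i < n].
Proof.
move=> eq_p; have : perm_eq m1 m2.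
  by apply: mkpart_perm_eq; rewrite ?size_tuple.
case/tuple_permP => s eq_m; exists s; apply/mnmP => i.
by rewrite mnmE (mnm_nth 0) eq_m -tnth_nth tnth_mktuple.
Qed.

Lemma mdeg_part_mnm n (m : 'X_{1..n}) : weight (part_mnm m) = mdeg m.
Proof.
rewrite /weight /mdeg sumnE (perm_big _ (perm_mkpart m)) big_cat /=.
by rewrite [X in _ + X]big1_seq ?addn0 // => i /andP[_ /nseqP[]].
Qed.

(** Sorting can only increase the sum of the first k entries. Both sides are
    counted column by column of the diagram. *)
Lemma sub_psum n (m : 'X_{1..n}) k :
  \sum_(i < n | i < k) m i <= psum (part_mnm m) k.
Proof.
pose M := part (part_mnm m) 1 + \sum_(i < n) m i.
rewrite (@psum_conj _ _ M) ?leq_addr //.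
have le_M i : m i <= M by rewrite /M (bigD1 i) //= addnCA leq_addr.
apply: leq_trans (_ : \sum_(i < n | i < k) \sum_(1 <= j < M.+1) (j <= m i) <= _).
  apply: leq_sum => i _.
  rewrite (big_cat_nat (n := (m i).+1)) ?ltnS ?le_M //=.
  rewrite big_nat (eq_bigr (fun=> 1)) => [|j /andP[_]]; last first.
    by rewrite ltnS => ->.
  by rewrite -big_nat sum_nat_const_nat muln1 subn1 leq_addr.
rewrite exchange_big /= [X in X <= _]big_nat [X in _ <= X]big_nat.
apply: leq_sum => j /andP[j_gt0 _]; rewrite conj_part_mnm // leq_min.
apply/andP; split; last first.
  by rewrite big_mkcond; apply: leq_sum => i _; case: ifP.
apply: leq_trans (_ : \sum_(i < n | i < k) 1 <= _).
  by apply: leq_sum => i _; case: (j <= m i).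
elim: n {m M le_M j j_gt0} k => [|n IHn] k; first by rewrite big_ord0.
rewrite big_mkcond big_ord_recl; case: k => [|k].
  by rewrite big1 // => i _.
by rewrite /= add1n ltnS -big_mkcond; apply: IHn.
Qed.

Lemma part_mnm_sorted n (m : 'X_{1..n}) :
  (forall i j : 'I_n, i <= j -> m j <= m i) ->
  forall i : 'I_n, part (part_mnm m) i.+1 = m i.
Proof.
move=> m_dec i; apply/eqP.
suff eq_le j : 0 < j -> (j <= part (part_mnm m) i.+1) = (j <= m i).
  rewrite eqn_leq; apply/andP; split.
    by case: (posnP (part (part_mnm m) i.+1)) => [->//|gt0]; rewrite -eq_le.
  by case: (posnP (m i)) => [->//|gt0]; rewrite eq_le.
move=> j_gt0; rewrite leq_part_conj // conj_part_mnm //.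
have sum_lt k : k <= n -> \sum_(l < n | l < k) 1 = k.
  elim: {i m m_dec} n k => [|n IHn] k; first by rewrite leqn0 big_ord0 => /eqP.
  rewrite big_mkcond big_ord_recl; case: k => [|k] le_k.
    by rewrite big1 // => i _.
  by rewrite /= add1n -big_mkcond; congr _.+1; apply: IHn.
case: (leqP j (m i)) => [le_j|lt_j].
  rewrite -(sum_lt i.+1 (ltn_ord i)) big_mkcond; apply: leq_sum => k _.
  by case: ltnP => //; rewrite ltnS => /m_dec/(leq_trans le_j)->.
apply/negbTE; rewrite -leqNgt -[X in _ <= X](sum_lt i (ltnW (ltn_ord i))).
rewrite [X in _ <= X]big_mkcond; apply: leq_sum => k _.
case: ltnP => [_|/m_dec le_k]; first by case: (j <= m k).
by rewrite leqn0 eqb0 -ltnNge (leq_ltn_trans le_k lt_j).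
Qed.

Lemma conj_part_sum N la j : 0 < j -> size la <= N ->
  conj_part la j = \sum_(i < N) (j <= part la i.+1).
Proof.
move=> j_gt0 le_N; rewrite -{1}(mnm_partK le_N) conj_part_mnm //.
by apply: eq_bigr => i _; rewrite mnmE.
Qed.

(** The diagram of la with a column of height N put in front. *)
Definition addcol N la : intpart :=
  part_mnm [multinom (part la i.+1).+1 | i < N].

Lemma part_addcol N la (i : 'I_N) : part (addcol N la) i.+1 = (part la i.+1).+1.
Proof.
by rewrite part_mnm_sorted ?mnmE // => k l le_kl; rewrite !mnmE ltnS leq_part.
Qed.

Lemma size_addcol N la : size (addcol N la) <= N.
Proof. exact: size_part_mnm. Qed.

Lemma addcol_incl N mu la :
  part_incl mu la -> part_incl (addcol N mu) (addcol N la).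
Proof. by move=> incl; apply: part_mnm_incl => i; rewrite !mnmE ltnS incl. Qed.

Lemma addcol_part_mnm N (m : 'X_{1..N}) :
  addcol N (part_mnm m) = part_mnm [multinom (m i).+1 | i < N].
Proof.
apply: conj_inj => -[//|j] _; rewrite !conj_part_mnm //.
under eq_bigr do rewrite mnmE; under [RHS]eq_bigr do rewrite mnmE ltnS.
case: j => [|j]; first by [].
under eq_bigr do rewrite ltnS.
by rewrite -conj_part_mnm // -conj_part_sum ?size_part_mnm.
Qed.

Lemma weight_mnm N la : size la <= N -> weight la = \sum_(i < N) part la i.+1.
Proof.
move=> le_N; rewrite -{1}(mnm_partK le_N) mdeg_part_mnm mdegE.
by apply: eq_bigr => i _; rewrite mnmE.
Qed.

Lemma weight_addcol N la : size la <= N -> weight (addcol N la) = weight la + N.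
Proof.
move=> le_N; rewrite !(@weight_mnm N) ?size_addcol //.
under eq_bigr do rewrite part_addcol -addn1.
by rewrite big_split /= sum1_card card_ord.
Qed.

Lemma addcol_dom_le N mu la : size mu <= N -> size la <= N ->
  dom_le (addcol N mu) (addcol N la) <-> dom_le mu la.
Proof.
move=> le_mu le_la.
have psum_add nu k : size nu <= N -> k <= N -> psum (addcol N nu) k = psum nu k + k.
  move=> le_nu; elim: k => [|k IHk] lt_k; first by rewrite !psum0.
  by rewrite !psumS IHk ?(ltnW lt_k) // (part_addcol _ (Ordinal lt_k)) /=; lia.
have psum_big nu k : size nu <= N -> N <= k -> psum nu k = psum nu N.
  by move=> le_nu le_k; rewrite !psum_weight // (leq_trans le_nu).
split=> /dom_leP h; apply/dom_leP => k; case: (leqP k N) => [le_k|/ltnW le_k].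
- by have := h k; rewrite !psum_add // leq_add2r.
- by rewrite !(@psum_big _ k) //; have := h N; rewrite !psum_add // leq_add2r.
- by rewrite !psum_add // leq_add2r.
by rewrite !(@psum_big _ k) ?size_addcol // !psum_add // leq_add2r.
Qed.

Lemma addcol_inj N mu la : size mu <= N -> size la <= N ->
  addcol N mu = addcol N la -> mu = la.
Proof.
move=> le_mu le_la eq_a; apply: dom_le_anti; apply/(@addcol_dom_le N) => //;
by rewrite eq_a.
Qed.

Lemma addcol_dom_lt N mu la : size mu <= N -> size la <= N ->
  dom_lt (addcol N mu) (addcol N la) <-> dom_lt mu la.
Proof.
move=> le_mu le_la; split=> -[h1 h2]; split.
- by apply/(@addcol_dom_le N).
- by move=> eq_mu; apply: h2; rewrite eq_mu.
- exact/addcol_dom_le.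
by move/addcol_inj => eq_a; apply: h2; apply: eq_a.
Qed.

Lemma addcol_surj N la : size la = N -> exists2 mu : intpart, size mu <= N & la = addcol N mu.
Proof.
move=> sz_la; exists (part_mnm [multinom (part la i.+1).-1 | i < N]).
  exact: size_part_mnm.
rewrite addcol_part_mnm -[LHS](mnm_partK (eq_leq sz_la)); congr part_mnm.
apply/mnmP => i; rewrite !mnmE prednK // part_pos ?sz_la //.
Qed.

End Partitions.

(** * Substitution and divisibility in several variables *)

Section MpolyTools.

Lemma mpoly_ring_ind (A : nzRingType) n (P : {mpoly A[n]} -> Prop) :
  (forall c, P c%:MP) -> (forall i, P 'X_i) ->
  (forall p p', P p -> P p' -> P (p + p')) ->
  (forall p p', P p -> P p' -> P (p * p')) -> forall p, P p.
Proof.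
move=> PC PX PD PM p; rewrite [p]mpolyE.
elim/big_ind: _ => [||m _]; [rewrite -mpolyC0; exact: PC|exact: PD|].
rewrite -mul_mpolyC; apply: (PM _ _ (PC _)); rewrite mpolyXE_id.
elim/big_ind: _ => [||i _]; [rewrite -mpolyC1; exact: PC|exact: PM|].
by elim: (m i) => [|k IHk]; rewrite ?expr0 -?mpolyC1 ?exprS; [apply: PC|apply: PM].
Qed.

Section Comp.
Variable A : comNzRingType.

Lemma comp_mpolyU n k (T : n.-tuple {mpoly A[k]}) i : 'X_i \mPo T = tnth T i.
Proof. by rewrite comp_mpolyXU -tnth_nth. Qed.

Lemma comp_mpolyM n k (T : n.-tuple {mpoly A[k]}) p p' :
  (p * p') \mPo T = (p \mPo T) * (p' \mPo T).
Proof. exact: rmorphM. Qed.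

Lemma comp_mpolyA n k l (T : n.-tuple {mpoly A[k]}) (T' : k.-tuple {mpoly A[l]}) p :
  (p \mPo T) \mPo T' = p \mPo [tuple tnth T i \mPo T' | i < n].
Proof.
elim/mpoly_ring_ind: p => [c|i|p p' IHp IHp'|p p' IHp IHp'].
- by rewrite !comp_mpolyC.
- by rewrite !comp_mpolyU tnth_mktuple.
- by rewrite !comp_mpolyD IHp IHp'.
by rewrite !comp_mpolyM IHp IHp'.
Qed.

Lemma msym_comp n k (T : n.-tuple {mpoly A[k]}) p (s : 'S_k) :
  msym s (p \mPo T) = p \mPo [tuple msym s (tnth T i) | i < n].
Proof.
elim/mpoly_ring_ind: p => [c|i|p p' IHp IHp'|p p' IHp IHp'].
- by rewrite !comp_mpolyC /msym mmapC.
- by rewrite !comp_mpolyU tnth_mktuple.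
- by rewrite !comp_mpolyD msymD IHp IHp'.
by rewrite !comp_mpolyM msymM IHp IHp'.
Qed.

Lemma msymU n (s : 'S_n) i : msym s 'X_i = 'X_(s i) :> {mpoly A[n]}.
Proof. by rewrite /msym mmapX mmap1U. Qed.

Lemma msymC n (s : 'S_n) c : msym s c%:MP = c%:MP :> {mpoly A[n]}.
Proof. by rewrite /msym mmapC. Qed.

Lemma msym_prod n (s : 'S_n) I (r : seq I) (P : pred I) (F : I -> {mpoly A[n]}) :
  msym s (\prod_(i <- r | P i) F i) = \prod_(i <- r | P i) msym s (F i).
Proof. exact: rmorph_prod. Qed.

Lemma eq_comp_mpoly n k (T T' : n.-tuple {mpoly A[k]}) p :
  (forall i, tnth T i = tnth T' i) -> p \mPo T = p \mPo T'.
Proof. by move=> /eq_from_tnth->. Qed.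

Definition substX n (i : 'I_n) (r : {mpoly A[n]}) :=
  [tuple if j == i then r else 'X_j | j < n].

Lemma tnth_substX n (i j : 'I_n) r :
  tnth (substX i r) j = if j == i then r else 'X_j.
Proof. by rewrite tnth_mktuple. Qed.

(** The remainder of the division by a polynomial that is monic of degree one
   in the i-th variable is the result of a substitution. *)
Lemma substX_dvd n (i : 'I_n) (r p : {mpoly A[n]}) :
  exists g, p - (p \mPo substX i r) = ('X_i - r) * g.
Proof.
elim/mpoly_ring_ind: p => [c|j|p p' [g Hg] [g' Hg']|p p' [g Hg] [g' Hg']].
- by exists 0; rewrite comp_mpolyC subrr mulr0.
- rewrite comp_mpolyU tnth_substX; case: eqP => [->|_].
    by exists 1; rewrite mulr1.
  by exists 0; rewrite subrr mulr0.
- by exists (g + g'); rewrite comp_mpolyD mulrDr -Hg -Hg' opprD addrACA.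
exists (g * p' + (p \mPo substX i r) * g'); rewrite comp_mpolyM.
have -> : p * p' - (p \mPo substX i r) * (p' \mPo substX i r)
  = (p - (p \mPo substX i r)) * p' + (p \mPo substX i r) * (p' - (p' \mPo substX i r)).
  by ring.
by rewrite Hg Hg'; ring.
Qed.

End Comp.

(** Here ev i is reduction modulo lin i. As it is multiplicative and kills no
    other factor, the factors can be divided out one at a time. *)
Lemma prod_dvd (I : eqType) (A : idomainType) (s : seq I) (lin : I -> A)
    (ev : I -> A -> A) (p : A) :
  uniq s ->
  (forall i x y, ev i (x * y) = ev i x * ev i y) ->
  (forall i x, i \in s -> ev i x = 0 -> exists g, x = lin i * g) ->
  (forall i j, i \in s -> j \in s -> i != j -> ev j (lin i) != 0) ->
  (forall i, i \in s -> ev i p = 0) ->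
  exists g, p = (\prod_(i <- s) lin i) * g.
Proof.
move=> uniq_s evM; elim: s uniq_s p => [|i s IHs] /=.
  by move=> _ p _ _ _; exists p; rewrite big_nil mul1r.
case/andP=> i_s uniq_s p dvd_lin ev_neq0 ev0.
have [g def_p] := dvd_lin i p (mem_head _ _) (ev0 i (mem_head _ _)).
have in_s j : j \in s -> j \in i :: s by rewrite inE orbC => ->.
have [|||g' def_g] := IHs uniq_s g.
- by move=> j x /in_s; apply: dvd_lin.
- by move=> j k /in_s j_s /in_s k_s; apply: ev_neq0.
- move=> j j_s; have /eqP := ev0 j (in_s _ j_s).
  rewrite def_p evM mulf_eq0 => /orP[/eqP ev_i|/eqP //].
  have /negP[] := ev_neq0 i j (mem_head _ _) (in_s _ j_s) (memPnC i_s _ j_s).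
  exact/eqP.
by exists g'; rewrite big_cons def_p def_g mulrA.
Qed.

Lemma mnm_add_ones n (m : 'X_{1..n}) :
  (m + \sum_(i <- enum 'I_n) U_(i))%MM = [multinom (m i).+1 | i < n].
Proof.
apply/mnmP => i; rewrite mnmDE mnm_sumE !mnmE big_enum /= (bigD1 i) //=.
by rewrite mnm1E eqxx big1 ?addn0 ?addn1 // => j ne; rewrite mnm1E (negPf ne).
Qed.

Section Support.
Variables (A : idomainType) (n : nat) (c : A).
Implicit Types (p g : {mpoly A[n]}) (Q : 'X_{1..n} -> Prop).

(** Were the bound violated, comparing coefficients would propagate a nonzero
    coefficient of g to arbitrarily high powers of the i-th variable. *)
Lemma msupp_div1 (i : 'I_n) Q p g :
  (forall m m', (m <= m')%MM -> Q m' -> Q m) ->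
  p = ('X_i - c%:MP) * g -> (forall m, m \in msupp p -> Q m) ->
  forall m, m \in msupp g -> Q (m + U_(i))%MM.
Proof.
move=> Qdown def_p Qp m m_g; case: (as_boolP (Q (m + U_(i))%MM)) => // nQ.
have coefE k : g@_(m + U_(i) *+ k) = c * g@_(m + U_(i) *+ k.+1).
  have : p@_(m + U_(i) *+ k.+1) = 0.
    apply/eqP; rewrite mcoeff_eq0; apply/negP => /Qp Q1; apply: nQ.
    apply: Qdown Q1; apply/mnm_lepP => j; rewrite !mnmDE mulmnE.
    by rewrite leq_add2l leq_pmulr.
  have -> : p = g * 'X_i - c%:MP * g by rewrite def_p mulrBl mulrC.
  have -> : (m + U_(i) *+ k.+1 = U_(i) + (m + U_(i) *+ k))%MM.
    by rewrite mulmS !addmA [(m + _)%MM]addmC.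
  by rewrite mcoeffB mcoeffMX mcoeffCM => /eqP; rewrite subr_eq0 => /eqP.
have coefk k : g@_m = c ^+ k * g@_(m + U_(i) *+ k).
  elim: k => [|k IHk]; first by rewrite mulm0n addm0 mul1r.
  by rewrite IHk coefE mulrA -exprSr.
move: m_g; rewrite mcoeff_msupp (coefk (msize g)) memN_msupp_eq0 ?mulr0 ?eqxx //.
by apply: msize_mdeg_ge; rewrite mdegD mdegMn mdeg1 mul1n leq_addl.
Qed.

Lemma msupp_divs (s : seq 'I_n) Q p g :
  (forall m m', (m <= m')%MM -> Q m' -> Q m) ->
  p = (\prod_(i <- s) ('X_i - c%:MP)) * g -> (forall m, m \in msupp p -> Q m) ->
  forall m, m \in msupp g -> Q (m + \sum_(i <- s) U_(i))%MM.
Proof.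
elim: s Q p g => [|i s IHs] Q p g Qdown def_p Qp m m_g.
  by rewrite big_nil addm0; apply: Qp; rewrite def_p big_nil mul1r.
rewrite big_cons addmC -addmA [(_ + m)%MM]addmC [(U_(i) + _)%MM]addmC.
pose Q' m := Q (m + U_(i))%MM.
apply: (IHs Q' _ g _ erefl) => // [m1 m2 le_m|m' m'_g].
  apply: Qdown; apply/mnm_lepP => j; rewrite !mnmDE leq_add2r.
  by move/mnm_lepP: le_m.
by apply: (msupp_div1 Qdown _ Qp m'_g); rewrite def_p big_cons mulrA.
Qed.
End Support.
End MpolyTools.

(** * Interpolation points and nonsingularity *)

Section Points.
Variable R : fieldType.
Implicit Types (q t a b c : R).

Definition mindep q t c := [/\ q != 0, t != 0, c != 0 &
  forall i j k : int, q ^ i * t ^ j * c ^ k = 1 -> [/\ i = 0, j = 0 & k = 0]].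

Lemma mindep_mul q t c (i j : int) : mindep q t c -> mindep q t (q ^ i * t ^ j * c).
Proof.
case=> q0 t0 c0 ind; split=> //; first by rewrite !mulf_neq0 // expfz_neq0.
move=> i' j' k; rewrite !exprzMl ?unitfE ?expfz_neq0 ?mulf_neq0 ?expfz_neq0 //.
rewrite !exprz_exp => eq1.
have := ind (i' + i * k) (j' + j * k) k; rewrite !expfzDr //.
case; first by rewrite -eq1; ring.
by move=> e1 e2 e3; move: e1 e2; rewrite e3 !mulr0 !addr0.
Qed.

Lemma mindep_neq1 q t c (i j k : int) : mindep q t c ->
  ~~ [&& i == 0, j == 0 & k == 0] -> q ^ i * t ^ j * c ^ k != 1.
Proof.
case=> _ _ _ ind; apply: contra => /eqP/ind[-> -> ->]; by rewrite !eqxx.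
Qed.

Definition ypt q t n (mu : intpart) (i : 'I_n) : R :=
  q ^+ part mu i.+1 * t ^+ (n - i.+1).

(** With a and b kept independent, fixing the last variable, removing a column
    and the difference operator used for extra vanishing all lead to points of
    the same kind. The points q^mu_i t^(n-i) s and their inverses are the case
    a = s, b = 1/s. *)
Definition zpt q t a b n (mu : intpart) (i : 'I_n) : R :=
  a * ypt q t mu i + b / ypt q t mu i.

Definition admissible q t a b := [/\ a != 0, b != 0 & mindep q t (a / b)].

Lemma admissible_mul q t a b (i j k l : int) : admissible q t a b ->
  admissible q t (q ^ i * t ^ j * a) (q ^ k * t ^ l * b).
Proof.
case=> a0 b0 ind; have [q0 t0 _ _] := ind.
split; rewrite ?mulf_neq0 ?expfz_neq0 //.
have := mindep_mul (i - k) (j - l) ind.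
rewrite !expfzDr // -!invr_expz !invfM.
by congr mindep; ring.
Qed.

Section Adm.
Variables (q t a b : R).
Hypothesis adm : admissible q t a b.

Let q0 : q != 0. Proof. by case: adm => _ _ []. Qed.
Let t0 : t != 0. Proof. by case: adm => _ _ []. Qed.
Let a0 : a != 0. Proof. by case: adm. Qed.
Let b0 : b != 0. Proof. by case: adm. Qed.

Lemma ypt_neq0 n mu (i : 'I_n) : ypt q t mu i != 0.
Proof. by rewrite mulf_neq0 ?expf_neq0. Qed.

Lemma adm_neq (i j k : int) : ~~ [&& i == 0, j == 0 & k == 0] ->
  q ^ i * t ^ j * (a / b) ^ k != 1.
Proof. by case: adm => _ _ ind; apply: mindep_neq1. Qed.

Lemma ypt_neq n mu nu (i j : 'I_n) :
  (i != j) || (part mu i.+1 != part nu i.+1) -> ypt q t mu i != ypt q t nu j.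
Proof.
move=> ne.
have := adm_neq (i := (part mu i.+1)%:Z - (part nu j.+1)%:Z)
   (j := (n - i.+1)%:Z - (n - j.+1)%:Z) (k := 0).
have -> : ~~ [&& (part mu i.+1)%:Z - (part nu j.+1)%:Z == 0,
   (n - i.+1)%:Z - (n - j.+1)%:Z == 0 & 0 == 0 :> int].
  apply: contraL ne => /and3P[/eqP e1 /eqP e2 _].
  have eq_ij : i = j.
    by apply/ord_inj; have := ltn_ord i; have := ltn_ord j; move: e2; lia.
  by rewrite eq_ij eqxx /= negbK; move: e1; rewrite eq_ij; lia.
move=> /(_ isT); apply: contra_neq => eq_y.
rewrite expr0z mulr1 !expfzDr // -!invr_expz mulrACA -invfM.
by rewrite -[X in X / _]/(ypt q t mu i) -[X in _ / X]/(ypt q t nu j)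
  eq_y mulfV // ypt_neq0.
Qed.

Lemma ypt_neq1 n mu (i : 'I_n) : (0 < part mu i.+1)%N -> ypt q t mu i != 1.
Proof.
move=> p_gt0.
have := adm_neq (i := part mu i.+1) (j := (n - i.+1)%N) (k := 0).
rewrite expr0z mulr1; apply; apply/negP => /and3P[/eqP e1 _ _]; lia.
Qed.

Lemma adm_ypt (i j : int) (k : nat) : (0 < k)%N ->
  a ^+ k * (q ^ i * t ^ j) != b ^+ k.
Proof.
move=> k0; have := adm_neq (i := i) (j := j) (k := k).
have -> : ~~ [&& i == 0, j == 0 & k%:Z == 0].
  by apply/negP => /and3P[_ _ /eqP]; lia.
move=> /(_ isT); apply: contra_neq => eq_ab.
rewrite -exprnP expr_div_n mulrA [_ * a ^+ k]mulrC eq_ab mulfV //.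
by rewrite expf_neq0.
Qed.

End Adm.

Lemma zpt_neq_last q t a b n mu (i : 'I_n) : admissible q t a b ->
  (0 < part mu i.+1)%N -> zpt q t a b mu i != a + b.
Proof.
move=> adm p_gt0; have y0 := ypt_neq0 adm mu i.
rewrite -subr_eq0 /zpt.
have -> : a * ypt q t mu i + b / ypt q t mu i - (a + b)
  = (ypt q t mu i - 1) * (a * ypt q t mu i - b) / ypt q t mu i.
  by field.
rewrite !mulf_neq0 ?invr_neq0 // subr_eq0.
  exact: (ypt_neq1 adm).
by have := adm_ypt adm (part mu i.+1) (n - i.+1)%N (k := 1) isT; rewrite !expr1.
Qed.

Lemma zpt_addcol q t a b n mu (i : 'I_n) : q != 0 ->
  zpt q t a b (addcol n mu) i = zpt q t (q * a) (b / q) mu i.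
Proof.
move=> q0; rewrite /zpt /ypt part_addcol exprS.
have -> : q * a * (q ^+ part mu i.+1 * t ^+ (n - i.+1))
  = a * (q * q ^+ part mu i.+1 * t ^+ (n - i.+1)) by ring.
by congr (_ + _); rewrite -!mulrA -!invfM mulrA.
Qed.

Lemma zpt_widen q t a b n mu (i : 'I_n) : t != 0 ->
  zpt q t a b mu (widen_ord (leqnSn n) i) = zpt q t (t * a) (b / t) mu i.
Proof.
move=> t0; rewrite /zpt /ypt /= subSn ?ltn_ord // exprS.
have -> : t * a * (q ^+ part mu i.+1 * t ^+ (n - i.+1))
  = a * (q ^+ part mu i.+1 * (t * t ^+ (n - i.+1))) by ring.
by congr (_ + _); rewrite -!mulrA -!invfM; congr (_ / _); ring.
Qed.

Lemma zpt_last q t a b n (mu : intpart) : (size mu <= n)%N ->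
  zpt q t a b mu (ord_max : 'I_n.+1) = a + b.
Proof.
move=> le_n; rewrite /zpt /ypt part_default //= subnn expr0 mulr1.
by rewrite mulr1 divr1.
Qed.

Definition fix_last n c : (n.+1).-tuple {mpoly R[n]} :=
  [tuple if unlift ord_max i is Some j then 'X_j else c%:MP | i < n.+1].

Definition restr n c (F : {mpoly R[n.+1]}) : {mpoly R[n]} := F \mPo fix_last n c.

Lemma lift_max_widen n (i : 'I_n) : fintype.lift ord_max i = widen_ord (leqnSn n) i.
Proof. by apply/ord_inj; rewrite lift_max. Qed.

Lemma tnth_fix_last n c (i : 'I_n) :
  tnth (fix_last n c) (widen_ord (leqnSn n) i) = 'X_i.
Proof. by rewrite tnth_mktuple -lift_max_widen liftK. Qed.

Lemma tnth_fix_max n c : tnth (fix_last n c) ord_max = c%:MP.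
Proof. by rewrite tnth_mktuple unlift_none. Qed.

Lemma restr_sym n c (F : {mpoly R[n.+1]}) :
  F \is symmetric -> restr c F \is symmetric.
Proof.
move=> /issymP symF; apply/issymP => s; rewrite /restr msym_comp.
rewrite -{2}(symF (lift_perm ord_max ord_max s)) msym_mPo.
apply: eq_comp_mpoly => i; rewrite !tnth_mktuple.
case: (unliftP ord_max i) => [j ->|->].
  by rewrite lift_perm_lift liftK msymU.
by rewrite lift_perm_id unlift_none msymC.
Qed.

Lemma restr_meval n c (F : {mpoly R[n.+1]}) (v : 'I_n.+1 -> R) :
  v ord_max = c ->
  (restr c F).@[fun i => v (widen_ord (leqnSn n) i)] = F.@[v].
Proof.
move=> v_max; rewrite comp_mpoly_meval; apply: meval_eq => i.
rewrite tnth_mktuple; case: (unliftP ord_max i) => [j ->|->].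
  by rewrite mevalXU lift_max_widen.
by rewrite mevalC.
Qed.

Definition mnm_widen n (m : 'X_{1..n.+1}) : 'X_{1..n} :=
  [multinom m (widen_ord (leqnSn n) i) | i < n].

Lemma restrE n c (F : {mpoly R[n.+1]}) :
  restr c F = \sum_(m <- msupp F) (F@_m * c ^+ m ord_max) *: 'X_[mnm_widen m].
Proof.
rewrite {1}[F]mpolyE /restr raddf_sum; apply: eq_bigr => m _.
rewrite [LHS]comp_mpolyZ comp_mpolyX big_ord_recr /= tnth_fix_max.
rewrite -scalerA; congr (_ *: _); rewrite -rmorphXn mulrC mul_mpolyC mpolyXE_id.
congr (_ *: _); apply: eq_bigr => i _.
by rewrite tnth_fix_last mnmE.
Qed.

Lemma msupp_restr n c (F : {mpoly R[n.+1]}) m : m \in msupp (restr c F) ->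
  exists2 m', m' \in msupp F & m = mnm_widen m'.
Proof.
rewrite restrE => /msupp_sum_le/flattenP[l /mapP[m']].
rewrite filter_predT => m'_F -> /msuppZ_le; rewrite msuppX inE => /eqP ->.
by exists m'.
Qed.

Lemma part_mnm_widen n (m : 'X_{1..n.+1}) :
  part_incl (part_mnm (mnm_widen m)) (part_mnm m).
Proof.
apply/part_incl_conj => j j_gt0; rewrite !conj_part_mnm // big_ord_recr /=.
by apply: leq_trans (leq_addr _ _); under eq_bigr do rewrite mnmE.
Qed.

Definition lin_prod n c : {mpoly R[n]} := \prod_(i <- enum 'I_n) ('X_i - c%:MP).

Lemma lin_prod_sym n c : lin_prod n c \is symmetric.
Proof.
apply/issymP => s; rewrite /lin_prod msym_prod !big_enum /=.
rewrite [RHS](reindex_inj (@perm_inj _ s)); apply: eq_bigr => i _.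
by rewrite msymB msymU msymC.
Qed.

Lemma linX_neq0 n (i : 'I_n) c : 'X_i - c%:MP != 0 :> {mpoly R[n]}.
Proof.
apply: contraTneq (oner_neq0 R) => /(congr1 (meval (fun=> c + 1))).
rewrite mevalB mevalXU mevalC meval0 addrC addKr => ->.
by rewrite negbK.
Qed.

Lemma lin_prod_neq0 n c : lin_prod n c != 0.
Proof. by rewrite prodf_seq_neq0; apply/allP => i _; rewrite linX_neq0. Qed.

Lemma meval_lin_prod n c (v : 'I_n -> R) :
  (lin_prod n c).@[v] = \prod_(i < n) (v i - c).
Proof.
rewrite /lin_prod rmorph_prod big_enum; apply: eq_bigr => i _.
by have -> : v i - c = ('X_i - c%:MP).@[v] by rewrite mevalB mevalXU mevalC.
Qed.

(** By symmetry the polynomial vanishes on all the hyperplanes z_i = c. *)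
Lemma restr0_factor n c (F : {mpoly R[n.+1]}) : F \is symmetric ->
  restr c F = 0 -> exists2 G, G \is symmetric & F = lin_prod n.+1 c * G.
Proof.
move=> symF restr0; suff [G defF] : exists G, F = lin_prod n.+1 c * G.
  exists G => //; apply: msymMK (lin_prod_neq0 _ c) (lin_prod_sym _ c) _.
  by rewrite -defF.
apply: (@prod_dvd _ _ (enum 'I_n.+1) _ (fun i x => x \mPo substX i c%:MP)).
- exact: enum_uniq.
- by move=> i x y; rewrite comp_mpolyM.
- move=> i x _ x0; have [g] := substX_dvd i c%:MP x.
  by rewrite x0 subr0; exists g.
- move=> i j _ _ ne; rewrite comp_mpolyB comp_mpolyU comp_mpolyC tnth_substX.
  by rewrite (negPf ne) linX_neq0.
move=> i _.
transitivity (restr c F \mPo [tuple 'X_(fintype.lift i j) | j < n]); last first.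
  by rewrite restr0 comp_mpoly0.
rewrite /restr comp_mpolyA -{2}(issymP _ symF (lift_perm i ord_max 1)) msym_mPo.
apply: eq_comp_mpoly => k; rewrite !tnth_mktuple.
case: (unliftP i k) => [j ->|->].
  by rewrite lift_perm_lift perm1 liftK eq_sym (negPf (neq_lift _ _))
    comp_mpolyU tnth_mktuple.
by rewrite lift_perm_id unlift_none eqxx comp_mpolyC.
Qed.

(** Nonsingularity of interpolation.  By induction on the number of variables a
   polynomial vanishing at all the points vanishes where its last variable is
   a + b, hence has the factor prod (z_i - (a + b)), and the quotient vanishes
   at the points with one column less. *)
Theorem interp_nonsing n q t a b (P : intpart -> Prop) (F : {mpoly R[n]}) :
  admissible q t a b ->
  (forall mu la, part_incl mu la -> P la -> P mu) ->
  F \is symmetric ->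
  (forall m, m \in msupp F -> P (part_mnm m)) ->
  (forall mu, P mu -> (size mu <= n)%N -> F.@[zpt q t a b mu] = 0) -> F = 0.
Proof.
elim: n a b P F => [|n IHn] a b P F adm Pdown symF suppF F0.
  apply/eqP; rewrite [F]nvar0_mpolyC mpolyC_eq0; apply/negPn/negP => nz0.
  have in0 : 0%MM \in msupp F by rewrite mcoeff_msupp.
  have := F0 _ (suppF _ in0) (size_part_mnm _).
  by rewrite [F]nvar0_mpolyC mevalC => /eqP; apply/negP.
pose P1 B mu := P mu /\ (weight mu < B)%N.
have {suppF} suppF : exists B, forall m, m \in msupp F -> P1 B (part_mnm m).
  exists (msize F) => m m_F; split; first exact: suppF.
  by rewrite mdeg_part_mnm msize_mdeg_lt.
case: suppF => B; elim: B a b P F @P1 adm Pdown symF F0 => [|B IHB] a b P F P1.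
  move=> _ _ _ _ suppF; apply: msuppnil0; case: (msupp F) suppF => // m l.
  by move=> /(_ m (mem_head _ _))[].
move=> adm Pdown symF F0 suppF.
have [a0 b0 [q0 t0 _ _]] := adm.
have restr0 : restr (a + b) F = 0.
  apply: (IHn (t * a) (b / t) P) => //.
  - by have := admissible_mul 0 1 0 (-1) adm; rewrite !mul1r [b / t]mulrC.
  - exact: restr_sym.
  - move=> m /msupp_restr[m' /suppF[Pm' _] ->].
    by apply: Pdown Pm'; apply: part_mnm_widen.
  move=> mu Pmu le_n; rewrite -(F0 mu Pmu (leqW le_n)).
  rewrite -(restr_meval _ (zpt_last q t a b le_n)).
  by apply: meval_eq => i; rewrite zpt_widen.
have [G symG defF] := restr0_factor symF restr0.
suff G0 : G = 0 by rewrite defF G0 mulr0.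
apply: (IHB (q * a) (b / q) (fun mu => P (addcol n.+1 mu) /\ (size mu <= n.+1)%N)).
- by have := admissible_mul 1 0 (-1) 0 adm; rewrite !mulr1 [b / q]mulrC.
- move=> mu la incl [Pla le_la]; split; last exact: leq_trans (part_incl_size incl) _.
  exact: Pdown (addcol_incl _ incl) Pla.
- exact: symG.
- move=> mu [Pmu le_mu] _; have /eqP := F0 _ Pmu (size_addcol _ _).
  rewrite defF mevalM mulf_eq0 => /orP[|/eqP G0]; last first.
    by rewrite -G0; apply: meval_eq => i; rewrite zpt_addcol.
  rewrite meval_lin_prod => /prodf_eq0[i _]; rewrite subr_eq0 => /eqP eq_z.
  have := zpt_neq_last (mu := addcol n.+1 mu) (i := i) adm; rewrite part_addcol => /(_ isT).
  by rewrite eq_z eqxx.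
move=> m m_G; pose Q m := P1 B.+1 (part_mnm (m : 'X_{1..n.+1})).
have Qdown m1 m2 : (m1 <= m2)%MM -> Q m2 -> Q m1.
  move/mnm_lepP/part_mnm_incl => incl [Pm2 lt_m2]; split; first exact: Pdown Pm2.
  by apply: leq_ltn_trans lt_m2; apply: incl_weight.
have := msupp_divs Qdown defF suppF m_G.
rewrite /Q mnm_add_ones -addcol_part_mnm => -[Pm]; rewrite weight_addcol ?size_part_mnm // => w.
by split; [split|lia].
Qed.

End Points.

(** * Linear interpolation problems *)

Lemma sum_delta (A : pzSemiRingType) (I : eqType) (l : seq I) (F : I -> A) x : uniq l ->
  \sum_(i <- l) F i * (i == x)%:R = if x \in l then F x else 0.
Proof.
move=> uniq_l; case: ifP => [x_l|/negbT x_l].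
  rewrite (bigD1_seq x) //= eqxx mulr1 big1 ?addr0 // => i /negPf->.
  by rewrite mulr0.
rewrite big1_seq // => i /= i_l; case: eqP => [eq_i|_]; last by rewrite mulr0.
by rewrite -eq_i i_l in x_l.
Qed.

Section FreeLin.
Variables (F : fieldType) (K : choiceType) (V : lmodType F).
Implicit Types (e : K -> V) (c d : {freeg K / F}) (l : seq K).

Definition flin e c : V := \sum_(x <- dom c) coeff x c *: e x.

Lemma flinE e c l : uniq l -> {subset dom c <= l} ->
  flin e c = \sum_(x <- l) coeff x c *: e x.
Proof.
move=> uniq_l sub; rewrite /flin.
rewrite [RHS](bigID (fun x => x \in dom c)) /= [X in _ + X]big1 ?addr0; last first.
  by move=> x x_c; rewrite coeff_outdom ?scale0r.
rewrite -[RHS]big_filter; apply: perm_big; apply: uniq_perm.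
- exact: uniq_dom.
- exact: filter_uniq.
move=> x; rewrite mem_filter; case: (boolP (x \in dom c)) => //= /sub -> //.
Qed.

Lemma flin_linear e k c d : flin e (k *: c + d) = k *: flin e c + flin e d.
Proof.
have u : uniq (undup (dom (k *: c + d) ++ dom c ++ dom d)) by apply: undup_uniq.
rewrite !(flinE e u) => [|x|x|x]; try by rewrite mem_undup !mem_cat => ->; rewrite ?orbT.
rewrite scaler_sumr -big_split /=; apply: eq_bigr => x _.
by rewrite coeffD coeffZ scalerDl scalerA.
Qed.

Lemma flinU e x : flin e << x >> = e x.
Proof. by rewrite /flin domU1 big_seq1 coeffU eqxx mulr1 scale1r. Qed.

Lemma flin0 e : flin e 0 = 0.
Proof. by rewrite /flin dom0 big_nil. Qed.

Lemma flinD e c d : flin e (c + d) = flin e c + flin e d.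
Proof. by rewrite -[c]scale1r flin_linear !scale1r. Qed.

Lemma flinZ e k c : flin e (k *: c) = k *: flin e c.
Proof. by rewrite -[k *: c]addr0 flin_linear flin0 addr0. Qed.

Lemma flinN e c : flin e (- c) = - flin e c.
Proof. by rewrite -[- c]scaleN1r flinZ scaleN1r. Qed.

Lemma flinB e c d : flin e (c - d) = flin e c - flin e d.
Proof. by rewrite flinD flinN. Qed.

Lemma flin_sum e (I : Type) (r : seq I) (P : pred I) (G : I -> {freeg K / F}) :
  flin e (\sum_(i <- r | P i) G i) = \sum_(i <- r | P i) flin e (G i).
Proof. by elim/big_rec2: _ => [|i x y _ <-]; rewrite ?flin0 ?flinD. Qed.

(** Unknown coefficients for the vectors e x, prescribed values for the linear forms
    phi x; both families have the same index set. *)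
Variables (e : K -> V) (phi : K -> V -> F).
Hypothesis phi_lin : forall x k v w, phi x (k *: v + w) = k * phi x v + phi x w.

Lemma linform0 x : phi x 0 = 0.
Proof. by have := phi_lin x (-1) 0 0; rewrite scaler0 addr0 mulN1r addNr. Qed.

Lemma linformD x v w : phi x (v + w) = phi x v + phi x w.
Proof. by have := phi_lin x 1 v w; rewrite scale1r mul1r. Qed.

Lemma linformZ x k v : phi x (k *: v) = k * phi x v.
Proof. by have := phi_lin x k v 0; rewrite !addr0 linform0 addr0. Qed.

Lemma linform_sum x (I : Type) (r : seq I) (P : pred I) (G : I -> V) :
  phi x (\sum_(i <- r | P i) G i) = \sum_(i <- r | P i) phi x (G i).
Proof. by elim/big_rec2: _ => [|i a b _ <-]; rewrite ?linform0 ?linformD. Qed.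

Definition elt l (i : 'I_(size l)) : K := tnth (in_tuple l) i.

Lemma elt_mem l (i : 'I_(size l)) : elt i \in l.
Proof. exact: mem_tnth. Qed.

Lemma eltP l x : x \in l -> exists i : 'I_(size l), x = elt i.
Proof. by move=> x_l; have /tnthP[i] : x \in in_tuple l by []; exists i. Qed.

Lemma elt_inj l : uniq l -> injective (@elt l).
Proof.
move=> uniq_l i j /eqP; rewrite /elt !(tnth_nth (elt i)) /= nth_uniq //.
by move/eqP/ord_inj.
Qed.

Definition interp_mx l : 'M[F]_(size l) :=
  \matrix_(i, j) phi (elt j) (e (elt i)).

Definition row_free_elt l (r : 'rV[F]_(size l)) : {freeg K / F} :=
  \sum_i r 0 i *: << elt i >>.

Lemma coeff_row l (r : 'rV[F]_(size l)) i : uniq l ->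
  coeff (elt i) (row_free_elt r) = r 0 i.
Proof.
move=> uniq_l; rewrite /row_free_elt raddf_sum (bigD1 i) //= coeffZ coeffU eqxx.
rewrite !mulr1 big1 ?addr0 // => j ne; rewrite coeffZ coeffU.
by rewrite (inj_eq (elt_inj uniq_l)) (negPf ne) !mulr0.
Qed.

Lemma dom_row l (r : 'rV[F]_(size l)) : {subset dom (row_free_elt r) <= l}.
Proof.
move=> x; rewrite mem_dom; apply: contraR => x_l.
rewrite raddf_sum big1 // => i _ /=; rewrite coeffZ coeffU.
case: eqP => [eq_x|_]; last by rewrite !mulr0.
by rewrite -eq_x elt_mem in x_l.
Qed.

Lemma row_of_coeff l c : uniq l -> {subset dom c <= l} ->
  c = row_free_elt (\row_(i < size l) coeff (elt i) c).
Proof.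
move=> uniq_l sub; apply/eqP/freeg_eqP => x.
have [/eltP[i ->]|x_l] := boolP (x \in l); first by rewrite coeff_row // mxE.
rewrite !coeff_outdom //; first by apply: contra x_l => /dom_row.
by apply: contra x_l => /sub.
Qed.

Lemma linform_row l (r : 'rV[F]_(size l)) x :
  phi x (flin e (row_free_elt r)) = \sum_i r 0 i * phi x (e (elt i)).
Proof.
by rewrite flin_sum linform_sum; apply: eq_bigr => i _; rewrite flinZ flinU linformZ.
Qed.

Lemma linform_row_mx l (r : 'rV[F]_(size l)) j :
  phi (elt j) (flin e (row_free_elt r)) = (r *m interp_mx l) 0 j.
Proof. by rewrite linform_row mxE; apply: eq_bigr => i _; rewrite mxE. Qed.

Lemma interp_mx_unit l : uniq l ->
  (forall c, {subset dom c <= l} ->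
     (forall x, x \in l -> phi x (flin e c) = 0) -> c = 0) ->
  interp_mx l \in unitmx.
Proof.
move=> uniq_l inj; rewrite -row_free_unit -kermx_eq0.
apply/rowV0P => r /sub_kermxP r0.
have c0 : row_free_elt r = 0.
  apply: inj; first exact: dom_row.
  by move=> x /eltP[j ->]; rewrite linform_row_mx r0 mxE.
by apply/rowP => i; rewrite -coeff_row // c0 coeff0 mxE.
Qed.

Lemma interp_unique l c : uniq l -> interp_mx l \in unitmx ->
  {subset dom c <= l} ->
  (forall x, x \in l -> phi x (flin e c) = 0) -> c = 0.
Proof.
move=> uniq_l unitA sub c0; rewrite (row_of_coeff uniq_l sub).
set r := \row__ _; suff -> : r = 0.
  by rewrite /row_free_elt big1 // => i _; rewrite mxE scale0r.
rewrite -[r](mulmxK unitA); suff -> : r *m interp_mx l = 0 by rewrite mul0mx.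
apply/rowP => j; rewrite -linform_row_mx /r -row_of_coeff // c0 ?elt_mem //.
by rewrite mxE.
Qed.

Definition interp_sol l (v : K -> F) : {freeg K / F} :=
  row_free_elt ((\row_(j < size l) v (elt j)) *m invmx (interp_mx l)).

Lemma interp_solP l v : interp_mx l \in unitmx ->
  {subset dom (interp_sol l v) <= l} /\
  (forall x, x \in l -> phi x (flin e (interp_sol l v)) = v x).
Proof.
move=> unitA; split; first exact: dom_row.
by move=> x /eltP[j ->]; rewrite linform_row_mx mulmxKV // mxE.
Qed.

End FreeLin.

(** * Coefficients of symmetric polynomials *)

Section SymPoly.
Variable R : fieldType.

Lemma mcoeff_monomial_sympoly N (la : intpart) m :
  (monomial_sympoly R N la)@_m = (part_mnm m == la)%:R.
Proof.
rewrite /monomial_sympoly /rearrangements.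
case: leqP => [le_N|lt_N]; last first.
  rewrite big_nil mcoeff0; case: eqP => // eq_la.
  by move: lt_N; rewrite -eq_la ltnNge size_part_mnm.
rewrite raddf_sum /=.
transitivity (\sum_(a <- permutations (la ++ nseq (N - size la) 0%N))
   (a == m :> seq nat)%:R : R).
  rewrite big_seq [RHS]big_seq; apply: eq_bigr => a a_in.
  rewrite mcoeffX; congr (_ : bool)%:R.
  move: a_in; rewrite mem_permutations => /perm_size.
  rewrite size_cat size_nseq subnKC // => sz_a.
  apply/eqP/eqP => [<-|->].
    apply: (@eq_from_nth _ 0%N); first by rewrite size_tuple.
    move=> i; rewrite sz_a => lt_i.
    by rewrite -(mnm_nth 0%N _ (Ordinal lt_i)) mnmE.
  by apply/mnmP => i; rewrite mnmE (mnm_nth 0%N).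
have uniq_p := permutations_uniq (la ++ nseq (N - size la) 0%N).
have -> : (part_mnm m == la) = ((m : seq nat) \in permutations (la ++ nseq (N - size la) 0%N)).
  rewrite mem_permutations; apply/eqP/idP => [<-|eq_p].
    by have := perm_mkpart m; rewrite size_tuple.
  by rewrite /part_mnm (mkpart_perm eq_p) mkpart_nseq0.
case: (boolP (_ \in _)) => m_in.
  rewrite (bigD1_seq _ m_in uniq_p) /= eqxx big1 ?addr0 // => a /negPf->//.
by rewrite big1_seq // => a /= a_in; case: eqP => // eq_a; rewrite -eq_a a_in in m_in.
Qed.

Lemma mcoeff_sympoly N (f : symfun R) m : (sympoly N f)@_m = coeff (part_mnm m) f.
Proof.
rewrite /sympoly raddf_sum /=.
under eq_bigr do rewrite mcoeffZ mcoeff_monomial_sympoly eq_sym.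
rewrite (sum_delta (fun mu => coeff mu f)) ?uniq_dom //.
by case: ifP => // /negbT/coeff_outdom ->.
Qed.

Lemma sympoly_sym N (f : symfun R) : sympoly N f \is symmetric.
Proof.
by apply/issymP => s; apply/mpolyP => m; rewrite mcoeff_sym !mcoeff_sympoly
  part_mnm_perm.
Qed.

End SymPoly.

(** * Interpolation polynomials in x + 1/x *)

Section InterpZ.
Variables (R : fieldType) (q t : R).
Implicit Types (a b : R) (la mu nu : intpart).

(** The interpolation polynomial of la in the variables z_i, up to a nonzero
    scalar: the operations used below do not preserve a normalization. *)
Record is_interpz n a b la (F : {mpoly R[n]}) : Prop := IsInterpz {
  iz_sym : F \is symmetric;
  iz_supp : forall m, m \in msupp F -> dom_le (part_mnm m) la;
  iz_lead : F@_(mnm_part n la) != 0;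
  iz_zero : forall mu, dom_lt mu la -> (size mu <= n)%N -> F.@[zpt q t a b mu] = 0
}.

Lemma dom_le_incl la mu nu : part_incl mu nu -> dom_le nu la -> dom_le mu la.
Proof. by move=> /incl_dom_le; apply: dom_le_trans. Qed.

Lemma dom_lt_incl la mu nu : part_incl mu nu -> dom_lt nu la -> dom_lt mu la.
Proof. by move=> /incl_dom_le; apply: dom_le_lt_trans. Qed.

Lemma interpz_val_neq0 n a b la (F : {mpoly R[n]}) : admissible q t a b ->
  (size la <= n)%N -> is_interpz a b la F -> F.@[zpt q t a b la] != 0.
Proof.
move=> adm le_n [symF suppF lead zeroF]; apply/eqP => F0.
move/eqP: lead; apply; suff -> : F = 0 by rewrite mcoeff0.
apply: (interp_nonsing (P := fun mu => dom_le mu la) adm) => //.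
  by move=> mu nu; apply: dom_le_incl.
by move=> mu /dom_le_eqVlt[->|] //; apply: zeroF.
Qed.

(** Without its leading term the polynomial only involves partitions strictly
    below la, and these are also the ones where it vanishes. *)
Lemma interpz_lead0 n a b la (F : {mpoly R[n]}) : admissible q t a b ->
  F \is symmetric -> (forall m, m \in msupp F -> dom_le (part_mnm m) la) ->
  F@_(mnm_part n la) = 0 ->
  (forall mu, dom_lt mu la -> (size mu <= n)%N -> F.@[zpt q t a b mu] = 0) ->
  F = 0.
Proof.
move=> adm symF suppF lead0 zeroF.
apply: (interp_nonsing (P := fun mu => dom_lt mu la) adm) => //.
  by move=> mu nu; apply: dom_lt_incl.
move=> m m_F; case: (dom_le_eqVlt (suppF m m_F)) => // eq_la.
have le_n : (size la <= n)%N by rewrite -eq_la size_part_mnm.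
have [s def_m] : exists s : 'S_n, m = [multinom mnm_part n la (s i) | i < n].
  by apply: part_mnm_eq; rewrite mnm_partK.
by move: m_F; rewrite mcoeff_msupp def_m msym_coeff // lead0 eqxx.
Qed.

Lemma interpz_unique n a b la (F G : {mpoly R[n]}) : admissible q t a b ->
  is_interpz a b la F -> G \is symmetric ->
  (forall m, m \in msupp G -> dom_le (part_mnm m) la) ->
  (forall mu, dom_lt mu la -> (size mu <= n)%N -> G.@[zpt q t a b mu] = 0) ->
  F@_(mnm_part n la) *: G = G@_(mnm_part n la) *: F.
Proof.
move=> adm [symF suppF leadF zeroF] symG suppG zeroG.
apply/eqP; rewrite -subr_eq0; apply/eqP; apply: (interpz_lead0 (la := la) adm).
- by rewrite rpredB ?rpredZ.
- move=> m /msuppB_le; rewrite mem_cat => /orP[] /msuppZ_le; [exact: suppG|exact: suppF].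
- by rewrite mcoeffB !mcoeffZ mulrC subrr.
by move=> mu lt_mu le_n; rewrite mevalB !mevalZ zeroF ?zeroG // !mulr0 subrr.
Qed.

Lemma interpz_exists n a b la : admissible q t a b -> (size la <= n)%N ->
  exists F : {mpoly R[n]}, is_interpz a b la F.
Proof.
move=> adm le_n.
pose l := parts_with (weight la) (fun mu => dom_le mu la /\ (size mu <= n)%N).
have mem_l mu : reflect (dom_le mu la /\ (size mu <= n)%N) (mu \in l).
  apply: (iffP (mem_parts_with _ _ _)) => [[]//|h]; split=> //.
  by case: h => /dom_le_weight.
pose e := monomial_sympoly R n.
pose phi mu (F : {mpoly R[n]}) := F.@[zpt q t a b mu].
have phi_lin x k v w : phi x (k *: v + w) = k * phi x v + phi x w.
  by rewrite /phi mevalD mevalZ.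
have supp_l (c : symfun R) : {subset dom c <= l} -> forall m, m \in msupp (sympoly n c) ->
    dom_le (part_mnm m) la.
  move=> sub m; rewrite mcoeff_msupp mcoeff_sympoly -mem_dom.
  by move=> /sub/mem_l[].
have unitA : interp_mx e phi l \in unitmx.
  apply: (interp_mx_unit phi_lin); first exact: parts_with_uniq.
  move=> c sub c0.
  have F0 : sympoly n c = 0.
    apply: (interp_nonsing (P := fun mu => dom_le mu la) adm).
    - by move=> mu nu; apply: dom_le_incl.
    - exact: sympoly_sym.
    - exact: supp_l.
    by move=> mu le_mu sz_mu; apply: c0; apply/mem_l.
  apply/eqP/freeg_eqP => mu; rewrite coeff0.
  have [/sub/mem_l[_ sz_mu]|/coeff_outdom//] := boolP (mu \in dom c).
  by rewrite -(mnm_partK sz_mu) -mcoeff_sympoly F0 mcoeff0.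
have [sub solP] := interp_solP phi_lin (fun mu => (mu == la)%:R) unitA.
set c := interp_sol _ _ _ _ in sub solP.
have zeroF mu : dom_lt mu la -> (size mu <= n)%N ->
    (sympoly n c).@[zpt q t a b mu] = 0.
  move=> lt_mu sz_mu; have := solP mu; rewrite /phi => ->.
    by case: eqP lt_mu => // -> [].
  by apply/mem_l; split=> //; case: lt_mu.
exists (sympoly n c); split=> //; [exact: sympoly_sym|exact: supp_l|].
apply/eqP => lead0; have := solP la; rewrite eqxx /phi.
have -> : flin e c = 0.
  by apply: (interpz_lead0 (la := la) adm); [exact: sympoly_sym|exact: supp_l|..].
rewrite meval0 => h; have /eqP := h (introT (mem_l la) (conj (@dom_le_refl la) le_n)).
by rewrite eq_sym oner_eq0.
Qed.

(** On partitions with at most n parts the last variable has the constant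
    value a + b. Fixing it there leaves a polynomial subject to the same
    conditions, for the parameters t a and b / t. *)
Lemma interpz_restr n a b la (F : {mpoly R[n.+1]}) : admissible q t a b ->
  (size la <= n)%N -> is_interpz a b la F ->
  [/\ is_interpz (t * a) (b / t) la (restr (a + b) F),
      (restr (a + b) F)@_(mnm_part n la) = F@_(mnm_part n.+1 la) &
      forall mu, (size mu <= n)%N ->
        (restr (a + b) F).@[zpt q t (t * a) (b / t) mu] = F.@[zpt q t a b mu]].
Proof.
move=> adm le_n [symF suppF leadF zeroF]; have [_ _ [_ t0 _ _]] := adm.
have valE mu : (size mu <= n)%N ->
    (restr (a + b) F).@[zpt q t (t * a) (b / t) mu] = F.@[zpt q t a b mu].
  move=> sz_mu; rewrite -(restr_meval _ (zpt_last q t a b sz_mu)).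
  by apply: meval_eq => i; rewrite zpt_widen.
have leadE : (restr (a + b) F)@_(mnm_part n la) = F@_(mnm_part n.+1 la).
  have def_la m : m \in msupp F -> mnm_widen m = mnm_part n la -> m = mnm_part n.+1 la.
    move=> m_F eq_m; have incl := part_mnm_widen m.
    move: incl; rewrite eq_m mnm_partK // => incl.
    have eq_la : la = part_mnm m.
      by apply: dom_le_anti; [apply: incl_dom_le|apply: suppF].
    have : mdeg m = mdeg (mnm_part n la).
      by rewrite -!mdeg_part_mnm -eq_la mnm_partK.
    rewrite -eq_m !mdegE big_ord_recr /=.
    under [RHS]eq_bigr do rewrite mnmE.
    move/(congr1 (subn^~ (\sum_(i < n) m (widen_ord (leqnSn n) i))%N)).
    rewrite addKn subnn => m_max; apply/mnmP => i.
    case: (unliftP ord_max i) => [j ->|->].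
      by rewrite lift_max_widen; move/mnmP/(_ j): eq_m; rewrite !mnmE.
    by rewrite m_max mnmE part_default.
  rewrite restrE raddf_sum /=.
  under eq_bigr do rewrite mcoeffZ mcoeffX.
  have [in_F|out_F] := boolP (mnm_part n.+1 la \in msupp F); last first.
    rewrite (memN_msupp_eq0 out_F) big1_seq // => m /= m_F.
    case: eqP => [/(def_la m m_F) eq_m|_]; rewrite ?mulr0 //.
    by rewrite -eq_m m_F in out_F.
  rewrite (bigD1_seq _ in_F (msupp_uniq _)) /= [X in _ + X]big1_seq ?addr0.
    have -> : mnm_widen (mnm_part n.+1 la) == mnm_part n la.
      by apply/eqP/mnmP => i; rewrite !mnmE.
    by rewrite mnmE part_default //= expr0 !mulr1.
  move=> m /andP[/eqP ne m_F]; case: eqP => [/(def_la m m_F)//|_].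
  by rewrite mulr0.
split=> //; split.
- exact: restr_sym.
- move=> m /msupp_restr[m' /suppF le_m' ->].
  by apply: dom_le_incl le_m'; apply: part_mnm_widen.
- by rewrite leadE.
by move=> mu lt_mu sz_mu; rewrite valE // zeroF // leqW.
Qed.

(** A linear factor shifts a maximal monomial and keeps its coefficient. *)
Lemma mcoeff_lin_prods n c (s : seq 'I_n) (p g : {mpoly R[n]}) m :
  p = (\prod_(i <- s) ('X_i - c%:MP)) * g ->
  (forall m', (m <= m')%MM -> m' != m -> g@_m' = 0) ->
  p@_(m + \sum_(i <- s) U_(i)) = g@_m /\
  (forall m', (m + \sum_(i <- s) U_(i) <= m')%MM ->
     m' != (m + \sum_(i <- s) U_(i))%MM -> p@_m' = 0).
Proof.
elim: s p => [|i s IHs] p def_p g0.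
  by rewrite big_nil addm0 def_p big_nil mul1r.
pose p1 := (\prod_(i <- s) ('X_i - c%:MP)) * g.
have [lead1 zero1] := IHs p1 erefl g0.
set k := (m + \sum_(i <- s) U_(i))%MM in lead1 zero1 *.
have -> : (m + \sum_(i <- i :: s) U_(i))%MM = (U_(i) + k)%MM.
  by rewrite big_cons /k !addmA [(m + _)%MM]addmC.
have pE k' : p@_(U_(i) + k') = p1@_k' - c * p1@_(U_(i) + k').
  have -> : p = p1 * 'X_i - c%:MP * p1.
    by rewrite def_p big_cons -mulrA mulrBl [_ * 'X_i]mulrC.
  by rewrite mcoeffB mcoeffMX mcoeffCM.
have ltk k' : (k <= k')%MM -> (U_(i) + k')%MM != k.
  move=> le_k; apply/eqP => eq_k; move/mnm_lepP/(_ i): le_k.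
  by rewrite -{1}eq_k mnmDE mnm1E eqxx ltnn.
split.
  rewrite pE (zero1 (U_(i) + k)%MM) ?mulr0 ?subr0 //; first exact: lem_addl.
  exact: ltk (lepm_refl _).
move=> m' le_m' ne; have le_i : (U_(i) <= m')%MM by apply: lepm_trans le_m'; apply: lem_addr.
have def_m' : m' = (U_(i) + (m' - U_(i)))%MM by rewrite addmC submK.
have le_k : (k <= m' - U_(i))%MM.
  apply/mnm_lepP => j; move/mnm_lepP/(_ j): le_m'.
  by rewrite mnmDE mnmBE leq_subRL ?(mnm_lepP le_i).
rewrite def_m' pE !zero1 ?mulr0 ?subr0 // -?def_m' //.
- exact: lepm_trans le_k (lem_subr _ _).
- by rewrite def_m'; apply: ltk.
by apply: contra ne => /eqP eq_k; rewrite def_m' eq_k.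
Qed.

(** A diagram with n + 1 rows is larger than those with at most n rows, so the
    polynomial vanishes where its last variable is a + b, and the product of
    the z_i - (a + b) splits off. The quotient satisfies the conditions for
    the parameters q a and b / q. *)
Lemma interpz_column n a b la (F : {mpoly R[n.+1]}) : admissible q t a b ->
  (size la <= n.+1)%N -> is_interpz a b (addcol n.+1 la) F ->
  exists2 G, is_interpz (q * a) (b / q) la G &
   F@_(mnm_part n.+1 (addcol n.+1 la)) = G@_(mnm_part n.+1 la) /\
   F = lin_prod n.+1 (a + b) * G.
Proof.
move=> adm le_n [symF suppF leadF zeroF]; have [_ _ [q0 t0 _ _]] := adm.
have sz_add mu : size (addcol n.+1 mu) = n.+1.
  by apply/eqP; rewrite eqn_leq size_addcol -part_pos // (part_addcol _ (ord_max : 'I_n.+1)).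
have restr0 : restr (a + b) F = 0.
  apply: (@interp_nonsing _ _ q t (t * a) (b / t) (fun mu => dom_lt mu (addcol n.+1 la))).
  - by have := admissible_mul 0 1 0 (-1) adm; rewrite !mul1r [b / t]mulrC.
  - by move=> mu nu; apply: dom_lt_incl.
  - exact: restr_sym.
  - move=> m /msupp_restr[m' /suppF le_m' ->]; split.
      by apply: dom_le_incl le_m'; apply: part_mnm_widen.
    move/(congr1 (fun mu : intpart => size mu)); rewrite sz_add => sz.
    by have := size_part_mnm (mnm_widen m'); rewrite sz ltnn.
  move=> mu lt_mu sz_mu; rewrite -(zeroF mu lt_mu (leqW sz_mu)).
  rewrite -(restr_meval _ (zpt_last q t a b sz_mu)).
  by apply: meval_eq => i; rewrite zpt_widen.
have [G symG defF] := restr0_factor symF restr0.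
have suppG m : m \in msupp G -> dom_le (part_mnm m) la.
  move=> m_G.
  pose Q m := dom_le (part_mnm (m : 'X_{1..n.+1})) (addcol n.+1 la).
  have Qdown m1 m2 : (m1 <= m2)%MM -> Q m2 -> Q m1.
    by move/mnm_lepP/part_mnm_incl; apply: dom_le_incl.
  have := msupp_divs Qdown defF suppF m_G; rewrite /Q mnm_add_ones -addcol_part_mnm.
  by move/addcol_dom_le; apply; rewrite ?size_part_mnm.
have leadE : F@_(mnm_part n.+1 (addcol n.+1 la)) = G@_(mnm_part n.+1 la).
  have [] := @mcoeff_lin_prods _ _ _ F G (mnm_part n.+1 la) defF.
    move=> m' le_m' ne; apply/eqP; rewrite mcoeff_eq0; apply/negP => /suppG le_la.
    move/eqP: ne; apply; apply/esym.
    have incl : part_incl la (part_mnm m').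
      by rewrite -{1}(mnm_partK le_n); apply/part_mnm_incl/mnm_lepP.
    have := dom_le_weight le_la; rewrite mdeg_part_mnm -(mnm_partK le_n) mdeg_part_mnm.
    rewrite mnm_partK // !mdegE => le_sum; apply/mnmP => i; apply/eqP.
    rewrite eqn_leq (mnm_lepP le_m') /=; rewrite leqNgt; apply/negP => lt_i.
    move: le_sum; rewrite leqNgt => /negP; apply.
    rewrite (bigD1 i) //= [X in (_ < X)%N](bigD1 i) //= -addSn leq_add //.
    by apply: leq_sum => j _; apply: (mnm_lepP le_m').
  rewrite mnm_add_ones => <- _; congr (_@__); apply/mnmP => i.
  by rewrite !mnmE part_addcol.
exists G => //; split=> //; first by rewrite -leadE.
move=> mu lt_mu sz_mu; have := zeroF (addcol n.+1 mu).
have lt_add : dom_lt (addcol n.+1 mu) (addcol n.+1 la) by apply/addcol_dom_lt.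
move=> /(_ lt_add (size_addcol _ _)); rewrite defF mevalM => /eqP.
rewrite mulf_eq0 => /orP[|/eqP G0]; last first.
  by rewrite -G0; apply: meval_eq => i; rewrite zpt_addcol.
rewrite meval_lin_prod => /prodf_eq0[i _]; rewrite subr_eq0 => /eqP eq_z.
have := zpt_neq_last (mu := addcol n.+1 mu) (i := i) adm; rewrite part_addcol => /(_ isT).
by rewrite eq_z eqxx.
Qed.

End InterpZ.

(** * Weighted degrees *)

Section Weights.
Variables (A : fieldType) (N : nat) (d : 'I_N -> nat).
Implicit Types (p g : {mpoly A[N]}) (D : nat).

Definition wt (m : 'X_{1..N}) : nat := \sum_(i < N) d i * m i.

Lemma wt0 : wt 0 = 0%N.
Proof. by rewrite /wt big1 // => i _; rewrite mnm0E muln0. Qed.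

Lemma wtD m1 m2 : wt (m1 + m2)%MM = (wt m1 + wt m2)%N.
Proof. by rewrite /wt -big_split; apply: eq_bigr => i _; rewrite mnmDE mulnDr. Qed.

Lemma wtU i : wt U_(i)%MM = d i.
Proof.
rewrite /wt (bigD1 i) //= mnm1E eqxx muln1 big1 ?addn0 // => j ne.
by rewrite mnm1E eq_sym (negPf ne) muln0.
Qed.

Definition degle D p := forall m, m \in msupp p -> (wt m <= D)%N.

Lemma degle_trans D D' p : (D <= D')%N -> degle D p -> degle D' p.
Proof. by move=> le_D h m /h/leq_trans; apply. Qed.

Lemma degleC D c : degle D c%:MP.
Proof. by move=> m; rewrite msuppC; case: eqP => // _; rewrite inE => /eqP->; rewrite wt0. Qed.

Lemma degleU i : degle (d i) 'X_i.
Proof. by move=> m; rewrite msuppX inE => /eqP->; rewrite wtU. Qed.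

Lemma degle0 D : degle D 0.
Proof. by rewrite -mpolyC0; apply: degleC. Qed.

Lemma degleD D p g : degle D p -> degle D g -> degle D (p + g).
Proof. by move=> hp hg m /msuppD_le; rewrite mem_cat => /orP[/hp|/hg]. Qed.

Lemma degleN D p : degle D p -> degle D (- p).
Proof. by move=> hp m; rewrite (perm_mem (msuppN _)) => /hp. Qed.

Lemma degleB D p g : degle D p -> degle D g -> degle D (p - g).
Proof. by move=> hp hg; apply: degleD hp (degleN hg). Qed.

Lemma degleM D D' p g : degle D p -> degle D' g -> degle (D + D') (p * g).
Proof.
by move=> hp hg m /msuppM_le/allpairsP[[m1 m2] /= [/hp h1 /hg h2 ->]];
  rewrite wtD leq_add.
Qed.

Lemma degleZ D c p : degle D p -> degle D (c *: p).
Proof. by move=> hp m /msuppZ_le/hp. Qed.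

Lemma degle_sum D (I : eqType) (r : seq I) (P : pred I) (G : I -> {mpoly A[N]}) :
  (forall i, i \in r -> P i -> degle D (G i)) ->
  degle D (\sum_(i <- r | P i) G i).
Proof.
move=> hG; rewrite big_seq_cond; elim/big_rec: _ => [|i p /andP[i_r Pi] hp].
  exact: degle0.
exact/degleD/hp/hG.
Qed.

Lemma degle_prod (I : Type) (r : seq I) (P : pred I) (D : I -> nat) (G : I -> {mpoly A[N]}) :
  (forall i, P i -> degle (D i) (G i)) ->
  degle (\sum_(i <- r | P i) D i) (\prod_(i <- r | P i) G i).
Proof.
move=> hG; elim/big_rec2: _ => [|i p D' Pi hp].
  by rewrite -mpolyC1; apply: degleC.
exact/degleM/hp/hG.
Qed.

Lemma degleX D k p : degle D p -> degle (D * k) (p ^+ k).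
Proof.
move=> hp; elim: k => [|k IHk]; first by rewrite expr0 -mpolyC1; apply: degleC.
by rewrite exprS mulnS; apply: degleM.
Qed.

(** The weighted degree is the degree in an auxiliary variable; hence it is
   additive on products. *)
Definition wtpoly p : {poly {mpoly A[N]}} :=
  mmap (polyC \o @mpolyC N A) (fun i => ('X_i)%:P * 'X^(d i)) p.

Lemma wtpolyM p g : wtpoly (p * g) = wtpoly p * wtpoly g.
Proof. exact: (rmorphM (mmap (polyC \o @mpolyC N A) (fun i => ('X_i)%:P * 'X^(d i)))). Qed.

Lemma wtpolyB p g : wtpoly (p - g) = wtpoly p - wtpoly g.
Proof. exact: (rmorphB (mmap (polyC \o @mpolyC N A) (fun i => ('X_i)%:P * 'X^(d i)))). Qed.

Lemma wtpolyU i : wtpoly 'X_i = ('X_i)%:P * 'X^(d i).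
Proof. by rewrite /wtpoly mmapX mmap1U. Qed.

Lemma wtpolyC c : wtpoly c%:MP = (c%:MP)%:P.
Proof. by rewrite /wtpoly mmapC. Qed.

Lemma wtpolyE p : wtpoly p = \sum_(m <- msupp p) (p@_m *: 'X_[m])%:P * 'X^(wt m).
Proof.
rewrite /wtpoly /mmap; apply: eq_bigr => m _.
rewrite -mul_mpolyC polyCM -mulrA; congr (_ * _).
rewrite [in RHS]mpolyXE_id rmorph_prod /wt expr_sum -big_split /mmap1 /=.
by apply: eq_bigr => i _; rewrite exprMn rmorphXn exprM.
Qed.

Lemma coef_wtpoly p k m : ((wtpoly p)`_k)@_m = if wt m == k then p@_m else 0.
Proof.
rewrite wtpolyE coef_sum raddf_sum /=.
have termE m' : ((p@_m' *: 'X_[m'])%:P * 'X^(wt m'))`_k@_m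
   = if m' == m then (if wt m == k then p@_m else 0) else 0.
  rewrite coefCM coefXn; case: (eqVneq m' m) => [->|ne].
    by rewrite eq_sym; case: eqP => _; rewrite ?mulr1 ?mulr0 ?mcoeff0 // mcoeffZ
      mcoeffX eqxx mulr1.
  case: eqP => _; rewrite ?mulr1 ?mulr0 ?mcoeff0 // mcoeffZ mcoeffX (negPf ne).
  by rewrite mulr0.
under eq_bigr do rewrite termE.
have [m_p|m_p] := boolP (m \in msupp p).
  rewrite (bigD1_seq m) //= eqxx big1 ?addr0 // => m' /negPf->//.
rewrite (memN_msupp_eq0 m_p) if_same big1_seq // => m' /= m'_p.
by case: eqP => // eq_m; rewrite -eq_m m'_p in m_p.
Qed.

Lemma degle_size D p : degle D p <-> (size (wtpoly p) <= D.+1)%N.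
Proof.
split=> [hp|sz m m_p].
  apply/leq_sizeP => k lt_k; apply/mpolyP => m; rewrite coef_wtpoly mcoeff0.
  case: eqP => // eq_k; apply/eqP; rewrite mcoeff_eq0; apply/negP => /hp.
  by rewrite eq_k leqNgt lt_k.
rewrite leqNgt; apply/negP => lt_D.
have /leq_sizeP/(_ _ lt_D)/(congr1 (mcoeff m)) := sz.
rewrite coef_wtpoly eqxx mcoeff0 => p0.
by move: m_p; rewrite mcoeff_msupp p0 eqxx.
Qed.

Definition degeq D p := size (wtpoly p) == D.+1.

Lemma size_mul_mpoly (u v : {poly {mpoly A[N]}}) : u != 0 -> v != 0 ->
  size (u * v) = (size u + size v).-1.
Proof. by move=> u0 v0; rewrite size_mul. Qed.

Lemma degeqM D D' p g : degeq D p -> degeq D' g -> degeq (D + D') (p * g).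
Proof.
move=> /eqP hp /eqP hg; rewrite /degeq wtpolyM.
move: (wtpoly p) (wtpoly g) hp hg => u v hu hv.
by rewrite size_mul_mpoly -?size_poly_gt0 ?hu ?hv // addSn addnS.
Qed.

Lemma degeq_prod (I : Type) (r : seq I) (P : pred I) (D : I -> nat) (G : I -> {mpoly A[N]}) :
  (forall i, P i -> degeq (D i) (G i)) ->
  degeq (\sum_(i <- r | P i) D i) (\prod_(i <- r | P i) G i).
Proof.
move=> hG; elim/big_rec2: _ => [|i p D' Pi hp].
  by rewrite /degeq -mpolyC1 wtpolyC mpolyC1 polyC1 size_poly1.
exact/degeqM/hp/hG.
Qed.

Lemma degeqU i : degeq (d i) 'X_i.
Proof.
rewrite /degeq wtpolyU size_Cmul ?size_polyXn // -msupp_eq0 msuppX //.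
Qed.

Lemma mpolyX_neq i j : i != j -> 'X_i - 'X_j != 0 :> {mpoly A[N]}.
Proof.
move=> ne; apply: contra ne; rewrite subr_eq0 => /eqP/mpolyP/(_ U_(i)%MM).
rewrite !mcoeffXU eqxx eq_sym; case: eqP => // _ /eqP.
by rewrite oner_eq0.
Qed.

Lemma degeq_sub i j : i != j -> (d j <= d i)%N -> degeq (d i) ('X_j - 'X_i).
Proof.
move=> ne le_d; rewrite /degeq; apply/eqP/anti_leq/andP; split.
  apply/degle_size; apply: degleB; last exact: degleU.
  exact: degle_trans le_d (@degleU j).
rewrite ltnNge; apply/negP => /leq_sizeP/(_ _ (leqnn _)).
rewrite wtpolyB !wtpolyU coefB !coefCM !coefXn eqxx mulr1.
case: eqP => _; rewrite ?mulr1 ?mulr0 ?sub0r.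
  by move/eqP; apply/negP/mpolyX_neq; rewrite eq_sym.
by move/eqP; rewrite oppr_eq0 -msupp_eq0 msuppX.
Qed.

Lemma degle_div e D p g : degeq e p -> degle (e + D) (p * g) -> degle D g.
Proof.
move=> /eqP hp; have [->|nz_g] := eqVneq g 0; first by move=> _; apply: degle0.
have [g0|nz_wg] := eqVneq (wtpoly g) 0.
  by move=> _; apply/degle_size; rewrite g0 size_poly0.
move/degle_size; rewrite wtpolyM => sz; apply/degle_size.
move: (wtpoly p) (wtpoly g) hp nz_wg sz => u v hu nz_v.
rewrite size_mul_mpoly //; last by rewrite -size_poly_gt0 hu.
by rewrite hu addSn /= -addnS leq_add2l.
Qed.

End Weights.

(** * Vandermonde products *)

Section Vdm.

Definition vdm (A : comNzRingType) n (u : 'I_n -> A) : A :=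
  \prod_(p : 'I_n * 'I_n | (p.1 < p.2)%N) (u p.2 - u p.1).

Lemma vdm_det (A : comNzRingType) n (u : 'I_n -> A) :
  vdm u = \det (Vandermonde n (\row_i u i)).
Proof.
rewrite det_Vandermonde /vdm.
rewrite (pair_big_dep xpredT (fun i j : 'I_n => (i < j)%N)
  (fun i j => (\row_k u k) 0 j - (\row_k u k) 0 i)) /=.
by apply: eq_bigr => p _; rewrite !mxE.
Qed.

Lemma vdm_perm (A : comNzRingType) n (u : 'I_n -> A) (s : 'S_n) :
  vdm (fun i => u (s i)) = (-1) ^+ s * vdm u.
Proof.
rewrite !vdm_det (_ : Vandermonde _ _ = col_perm s (Vandermonde n (\row_i u i))); last first.
  by apply/matrixP => i j; rewrite !mxE.
by rewrite col_permE det_mulmx det_perm odd_permV mulrC.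
Qed.

Lemma rmorph_vdm (A B : comNzRingType) n (f : {rmorphism A -> B}) (u : 'I_n -> A) :
  f (vdm u) = vdm (fun i => f (u i)).
Proof. by rewrite /vdm rmorph_prod; apply: eq_bigr => p _; rewrite rmorphB. Qed.

Lemma eq_vdm (A : comNzRingType) n (u v : 'I_n -> A) : u =1 v -> vdm u = vdm v.
Proof. by move=> eq_u; apply: eq_bigr => p _; rewrite !eq_u. Qed.

Lemma vdm_neq0 (A : idomainType) n (u : 'I_n -> A) :
  (forall i j, i != j -> u i != u j) -> vdm u != 0.
Proof.
move=> neq; apply/prodf_neq0 => p lt_p; rewrite subr_eq0 neq //.
by apply: contraTneq lt_p => ->; rewrite ltnn.
Qed.

Lemma vdm_eq0 (A : comNzRingType) n (u : 'I_n -> A) (i j : 'I_n) :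
  (i < j)%N -> u i = u j -> vdm u = 0.
Proof. by move=> lt_ij eq_u; rewrite /vdm (bigD1 (i, j)) //= eq_u subrr mul0r. Qed.

Variables (R : fieldType) (n : nat).

Lemma vdmX_neq0 : vdm (fun i : 'I_n => 'X_i : {mpoly R[n]}) != 0.
Proof. by apply: vdm_neq0 => i j ne; rewrite -subr_eq0 mpolyX_neq. Qed.

(** Exchanging x_i and x_j shows that the polynomial is zero when they are
    equal; characteristic 2 would be an exception. *)
Lemma antisym_div (p : {mpoly R[n]}) : 2%:R != 0 :> R ->
  (forall s : 'S_n, msym s p = (-1) ^+ s * p) ->
  exists2 g, g \is symmetric & p = vdm (fun i => 'X_i) * g.
Proof.
move=> char2 anti.
have [g def_p] : exists g, p = vdm (fun i => 'X_i) * g.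
  pose J := enum [pred p : 'I_n * 'I_n | (p.1 < p.2)%N].
  have memJ (ij : 'I_n * 'I_n) : (ij \in J) = (ij.1 < ij.2)%N by rewrite mem_enum.
  suff [g Hg] : exists g, p = (\prod_(ij <- J) ('X_ij.2 - 'X_ij.1)) * g.
    by exists g; rewrite Hg /J big_enum.
  apply: (@prod_dvd _ _ J _ (fun ij x => x \mPo substX ij.2 'X_ij.1)).
  - exact: enum_uniq.
  - by move=> ij x y; rewrite comp_mpolyM.
  - move=> ij x _ x0; have [g] := substX_dvd ij.2 'X_ij.1 x.
    by rewrite x0 subr0; exists g.
  - move=> [i j] [k l]; rewrite !memJ /= => lt_ij lt_kl ne.
    rewrite comp_mpolyB !comp_mpolyU !tnth_substX.
    case: (eqVneq j l) (eqVneq i l) => [ejl|njl] [eil|nil]; subst.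
    + by rewrite ltnn in lt_ij.
    + by rewrite mpolyX_neq //; apply: contraNneq ne => ->.
    + rewrite mpolyX_neq //; apply: contraTneq (ltn_trans lt_kl lt_ij) => ->.
      by rewrite ltnn.
    by rewrite mpolyX_neq //; apply: contraTneq lt_ij => ->; rewrite ltnn.
  move=> [i j]; rewrite memJ /= => lt_ij.
  have ne : i != j by apply: contraTneq lt_ij => ->; rewrite ltnn.
  have := congr1 (comp_mpoly (substX j 'X_i)) (anti (tperm i j)).
  rewrite odd_tperm ne expr1 mulN1r comp_mpolyN msym_mPo.
  have -> : p \mPo [tuple tnth (substX j 'X_i) (tperm i j k) | k < n]
    = p \mPo substX j 'X_i.
    apply: eq_comp_mpoly => k; rewrite tnth_mktuple !tnth_substX.
    case: tpermP => [->|->|/eqP ni /eqP nj]; rewrite ?eqxx ?(negPf ne) //.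
  move/eqP; rewrite -addr_eq0 -mulr2n -scaler_nat scaler_eq0 (negPf char2) /=.
  by move/eqP.
exists g => //; apply/issymP => s; apply: (mulfI vdmX_neq0).
have := anti s; rewrite def_p msymM.
have -> : msym s (vdm (fun i => 'X_i)) = (-1) ^+ s * vdm (fun i => 'X_i : {mpoly R[n]}).
  rewrite -vdm_perm (rmorph_vdm (msym s)); apply: eq_vdm => i.
  exact: msymU.
by rewrite -!mulrA => /(can_inj (signrMK s)).
Qed.

End Vdm.

(** * Diagonal values of interpolation polynomials *)

Section Diagonal.
Variables (R : fieldType) (q t : R).
Implicit Types (la mu : intpart).

Lemma cell_prodE N la (w : nat -> nat -> R) : (size la <= N)%N ->
  cell_prod la w = \prod_(i < N) \prod_(j < part la i.+1) w i.+1 j.+1.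
Proof.
move=> le_N; rewrite /cell_prod big_add1 /=.
rewrite -(big_mkord xpredT (fun i => \prod_(j < part la i.+1) w i.+1 j.+1)).
rewrite [RHS](big_cat_nat (n := size la)) //= [X in _ = _ * X]big_nat.
rewrite [X in _ = _ * X]big1 ?mulr1; last first.
  by move=> i /andP[le_i _]; rewrite part_default ?big_ord0.
by apply: eq_bigr => i _; rewrite big_add1 big_mkord.
Qed.

Lemma cell_prod_addcol N la (w : nat -> nat -> R) :
  cell_prod (addcol N la) w =
  (\prod_(i < N) w i.+1 1%N) *
  \prod_(i < N) \prod_(j < part la i.+1) w i.+1 j.+2.
Proof.
rewrite (cell_prodE _ (size_addcol N la)) -big_split /=.
by apply: eq_bigr => i _; rewrite part_addcol big_ord_recl.
Qed.

Lemma conj_addcol1 N la : conj_part (addcol N la) 1 = N.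
Proof.
rewrite (conj_part_sum (N := N)) ?size_addcol //.
under eq_bigr do rewrite part_addcol; by rewrite sum_nat_const card_ord muln1.
Qed.

Lemma conj_addcolS N la j : (size la <= N)%N -> (0 < j)%N ->
  conj_part (addcol N la) j.+1 = conj_part la j.
Proof.
move=> le_N j_gt0; rewrite !(conj_part_sum (N := N)) ?size_addcol //.
by apply: eq_bigr => i _; rewrite part_addcol ltnS.
Qed.

Lemma Cplus_addcol N la x : q != 0 -> (size la <= N)%N ->
  Cplus q t (addcol N la) x =
  (\prod_(i < N) (1 - q ^+ (part la i.+1).+1 * t ^ (1 - N%:Z - i%:Z) * x))
  * Cplus q t la (q ^+ 2 * x).
Proof.
move=> q0 le_N; rewrite /Cplus cell_prod_addcol; congr (_ * _).
  apply: eq_bigr => i _; rewrite part_addcol conj_addcol1.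
  congr (1 - _ * _ * _); last by congr (_ ^ _); lia.
  by rewrite exprnP; congr (_ ^ _); lia.
rewrite (cell_prodE _ le_N); apply: eq_bigr => i _; apply: eq_bigr => j _.
rewrite part_addcol conj_addcolS //.
have -> : (part la i.+1).+1%:Z + j.+2%:Z - 1 = (part la i.+1)%:Z + j.+1%:Z - 1 + 2.
  by lia.
by rewrite expfzDr // -[q ^ 2]exprnP; ring.
Qed.

(** The value of an interpolation polynomial at its own partition, up to a
   factor that depends on neither a nor b: removing a column or fixing the last
   variable produces the factors of a product over the cells. *)
Lemma interpz_diag n la a0 b0 : admissible q t a0 b0 -> (size la <= n)%N ->
  exists2 k : R, k != 0 & forall a b (F : {mpoly R[n]}),
    admissible q t a b -> is_interpz q t a b la F ->
    F.@[zpt q t a b la] = F@_(mnm_part n la) * k * b ^+ weight la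
      * Cplus q t la (t ^ (2 * n%:Z - 2) * (a / b)).
Proof.
move=> adm0; have [_ _ [q0 t0 _ _]] := adm0.
elim: n la => [|n IHn] la le_n.
  have la_nil : la = mkpart [::].
    by apply: part_inj => i i_gt0; rewrite !part_default // (leq_ltn_trans le_n).
  exists 1; first exact: oner_neq0.
  move=> a b F _ _; rewrite {1}[F]nvar0_mpolyC mevalC.
  have -> : mnm_part 0 la = 0%MM by apply/mnmP => -[].
  by rewrite /Cplus (cell_prodE _ le_n) big_ord0 la_nil !mulr1.
have [B lt_B] : exists B, (weight la < B)%N by exists (weight la).+1.
elim: B la le_n lt_B => // B IHB la le_n lt_B.
move: (le_n); rewrite leq_eqVlt => /orP[/eqP sz_la|].
  have [mu sz_mu def_la] := addcol_surj sz_la.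
  have [|k k0 IHk] := IHB mu sz_mu.
    by move: lt_B; rewrite def_la weight_addcol //; lia.
  pose y (i : 'I_n.+1) : R := ypt q t la i.
  have y1 i : y i != 1 by apply: (ypt_neq1 adm0); rewrite def_la part_addcol.
  have y0 i : y i != 0 := ypt_neq0 adm0 la i.
  exists ((\prod_i (1 / y i - 1)) * k / q ^+ weight mu).
    rewrite !mulf_neq0 ?invr_neq0 ?expf_neq0 //; apply/prodf_neq0 => i _.
    rewrite subr_eq0; apply: contra (y1 i) => /eqP eq1.
    by rewrite -[y i]invrK -[(y i)^-1]mul1r eq1 invr1.
  move=> a b F adm isF; have [a_0 b_0 _] := adm.
  rewrite def_la in isF *.
  have [G isG [leadE defF]] := interpz_column adm sz_mu isF.
  rewrite leadE {1}defF mevalM meval_lin_prod.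
  have -> : G.@[zpt q t a b (addcol n.+1 mu)] = G.@[zpt q t (q * a) (b / q) mu].
    by apply: meval_eq => i; rewrite zpt_addcol.
  have adm' : admissible q t (q * a) (b / q).
    by have := admissible_mul 1 0 (-1) 0 adm; rewrite !mulr1 [b / q]mulrC.
  rewrite (IHk _ _ _ adm' isG) weight_addcol // Cplus_addcol //.
  have -> : t ^ (2 * n.+1%:Z - 2) * (q * a / (b / q))
    = q ^+ 2 * (t ^ (2 * n.+1%:Z - 2) * (a / b)) by field; rewrite q0 b_0.
  have -> : \prod_(i < n.+1) (zpt q t a b (addcol n.+1 mu) i - (a + b))
    = b ^+ n.+1 * (\prod_(i < n.+1) (1 / y i - 1)) *
     \prod_(i < n.+1) (1 - q ^+ (part mu i.+1).+1 * t ^ (1 - n.+1%:Z - i%:Z)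
         * (t ^ (2 * n.+1%:Z - 2) * (a / b))).
    have -> : b ^+ n.+1 = \prod_(i < n.+1) b by rewrite prodr_const card_ord.
    rewrite -!big_split /=.
    apply: eq_bigr => i _.
    have -> : q ^+ (part mu i.+1).+1 * t ^ (1 - n.+1%:Z - i%:Z) * (t ^ (2 * n.+1%:Z - 2) * (a / b))
       = y i * (a / b).
      have -> : y i = q ^+ (part mu i.+1).+1 * t ^+ (n.+1 - i.+1).
        by rewrite /y /ypt def_la part_addcol.
      rewrite [LHS]mulrA; congr (_ * (a / b)); rewrite -mulrA.
      rewrite -expfzDr // exprnP [t ^+ _]exprnP; congr (_ * t ^ _).
      by have := ltn_ord i; lia.
    have := y0 i; rewrite -def_la /zpt -/(y i) => yi0.
    by field; rewrite ?yi0 ?b_0.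
  rewrite expr_div_n [in RHS]exprD.
  have q1 : q ^+ weight mu != 0 by rewrite expf_neq0.
  by field.
rewrite ltnS => le_n'; have [k k0 IHk] := IHn la le_n'.
exists (k / t ^+ weight la); first by rewrite mulf_neq0 // invr_neq0 // expf_neq0.
move=> a b F adm isF; have [a_0 b_0 _] := adm.
have [isG leadE valE] := interpz_restr adm le_n' isF.
have adm' : admissible q t (t * a) (b / t).
  by have := admissible_mul 0 1 0 (-1) adm; rewrite !mul1r [b / t]mulrC.
rewrite -valE // (IHk _ _ _ adm' isG) leadE.
have -> : t ^ (2 * n%:Z - 2) * (t * a / (b / t)) = t ^ (2 * n.+1%:Z - 2) * (a / b).
  have -> : t ^ (2 * n.+1%:Z - 2) = t ^ (2 * n%:Z - 2) * t ^+ 2.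
    by rewrite exprnP -expfzDr //; congr (_ ^ _); lia.
  by field; rewrite ?t0 ?b_0.
have t1 : t ^+ weight la != 0 by rewrite expf_neq0.
by rewrite expr_div_n; field.
Qed.

End Diagonal.

(** * A difference operator *)

Section Chebyshev.
Implicit Types (A B : comNzRingType).

(** The pair (h_k, h_(k+1)), where h_k = (x^k - y^k) / (x - y) is expressed
   in terms of Z = x + y and c = x y. *)
Fixpoint hpair A (Z c : A) k : A * A :=
  if k is k'.+1 then ((hpair Z c k').2, Z * (hpair Z c k').2 - c * (hpair Z c k').1)
  else (0, 1).

(** The quotient (x^k y^l - y^k x^l) / (x - y), again in terms of Z and c. *)
Definition hdiff A (Z c : A) k l : A :=
  if (l <= k)%N then c ^+ l * (hpair Z c (k - l)).1
  else - (c ^+ k * (hpair Z c (l - k)).1).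

Lemma hpairE A (x y : A) k :
  (hpair (x + y) (x * y) k).1 * (x - y) = x ^+ k - y ^+ k
  /\ (hpair (x + y) (x * y) k).2 * (x - y) = x ^+ k.+1 - y ^+ k.+1.
Proof.
elim: k => [|k [IH1 IH2]] /=; first by rewrite !expr0 !expr1; split; ring.
split=> //; rewrite mulrBl -!mulrA IH1 IH2 !exprS; ring.
Qed.

Lemma hdiffE A (x y : A) k l :
  hdiff (x + y) (x * y) k l * (x - y) = x ^+ k * y ^+ l - y ^+ k * x ^+ l.
Proof.
rewrite /hdiff; case: leqP => [le_lk|/ltnW le_kl].
  rewrite -mulrA (hpairE x y _).1 exprMn.
  have E z : z ^+ k = z ^+ (k - l) * z ^+ l :> A by rewrite -exprD subnK.
  by rewrite !E; ring.
rewrite mulNr -mulrA (hpairE x y _).1 exprMn.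
have E z : z ^+ l = z ^+ (l - k) * z ^+ k :> A by rewrite -exprD subnK.
by rewrite !E; ring.
Qed.

Lemma rmorph_hpair A B (f : {rmorphism A -> B}) Z c k :
  f (hpair Z c k).1 = (hpair (f Z) (f c) k).1 /\
  f (hpair Z c k).2 = (hpair (f Z) (f c) k).2.
Proof.
elim: k => [|k [IH1 IH2]] /=; first by rewrite rmorph0 rmorph1.
by split=> //; rewrite rmorphB !rmorphM IH1 IH2.
Qed.

Lemma rmorph_hdiff A B (f : {rmorphism A -> B}) Z c k l :
  f (hdiff Z c k l) = hdiff (f Z) (f c) k l.
Proof.
rewrite /hdiff; case: ifP => _.
  by rewrite rmorphM rmorphXn (rmorph_hpair f _ _ _).1.
by rewrite rmorphN rmorphM rmorphXn (rmorph_hpair f _ _ _).1.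
Qed.

End Chebyshev.

Section SignedPerm.
Variable n : nat.

Lemma split_lshift (i : 'I_n) : split (lshift n i) = inl i :> 'I_n + 'I_n.
Proof. exact: (unsplitK (inl i)). Qed.

Lemma split_rshift (i : 'I_n) : split (rshift n i) = inr i :> 'I_n + 'I_n.
Proof. exact: (unsplitK (inr i)). Qed.

Variables (s : {perm 'I_n}) (e : {ffun 'I_n -> bool}).

(** The permutation of n + n variables x_i, y_i that corresponds to an element
    of BC_n; inverting x_i means exchanging it with y_i. *)
Definition pm_fun (i : 'I_(n + n)) : 'I_(n + n) :=
  match split i with
  | inl j => if e j then rshift n (s j) else lshift n (s j)
  | inr j => if e j then lshift n (s j) else rshift n (s j)
  end.

Lemma pm_fun_inj : injective pm_fun.
Proof.
have P a b : (unsplit a = unsplit b :> 'I_(n + n)) -> a = b.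
  exact: (can_inj unsplitK).
move=> i j; rewrite -[i]splitK -[j]splitK /pm_fun !unsplitK.
case: (split i) (split j) => a [] b /=; case ea: (e a); case eb: (e b) => eq_ij;
  (have := P _ _ (eq_ij : unsplit (inl _) = unsplit (inl _))) ||
  (have := P _ _ (eq_ij : unsplit (inr _) = unsplit (inr _))) ||
  (have := P _ _ (eq_ij : unsplit (inl _) = unsplit (inr _))) ||
  (have := P _ _ (eq_ij : unsplit (inr _) = unsplit (inl _))); move=> [] //;
  move/perm_inj=> eq_ab; rewrite eq_ab ?eq_ab ?eb // in ea *; by rewrite ?eb in ea.
Qed.

Definition pm_perm : {perm 'I_(n + n)} := perm pm_fun_inj.

End SignedPerm.

Section SignSum.
Variables (R : fieldType) (n : nat) (c : R).
Implicit Types (p : {mpoly R[n + n]}) (s : 'S_n) (x y : 'I_n -> R).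

Definition perm2 s : 'S_(n + n) := pm_perm s [ffun=> false].

Lemma perm2_l s i : perm2 s (lshift n i) = lshift n (s i).
Proof. by rewrite permE /pm_fun split_lshift ffunE. Qed.

Lemma perm2_r s i : perm2 s (rshift n i) = rshift n (s i).
Proof. by rewrite permE /pm_fun split_rshift ffunE. Qed.

Lemma perm2V_l s i : (perm2 s)^-1%g (lshift n (s i)) = lshift n i.
Proof. by rewrite -perm2_l permK. Qed.

Lemma perm2V_r s i : (perm2 s)^-1%g (rshift n (s i)) = rshift n i.
Proof. by rewrite -perm2_r permK. Qed.

Definition hmon (m : 'X_{1..n + n}) : {mpoly R[n]} :=
  \prod_(i < n) hdiff 'X_i c%:MP (m (lshift n i)) (m (rshift n i)).

(** With y_i = c / x_i, the alternating sum of p over the exchanges of x_i and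
   y_i is the product of the x_i - y_i and of a polynomial in the x_i + y_i. *)
Definition altsum p : {mpoly R[n]} := \sum_(m <- msupp p) p@_m *: hmon m.

Lemma altsum_lin k p p' : altsum (k *: p + p') = k *: altsum p + altsum p'.
Proof. exact: (flin_linear hmon k p p'). Qed.

Lemma altsum0 : altsum 0 = 0.
Proof. by rewrite /altsum -mpolyC0 msupp0 big_nil. Qed.

Lemma altsumN p : altsum (- p) = - altsum p.
Proof. by have := altsum_lin (-1) p 0; rewrite altsum0 !addr0 !scaleN1r. Qed.

Lemma altsum_sum (I : Type) (r : seq I) (k : I -> R) (G : I -> {mpoly R[n + n]}) :
  altsum (\sum_(i <- r) k i *: G i) = \sum_(i <- r) k i *: altsum (G i).
Proof. by elim/big_rec2: _ => [|i x y _ <-]; rewrite ?altsum0 ?altsum_lin. Qed.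

Lemma altsumX m : altsum 'X_[m] = hmon m.
Proof. by rewrite /altsum msuppX big_seq1 mcoeffX eqxx scale1r. Qed.

Lemma altsum_sym s p : altsum (msym (perm2 s) p) = msym s (altsum p).
Proof.
rewrite {1}[p]mpolyE [msym (perm2 s) _]raddf_sum /=.
under eq_bigr do rewrite msymZ msymX; rewrite altsum_sum /altsum raddf_sum /=.
apply: eq_bigr => m _; rewrite msymZ -/(altsum _) altsumX; congr (_ *: _).
rewrite /hmon msym_prod (reindex_inj (@perm_inj _ s)); apply: eq_bigr => i _.
rewrite !mnmE perm2V_l perm2V_r (rmorph_hdiff (msym s)) /=.
by rewrite msymU msymC.
Qed.

Definition swap_pt x y (e : {ffun 'I_n -> bool}) (j : 'I_(n + n)) : R :=
  match split j with
  | inl i => if e i then y i else x i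
  | inr i => if e i then x i else y i
  end.

Lemma altsum_eval p x y : (forall i, x i * y i = c) ->
  (altsum p).@[fun i => x i + y i] * \prod_i (x i - y i) =
  \sum_(e : {ffun 'I_n -> bool})
    (\prod_i (if e i then -1 else 1)) * p.@[swap_pt x y e].
Proof.
move=> xyc; under [RHS]eq_bigr do rewrite mevalE mulr_sumr.
rewrite exchange_big /= /altsum raddf_sum /= mulr_suml; apply: eq_bigr => m _.
rewrite mevalZ -mulrA.
transitivity (p@_m * \sum_(e : {ffun 'I_n -> bool}) \prod_i
   ((if e i then -1 else 1) * ((if e i then y i else x i) ^+ m (lshift n i)
     * (if e i then x i else y i) ^+ m (rshift n i)))).
  congr (_ * _); rewrite /hmon rmorph_prod -big_split /=.
  rewrite -(bigA_distr_bigA (fun i (e : bool) => (if e then -1 else 1) *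
    ((if e then y i else x i) ^+ m (lshift n i) * (if e then x i else y i) ^+ m (rshift n i)))).
  apply: eq_bigr => i _; rewrite big_bool /=.
  have -> : (hdiff 'X_i c%:MP (m (lshift n i)) (m (rshift n i))).@[fun i => x i + y i]
     = hdiff (x i + y i) (x i * y i) (m (lshift n i)) (m (rshift n i)).
    rewrite (rmorph_hdiff (meval (fun i => x i + y i))) /=.
    by congr hdiff; [rewrite mevalXU|rewrite mevalC xyc].
  by rewrite hdiffE mul1r mulN1r addrC.
rewrite mulr_sumr; apply: eq_bigr => e _; rewrite big_split /= mulrCA.
congr (_ * (_ * _)); rewrite big_split_ord /= -big_split /=.
by apply: eq_bigr => i _; rewrite /swap_pt split_lshift split_rshift.
Qed.

End SignSum.

Section DOperator.
Variables (R : fieldType) (n : nat) (q t a b w : R).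
Hypothesis char2 : 2%:R != 0 :> R.

Notation c := (a * b).
Let X (i : 'I_n) : {mpoly R[n + n]} := 'X_(lshift n i).
Let Y (i : 'I_n) : {mpoly R[n + n]} := 'X_(rshift n i).

Let fac i := Y i - (w * c + a)%:MP + (a * w)%:MP * X i.
Let upt i := Y i + t%:MP * X i.
Let zsub := [tuple q%:MP * X i + Y i | i < n].

(** The summand of a difference operator. Where x_i y_i = a b, the factor of
    index i is (y_i - a) (1 - w x_i). It vanishes for y_i = a, and the
    Vandermonde product vanishes if x_i = t x_j when x_i is exchanged with y_i
    and x_j is not; this kills the shifts that do not lead to a partition. The
    parameter w is free, and serves to place a zero of the term without
    exchange. *)
Definition dterm (F : {mpoly R[n]}) : {mpoly R[n + n]} :=
  (\prod_i fac i) * vdm upt * (F \mPo zsub).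

Lemma dterm_anti F (s : 'S_n) : F \is symmetric ->
  msym (perm2 s) (dterm F) = (-1) ^+ s * dterm F.
Proof.
move=> symF; rewrite /dterm !msymM.
have sX i : msym (perm2 s) (X i) = X (s i) by rewrite msymU perm2_l.
have sY i : msym (perm2 s) (Y i) = Y (s i) by rewrite msymU perm2_r.
have -> : msym (perm2 s) (\prod_i fac i) = \prod_i fac i.
  rewrite msym_prod [RHS](reindex_inj (@perm_inj _ s)); apply: eq_bigr => i _.
  by rewrite /fac msymD msymB msymM !msymC sX sY.
have -> : msym (perm2 s) (vdm upt) = (-1) ^+ s * vdm upt.
  rewrite -vdm_perm (rmorph_vdm (msym (perm2 s))); apply: eq_vdm => i.
  by rewrite /upt [LHS]msymD msymM msymC sX sY.
have -> : msym (perm2 s) (F \mPo zsub) = F \mPo zsub.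
  rewrite msym_comp -{2}(issymP _ symF s) msym_mPo; apply: eq_comp_mpoly => i.
  by rewrite !tnth_mktuple msymD msymM msymC sX sY.
by rewrite !mulrA; congr (_ * _); rewrite [_ * (-1) ^+ s]mulrC.
Qed.

(** The summand is antisymmetric, hence so is its alternating sum. *)
Lemma dop_exists F : F \is symmetric ->
  exists2 G : {mpoly R[n]}, G \is symmetric &
    altsum c (dterm F) = vdm (fun i => 'X_i) * G.
Proof.
move=> symF; apply: antisym_div => // s.
rewrite -altsum_sym dterm_anti //; case: (odd_perm s).
  by rewrite expr1 !mulN1r altsumN.
by rewrite expr0 !mul1r.
Qed.

Lemma dterm_eval F (x y : 'I_n -> R) e : (forall i, x i * y i = c) ->
  (dterm F).@[swap_pt x y e] =
  (\prod_i (((if e i then x i else y i) - a) * (1 - w * (if e i then y i else x i))))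
  * vdm (fun i => (if e i then x i else y i) + t * (if e i then y i else x i))
  * F.@[fun i => q * (if e i then y i else x i) + (if e i then x i else y i)].
Proof.
move=> xyc; rewrite /dterm !mevalM.
have eX i : (X i).@[swap_pt x y e] = if e i then y i else x i.
  by rewrite mevalXU /swap_pt split_lshift.
have eY i : (Y i).@[swap_pt x y e] = if e i then x i else y i.
  by rewrite mevalXU /swap_pt split_rshift.
congr (_ * _ * _).
- rewrite rmorph_prod /=; apply: eq_bigr => i _.
  rewrite /fac mevalD mevalB mevalM !mevalC eX eY.
  have := xyc i; case: (e i) => <-; ring.
- rewrite (rmorph_vdm (meval (swap_pt x y e))) /=; apply: eq_vdm => i.
  by rewrite /upt mevalD mevalM mevalC eX eY.
rewrite comp_mpoly_meval; apply: meval_eq => i.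
by rewrite tnth_mktuple mevalD mevalM mevalC eX eY.
Qed.

(** The coefficients of the operator have the same degree in the first k
    variables as the denominator that is divided out. *)
Lemma dop_degle F G k D : altsum c (dterm F) = vdm (fun i => 'X_i) * G ->
  degle (fun i : 'I_n => (i < k)%N : nat) D F ->
  degle (fun i : 'I_n => (i < k)%N : nat) D G.
Proof.
move=> defG; set d := fun i : 'I_n => _ => degF.
pose d2 (j : 'I_(n + n)) := match split j with inl i | inr i => d i end.
have dX i : degle d2 (d i) (X i).
  by have := @degleU R _ d2 (lshift n i); rewrite {2}/d2 split_lshift.
have dY i : degle d2 (d i) (Y i).
  by have := @degleU R _ d2 (rshift n i); rewrite {2}/d2 split_rshift.
have dC D' x : degle d2 D' (x%:MP : {mpoly R[n + n]}) by apply: degleC.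
have dCM D' x p : degle d2 D' p -> degle d2 D' (x%:MP * p).
  by rewrite mul_mpolyC; apply: degleZ.
pose e := (\sum_i d i + \sum_(p : 'I_n * 'I_n | (p.1 < p.2)%N) d p.1)%N.
have d_anti (i j : 'I_n) : (i < j)%N -> (d j <= d i)%N.
  by move=> lt_ij; rewrite /d; case: (ltnP j k) => // /(ltn_trans lt_ij) ->.
have degT : degle d2 (e + D) (dterm F).
  rewrite /dterm; apply: degleM; first apply: degleM.
  - apply: degle_prod => i _; rewrite /fac.
    by apply: degleD; [apply: degleB|apply: dCM].
  - have du i : degle d2 (d i) (upt i) by apply: degleD => //; apply: dCM.
    apply: degle_prod => -[i j] /= lt_ij.
    by apply: degleB (degle_trans (d_anti _ _ lt_ij) (du j)) (du i).
  rewrite comp_mpolyEX; apply: degle_sum => m m_F _; apply: degleZ.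
  rewrite comp_mpolyX; apply: degle_trans (degF m m_F) _.
  apply: degle_prod => i _; apply: degleX; rewrite tnth_mktuple.
  by apply: degleD => //; apply: dCM.
have degh i k' : degle d (d i * k') ('X_i * (hpair ('X_i : {mpoly R[n]}) c%:MP k').1)
   /\ degle d (d i * k'.+1) ('X_i * (hpair ('X_i : {mpoly R[n]}) c%:MP k').2).
  elim: k' => [|k' [IH1 IH2]] /=.
    by rewrite mulr0 mulr1 muln1; split; [apply: degle0|apply: degleU].
  split=> //; rewrite mulrBr; apply: degleB.
    by rewrite mulnS; apply: degleM => //; apply: degleU.
  rewrite mulrCA mul_mpolyC; apply: degleZ; apply: degle_trans IH1.
  by rewrite leq_mul2l; apply/orP; right; apply: leqW.
(* Dividing by x_i - y_i lowers the degree in x_i by one; the additional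
   factor 'X_i restores it, so that no degree has to be subtracted. *)
pose P := (\prod_i 'X_i) * vdm (fun i => 'X_i) : {mpoly R[n]}.
apply: (@degle_div R n d e D P).
  apply: degeqM; first by apply: degeq_prod => i _; apply: degeqU.
  apply: degeq_prod => -[i j] /= lt_ij; apply: degeq_sub; last exact: d_anti.
  by apply: contraTneq lt_ij => ->; rewrite ltnn.
rewrite /P -mulrA -defG /altsum mulr_sumr; apply: degle_sum => m m_T _.
rewrite -scalerAr; apply: degleZ; rewrite /hmon -big_split /=.
apply: degle_trans (degT m m_T) _.
have -> : wt d2 m = (\sum_i d i * (m (lshift n i) + m (rshift n i)))%N.
  rewrite /wt big_split_ord /= -big_split; apply: eq_bigr => i _.
  by rewrite /d2 split_lshift split_rshift mulnDr.
apply: degle_prod => i _; rewrite /hdiff; case: ifP => _; rewrite ?mulrN;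
  try apply: degleN; rewrite -rmorphXn mulrCA mul_mpolyC; apply: degleZ;
  apply: degle_trans (degh i _).1; rewrite leq_mul2l; apply/orP; right.
  by rewrite (leq_trans (leq_subr _ _)) ?leq_addr.
by rewrite (leq_trans (leq_subr _ _)) ?leq_addl.
Qed.

Lemma dop_eval F G (x y : 'I_n -> R) :
  altsum c (dterm F) = vdm (fun i => 'X_i) * G ->
  (forall i, x i * y i = c) ->
  G.@[fun i => x i + y i] * (vdm (fun i => x i + y i) * \prod_i (x i - y i)) =
  \sum_(e : {ffun 'I_n -> bool})
    (\prod_i (if e i then -1 else 1)) *
     ((\prod_i (((if e i then x i else y i) - a) * (1 - w * (if e i then y i else x i))))
      * vdm (fun i => (if e i then x i else y i) + t * (if e i then y i else x i))
      * F.@[fun i => q * (if e i then y i else x i) + (if e i then x i else y i)]).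
Proof.
move=> defG xyc.
have := altsum_eval (dterm F) xyc; rewrite defG mevalM.
rewrite (rmorph_vdm (meval (fun i => x i + y i))) /=.
rewrite (eq_vdm (v := fun i => x i + y i)); last by move=> i; rewrite mevalXU.
rewrite mulrA [G.@[_] * _]mulrC => ->.
by apply: eq_bigr => e _; rewrite dterm_eval.
Qed.

(** The sum of the k largest exponents is the degree in the first k variables,
    after a suitable permutation. *)
Lemma degle_dom (F : {mpoly R[n]}) la : F \is symmetric ->
  (forall m, m \in msupp F -> dom_le (part_mnm m) la) <->
  (forall k, degle (fun i : 'I_n => (i < k)%N : nat) (psum la k) F).
Proof.
move=> symF; split=> [dom k m /dom le_m|deg m m_F].
  apply: leq_trans ((dom_leP _ _).1 le_m k); apply: leq_trans (sub_psum m k).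
  rewrite /wt [X in (_ <= X)%N]big_mkcond; apply: leq_sum => i _.
  by case: ifP; rewrite ?mul1n ?mul0n.
pose m' := mnm_part n (part_mnm m).
have m'_F : m' \in msupp F.
  have [s def_m] : exists s : 'S_n, m' = [multinom m (s i) | i < n].
    by apply: part_mnm_eq; rewrite mnm_partK ?size_part_mnm.
  by rewrite def_m issym_msupp.
have wtE k : (k <= n)%N -> wt (fun i : 'I_n => (i < k)%N : nat) m' = psum (part_mnm m) k.
  move=> le_k; rewrite /wt /psum big_add1 /= big_mkord.
  rewrite (big_ord_widen _ (fun i => part (part_mnm m) i.+1) le_k) [RHS]big_mkcond.
  by apply: eq_bigr => i _; rewrite mnmE; case: ifP; rewrite ?mul1n ?mul0n.
apply/dom_leP => k; have [le_k|lt_k] := leqP k n.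
  by rewrite -wtE //; apply: deg.
have -> : psum (part_mnm m) k = psum (part_mnm m) n.
  by rewrite !psum_weight ?size_part_mnm // (leq_trans (size_part_mnm m)) // ltnW.
rewrite -wtE //; apply: leq_trans (deg n _ m'_F) _.
by rewrite /psum [X in (_ <= X)%N](big_cat_nat (n := n.+1)) ?leq_addr // ltnS ltnW.
Qed.

End DOperator.

(** * Extra vanishing *)

Section ExtraVanishing.
Variables (R : fieldType) (q t : R).
Hypothesis char2 : 2%:R != 0 :> R.
Implicit Types (a b : R) (la mu nu : intpart).

Lemma adm_yy n a b mu (i j : 'I_n) k : admissible q t a b ->
  a * (t ^+ k * (ypt q t mu i * ypt q t mu j)) != b.
Proof.
move=> adm; have [_ _ [q0 t0 _ _]] := adm.
have := adm_ypt adm (part mu i.+1 + part mu j.+1)%N (k + ((n - i.+1) + (n - j.+1)))%N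
  (k := 1) isT.
rewrite !expr1 -!exprnP !exprD; congr (a * _ != b); rewrite /ypt; ring.
Qed.

Lemma adm_y n a b mu (i : 'I_n) : admissible q t a b -> a * ypt q t mu i != b.
Proof.
move=> adm; have := adm_ypt adm (part mu i.+1) (n - i.+1)%N (k := 1) isT.
by rewrite !expr1.
Qed.

Lemma ypt_inj n a b mu (i j : 'I_n) : admissible q t a b -> i != j ->
  ypt q t mu i != ypt q t mu j.
Proof. by move=> adm ne; apply: (ypt_neq adm); rewrite ne. Qed.

Lemma vdm_twist_neq0 n a b mu k : admissible q t a b ->
  vdm (fun i : 'I_n => b / ypt q t mu i + t ^+ k * (a * ypt q t mu i)) != 0.
Proof.
move=> adm; apply: vdm_neq0 => i j ne.
have y0 l := ypt_neq0 adm mu (l : 'I_n).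
have yi := y0 i; have yj := y0 j.
rewrite -subr_eq0.
have -> : b / ypt q t mu i + t ^+ k * (a * ypt q t mu i) -
   (b / ypt q t mu j + t ^+ k * (a * ypt q t mu j))
 = (ypt q t mu i - ypt q t mu j) *
   (a * (t ^+ k * (ypt q t mu i * ypt q t mu j)) - b) / (ypt q t mu i * ypt q t mu j).
  by field; rewrite ?yi ?yj.
rewrite mulf_neq0 //; last by rewrite invr_neq0 // mulf_neq0.
by rewrite mulf_neq0 // subr_eq0; [apply: ypt_inj adm ne|apply: adm_yy].
Qed.

Lemma shift_partition n mu (e : {ffun 'I_n -> bool}) :
  (size mu <= n)%N ->
  (forall i : 'I_n, i.+1 = n -> e i -> (0 < part mu i.+1)%N) ->
  (forall i j : 'I_n, j = i.+1 :> nat -> e i -> ~~ e j ->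
     (part mu j.+1 < part mu i.+1)%N) ->
  exists2 nu : intpart, (size nu <= n)%N /\ part_incl nu mu &
    (forall i : 'I_n, part mu i.+1 = (part nu i.+1 + e i)%N).
Proof.
move=> le_n last_e adj_e.
have e_pos (i : 'I_n) : e i -> (0 < part mu i.+1)%N.
  move=> e_i; rewrite lt0n; apply/eqP.
  move: {2}(n - i)%N (erefl (n - i)%N) => k; elim: k i e_i => [|k IHk] i e_i def_k p0.
    by have := ltn_ord i; move: def_k; lia.
  have [lt_i|ge_i] := ltnP i.+1 n; last first.
    have eq_n : i.+1 = n by apply/eqP; rewrite eqn_leq ge_i ltn_ord.
    by have := last_e i eq_n e_i; rewrite p0.
  pose j := Ordinal lt_i; have [e_j|e_j] := boolP (e j).
    apply: (IHk j e_j); first by rewrite /= ; move: def_k; lia.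
    by apply/eqP; rewrite -leqn0 -p0 leq_part.
  by have := adj_e i j erefl e_i e_j; rewrite p0.
pose m := [multinom (part mu i.+1 - e i)%N | i < n].
have m_dec (i j : 'I_n) : (i <= j)%N -> (m j <= m i)%N.
  have step (k l : 'I_n) : l = k.+1 :> nat -> (m l <= m k)%N.
    move=> def_l; rewrite !mnmE.
    have le_l : (part mu l.+1 <= part mu k.+1)%N by apply: leq_part; rewrite // def_l.
    have [e_k|e_k] := boolP (e k); last by rewrite subn0 (leq_trans (leq_subr _ _)).
    have [e_l|e_l] := boolP (e l); first by rewrite leq_sub2r.
    by have := adj_e k l def_l e_k e_l; rewrite subn0 /=; lia.
  case: i j => [i lt_i] [j lt_j] /= /subnKC; move: (j - i)%N => k.
  elim: k j lt_j => [|k IHk] j lt_j def_j.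
    by rewrite (_ : Ordinal lt_j = Ordinal lt_i) //; apply/ord_inj; rewrite /= -def_j addn0.
  have lt_j' : (i + k < n)%N by rewrite -addnS in def_j *; lia.
  apply: leq_trans (IHk _ lt_j' erefl); apply: step; rewrite /= -def_j; lia.
exists (part_mnm m); [split; first exact: size_part_mnm|].
  rewrite -(mnm_partK le_n); apply: part_mnm_incl => i.
  by rewrite !mnmE leq_subr.
move=> i; rewrite part_mnm_sorted // mnmE subnK //.
by case e_i: (e i) => //; apply: e_pos.
Qed.

Section AtPoint.
Variables (n : nat) (a b w : R) (mu : intpart) (F G : {mpoly R[n]}).
Hypothesis adm : admissible q t a b.
Hypothesis le_n : (size mu <= n)%N.
Hypothesis defG : altsum (a * b) (dterm q t a b w F) = vdm (fun i => 'X_i) * G.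
Hypothesis F0 : forall nu, part_incl nu mu -> nu <> mu -> (size nu <= n)%N ->
  F.@[zpt q t (q * a) b nu] = 0.

Let y := ypt q t mu : 'I_n -> R.
Let y0 i : y i != 0 := ypt_neq0 adm mu i.

(** At the point of a partition only shifts to smaller partitions survive. *)
Lemma dop_at_point :
  exists2 k : R, k != 0 &
  G.@[zpt q t a b mu] * k =
  (\prod_i (1 - w * (a * y i))) * F.@[zpt q t (q * a) b mu].
Proof.
have [a0 b0 [q0 t0 _ _]] := adm.
pose x i := a * y i; pose xb i := b / y i.
have xxb i : x i * xb i = a * b by have := y0 i; rewrite /x /xb => yi; field.
have := dop_eval defG xxb.
rewrite (bigD1 [ffun=> false]) //= [X in _ = _ + X]big1 ?addr0; last first.
  move=> e ne; apply/eqP; rewrite mulf_eq0; apply/orP; right.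
  apply/negPn/negP; rewrite mulf_eq0 negb_or => /andP[nz1 nzF].
  move: nz1; rewrite mulf_eq0 negb_or => /andP[/prodf_neq0 nzA nzV].
  have [nu [sz_nu incl] def_nu] : exists2 nu : intpart, (size nu <= n)%N /\ part_incl nu mu &
    (forall i : 'I_n, part mu i.+1 = (part nu i.+1 + e i)%N).
    apply: shift_partition => // [i eq_n e_i|i j def_j e_i e_j].
      rewrite lt0n; apply/eqP => p0; have := nzA i isT; rewrite e_i mulf_eq0 negb_or.
      have n0 : (n - i.+1 = 0)%N by rewrite eq_n subnn.
      by rewrite /x /y /ypt p0 n0 !expr0 !mulr1 subrr eqxx.
    rewrite ltn_neqAle leq_part ?def_j // andbT; apply/eqP => eq_p.
    move/eqP: nzV; apply; apply: (@vdm_eq0 _ _ _ i j); first by rewrite def_j.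
    rewrite e_i (negPf e_j) /x /xb.
    have -> : y i = t * y j.
      have e2 : (n - i.+1 = (n - j.+1).+1)%N by have := ltn_ord j; lia.
      by rewrite /y /ypt e2 -eq_p -def_j exprS; ring.
    by have := y0 j => yj; field; rewrite ?yj ?t0.
  move/eqP: nzF; apply; rewrite -(F0 incl _ sz_nu); last first.
    move=> eq_nu; move/eqP: ne; apply; apply/ffunP => i; rewrite ffunE.
    by have := def_nu i; rewrite eq_nu; case: (e i) => //; lia.
  apply: meval_eq => i; rewrite /zpt /x /xb.
  have : y i = q ^+ e i * ypt q t nu i.
    by rewrite /y /ypt def_nu exprD; ring.
  have := ypt_neq0 adm nu i; have := y0 i; move: (y i) (ypt q t nu i) => yi yn yi0 yn0.
  by case: (e i) => /= ->; rewrite ?expr1 ?expr0 ?mul1r; field; rewrite ?yn0 ?q0.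
have ->: \prod_(i < n) (if [ffun=> false] i then -1 else 1 : R) = 1.
  by rewrite big1 // => i _; rewrite ffunE.
rewrite mul1r.
have -> : F.@[fun i => q * (if [ffun=> false] i then xb i else x i)
      + (if [ffun=> false] i then x i else xb i)] = F.@[zpt q t (q * a) b mu].
  by apply: meval_eq => i; rewrite !ffunE /zpt /x /xb -/(y i); ring.
have -> : vdm (fun i => (if [ffun=> false] i then x i else xb i)
    + t * (if [ffun=> false] i then xb i else x i)) = vdm (fun i => xb i + t ^+ 1 * x i).
  by apply: eq_vdm => i; rewrite !ffunE expr1.
have -> : \prod_(i < n) (((if [ffun=> false] i then x i else xb i) - a)
     * (1 - w * (if [ffun=> false] i then xb i else x i)))
   = (\prod_i (xb i - a)) * (\prod_i (1 - w * x i)).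
  by rewrite -big_split; apply: eq_bigr => i _; rewrite !ffunE.
have nzA : \prod_i (xb i - a) != 0.
  apply/prodf_neq0 => i _; have yi := y0 i.
  have -> : xb i - a = (b - a * y i) / y i by rewrite /xb; field.
  by rewrite mulf_neq0 ?invr_neq0 // subr_eq0 eq_sym adm_y.
have nzV : vdm (fun i => xb i + t ^+ 1 * x i) != 0 := vdm_twist_neq0 n mu 1 adm.
have nzZ : vdm (fun i => x i + xb i) != 0.
  have := vdm_twist_neq0 n mu 0 adm.
  by rewrite (eq_vdm (v := fun i => x i + xb i)) // => i; rewrite expr0 mul1r addrC.
have nzX : \prod_i (x i - xb i) != 0.
  apply/prodf_neq0 => i _; have yi := y0 i.
  have -> : x i - xb i = (a * (t ^+ 0 * (y i * y i)) - b) / y i.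
    by rewrite /x /xb expr0; field.
  by rewrite mulf_neq0 ?invr_neq0 // subr_eq0 adm_yy.
move=> eqG; exists ((vdm (fun i => x i + xb i) * \prod_i (x i - xb i))
   / ((\prod_i (xb i - a)) * vdm (fun i => xb i + t ^+ 1 * x i))).
  by rewrite !mulf_neq0 ?invr_neq0 ?mulf_neq0.
rewrite mulrA [G.@[_] * _]eqG.
by field; rewrite nzV nzA.
Qed.

End AtPoint.

(** The extra vanishing property.  The difference operator maps an
   interpolation polynomial for (q a, b) to a nonzero multiple of that for
   (a, b); with the parameter w chosen so that the diagonal term vanishes at
   mu, the value at mu involves smaller partitions only. *)
Theorem extra_vanishing n a b la mu (F : {mpoly R[n]}) : admissible q t a b ->
  (size la <= n)%N -> (size mu <= n)%N -> is_interpz q t a b la F ->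
  ~ part_incl la mu -> F.@[zpt q t a b mu] = 0.
Proof.
move=> adm le_la; have [B lt_B] : exists B, (weight mu < B)%N by exists (weight mu).+1.
elim: B mu a b F adm lt_B => // B IHB mu a b F adm lt_B le_mu isF nincl.
have [a0 b0 [q0 t0 _ _]] := adm.
have adm' : admissible q t (q * a) b.
  by have := admissible_mul 1 0 0 0 adm; rewrite !mulr1 !mul1r.
have [i0 ne_i0] : exists i0 : 'I_n, part mu i0.+1 != part la i0.+1.
  apply/existsP; rewrite -[[exists _, _]]negbK negb_exists; apply/negP => /forallP eq_p.
  apply: nincl => -[//|i] _; have [lt_i|ge_i] := ltnP i n.
    by have := eq_p (Ordinal lt_i); rewrite negbK => /eqP->.
  by rewrite part_default // ltnS (leq_trans le_la).
(* This makes the term without shifts vanish at mu, but not at la. *)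
pose w := (a * ypt q t mu i0)^-1.
have [F' isF'] := interpz_exists adm' le_la.
have [G symG defG] := dop_exists q t a b w char2 (iz_sym isF').
have suppG : forall m, m \in msupp G -> dom_le (part_mnm m) la.
  apply/(degle_dom la symG) => k; apply: dop_degle defG _.
  exact: ((degle_dom la (iz_sym isF')).1 (iz_supp isF')).
have zeroG nu : dom_lt nu la -> (size nu <= n)%N -> G.@[zpt q t a b nu] = 0.
  move=> lt_nu sz_nu.
  have [|k k0 eqG] := dop_at_point adm sz_nu defG.
    move=> nu' incl _ sz_nu'; apply: (iz_zero isF') => //.
    exact: dom_lt_incl incl lt_nu.
  move/eqP: eqG; rewrite (iz_zero isF') // mulr0 mulf_eq0 (negPf k0) orbF.
  by move/eqP.
have eqFG := interpz_unique adm isF symG suppG zeroG.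
have G_la : G.@[zpt q t a b la] != 0.
  have [|k k0 eqG] := dop_at_point adm le_la defG.
    by move=> nu incl ne sz_nu; apply: (iz_zero isF') => //; apply: incl_dom_lt.
  suff : G.@[zpt q t a b la] * k != 0 by rewrite mulf_eq0 negb_or => /andP[].
  rewrite eqG mulf_neq0 ?(interpz_val_neq0 adm' le_la isF') //.
  apply/prodf_neq0 => i _; rewrite subr_eq0 eq_sym /w.
  have := ypt_neq0 adm mu i0 => y0.
  apply/eqP => eq1; have : ypt q t la i == ypt q t mu i0.
    have nz : a * ypt q t mu i0 != 0 by rewrite mulf_neq0.
    apply/eqP/(mulfI a0); rewrite -[LHS](mulVKf nz) eq1 mulr1 //.
  apply/negP; apply: (ypt_neq adm); case: eqP => [->|//] /=.
  by rewrite eq_sym.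
have G_mu : G.@[zpt q t a b mu] = 0.
  have [|k k0 eqG] := dop_at_point adm le_mu defG.
    move=> nu incl ne sz_nu; apply: IHB isF' _ => //.
      have : (weight nu < weight mu)%N.
        rewrite ltnNge; apply/negP => le_w; apply: ne.
        exact: incl_weight_eq.
      by move: lt_B; lia.
    by move=> incl'; apply: nincl; apply: part_incl_trans incl' incl.
  move/eqP: eqG; rewrite (bigD1 i0) //= /w mulVf ?subrr ?mul0r; last first.
    by rewrite mulf_neq0 ?(ypt_neq0 adm).
  by rewrite mulf_eq0 (negPf k0) orbF => /eqP.
have leadG : G@_(mnm_part n la) != 0.
  apply: contra_neq G_la => leadG; move: (congr1 (meval (zpt q t a b la)) eqFG).
  rewrite leadG scale0r meval0 mevalZ => /eqP.
  by rewrite mulf_eq0 (negPf (iz_lead isF)) => /eqP.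
move: (congr1 (meval (zpt q t a b mu)) eqFG); rewrite !mevalZ G_mu mulr0 => /esym/eqP.
by rewrite mulf_eq0 (negPf leadG) => /eqP.
Qed.

End ExtraVanishing.

(** * Orbit sums of the hyperoctahedral group *)

Section Triangular.
Variables (R : fieldType) (V : lmodType R) (e : intpart -> V).
Variable chi : intpart -> V -> R.
Hypothesis chi_lin : forall x k v w, chi x (k *: v + w) = k * chi x v + chi x w.

Lemma weight_argmax (l : seq intpart) : l != [::] ->
  exists2 mu, mu \in l & forall nu, nu \in l -> (weight nu <= weight mu)%N.
Proof.
elim: l => // x l IHl _; case: (eqVneq l [::]) => [->|/IHl[mu mu_l max_mu]].
  by exists x => [|nu]; rewrite ?mem_head // inE => /eqP->.
have [le_x|lt_x] := leqP (weight x) (weight mu).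
  exists mu => [|nu]; rewrite inE ?mu_l ?orbT // => /predU1P[->//|].
  exact: max_mu.
exists x => [|nu]; rewrite ?mem_head // inE => /predU1P[->//|/max_mu le_nu].
exact: leq_trans le_nu (ltnW lt_x).
Qed.

(** The coefficient at an index of maximal weight is isolated by its own
    linear form. *)
Lemma triangular_free (c : {freeg intpart / R}) :
  (forall mu, mu \in dom c -> chi mu (e mu) != 0) ->
  (forall mu ka, mu \in dom c -> ka \in dom c -> chi mu (e ka) != 0 -> part_incl mu ka) ->
  flin e c = 0 -> c = 0.
Proof.
move=> diag trig c0; apply/eqP; rewrite -dom_eq0; apply/negPn/negP.
case/weight_argmax=> mu mu_c max_mu; have := diag mu mu_c.
apply/negP; rewrite negbK; have : chi mu (flin e c) = 0 by rewrite c0 (linform0 chi_lin).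
rewrite /flin (linform_sum chi_lin) (bigD1_seq mu) ?uniq_dom //= big1_seq ?addr0.
  rewrite (linformZ chi_lin) => /eqP; rewrite mulf_eq0 => /orP[c_0|//].
  by move: mu_c; rewrite mem_dom c_0.
move=> ka /andP[ne ka_c]; rewrite (linformZ chi_lin).
have [->|nz] := eqVneq (chi mu (e ka)) 0; first by rewrite mulr0.
case/eqP: ne; apply/esym; apply: incl_weight_eq (max_mu _ ka_c).
exact: trig nz.
Qed.
End Triangular.

Section UniProd.
Variables (R : fieldType) (n : nat).

Definition unip (i : 'I_n) (p : {poly R}) : {mpoly R[n]} :=
  \sum_(j < size p) p`_j *: 'X_i ^+ j.

Lemma unipE (i : 'I_n) (p : {poly R}) K : (size p <= K)%N ->
  unip i p = \sum_(j < K) p`_j *: 'X_i ^+ j.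
Proof.
move=> le_K; rewrite /unip (big_ord_widen _ (fun j => p`_j *: 'X_i ^+ j) le_K).
rewrite big_mkcond; apply: eq_bigr => j _; case: ltnP => // le_j.
by rewrite nth_default // scale0r.
Qed.

Lemma unip_eval i p (z : 'I_n -> R) : (unip i p).@[z] = p.[z i].
Proof.
rewrite /unip raddf_sum horner_coef; apply: eq_bigr => j _.
by rewrite /= mevalZ rmorphXn /= mevalXU.
Qed.

Lemma msym_unip (s : 'S_n) i p : msym s (unip i p) = unip (s i) p.
Proof.
rewrite /unip raddf_sum; apply: eq_bigr => j _.
by rewrite /= msymZ rmorphXn /= msymU.
Qed.

Lemma mcoeff_unip (f : 'I_n -> {poly R}) m :
  (\prod_i unip i (f i))@_m = \prod_i (f i)`_(m i).
Proof.
pose K := \max_(i < n) size (f i).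
have le_K i : (size (f i) <= K)%N := leq_bigmax (F := fun i => size (f i)) i.
under eq_bigr do rewrite (unipE _ (le_K _)).
rewrite (bigA_distr_bigA (fun i (j : 'I_K) => (f i)`_j *: 'X_i ^+ j)) raddf_sum /=.
have termE (g : {ffun 'I_n -> 'I_K}) :
  (\prod_i ((f i)`_(g i) *: 'X_i ^+ g i : {mpoly R[n]}))@_m
  = (\prod_i (f i)`_(g i)) * ([forall i, g i == m i :> nat])%:R.
  rewrite scaler_prod mcoeffZ; congr (_ * _).
  have -> : \prod_i ('X_i ^+ g i : {mpoly R[n]}) = 'X_[[multinom g i : nat | i < n]].
    by rewrite mpolyXE_id; apply: eq_bigr => i _; rewrite mnmE.
  rewrite mcoeffX; congr (_ : bool)%:R; apply/eqP/forallP => [<- i|eq_m].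
    by rewrite mnmE.
  by apply/mnmP => i; rewrite mnmE; apply/eqP.
under eq_bigr do rewrite termE.
have [/forallP lt_m|] := boolP [forall i, (m i < K)%N].
  pose g0 := [ffun i => Ordinal (lt_m i)].
  rewrite (bigD1 g0) //= [X in _ + X]big1 ?addr0.
    have -> : [forall i, g0 i == m i :> nat] by apply/forallP => i; rewrite ffunE.
    by rewrite mulr1; apply: eq_bigr => i _; rewrite ffunE.
  move=> g ne; case: forallP => [eq_m|_]; last by rewrite mulr0.
  by case/eqP: ne; apply/ffunP => i; apply/ord_inj; rewrite ffunE; apply/eqP.
rewrite negb_forall => /existsP[i]; rewrite -leqNgt => le_m.
rewrite big1 => [|g _]; last first.
  case: forallP => [/(_ i)/eqP eq_m|_]; last by rewrite mulr0.
  by have := ltn_ord (g i); rewrite eq_m ltnNge le_m.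
by rewrite (bigD1 i) //= nth_default ?mul0r // (leq_trans (le_K i)).
Qed.

End UniProd.

Section ChebyshevT.
Variable R : fieldType.

(** The pair (c_k, c_(k+1)), where c_k maps x + 1/x to x^k + 1/x^k. *)
Fixpoint tpair k : {poly R} * {poly R} :=
  if k is k'.+1 then ((tpair k').2, 'X * (tpair k').2 - (tpair k').1)
  else (2%:R%:P, 'X).

Definition tcheb k := (tpair k).1.

Lemma tcheb_eval x k : x != 0 -> (tcheb k).[x + x^-1] = x ^+ k + x ^- k.
Proof.
move=> x0; suff: (tpair k).1.[x + x^-1] = x ^+ k + x ^- k /\
   (tpair k).2.[x + x^-1] = x ^+ k.+1 + x ^- k.+1 by case.
elim: k => [|k [IH1 IH2]] /=.
  by rewrite hornerC hornerX expr0 expr1 invr1.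
split=> //; rewrite hornerD hornerN hornerM hornerX IH1 IH2 -!exprVn !exprS.
by move: (x ^+ k) (x^-1 ^+ k) => u v; field.
Qed.

Lemma tcheb_size k : (size (tcheb k) <= k.+1)%N.
Proof.
suff: (size (tpair k).1 <= k.+1)%N /\ (size (tpair k).2 <= k.+2)%N by case.
elim: k => [|k [IH1 IH2]] /=; first by rewrite size_polyX size_polyC_leq1.
split=> //; apply: leq_trans (size_polyD _ _) _; rewrite geq_max size_polyN.
rewrite (leq_trans IH1 (ltnW (leqnSn _))) andbT.
by apply: leq_trans (size_polyMleq _ _) _; rewrite size_polyX.
Qed.

Lemma tcheb_lead k : (tcheb k)`_k = if k == 0%N then 2%:R else 1.
Proof.
case: k => [|k]; first by rewrite coefC.
rewrite /tcheb /=; elim: k => [|k IHk] /=; first by rewrite coefX.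
rewrite coefB coefXM /= IHk nth_default ?subr0 //.
exact: leq_trans (tcheb_size k) (leqnSn _).
Qed.

End ChebyshevT.

Section Laurent.
Variables (R : fieldType) (n : nat).
Hypothesis char0 : forall k, k.+1%:R != 0 :> R.
Implicit Types (v w : {ffun 'I_n -> int}) (s : {perm 'I_n}) (e : {ffun 'I_n -> bool}).
Implicit Types (la mu nu : intpart).

Definition vec la : {ffun 'I_n -> int} := [ffun i : 'I_n => (part la i.+1)%:Z].

Lemma laurent_eval_lin (x : 'I_n -> R) k (p p' : laurent n R) :
  laurent_eval (k *: p + p') x = k * laurent_eval p x + laurent_eval p' x.
Proof.
exact: (@flin_linear R _ (R^o) (fun v => \prod_(i < n) x i ^ v i) k p p').
Qed.

Lemma laurent_evalU (x : 'I_n -> R) v :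
  laurent_eval << v >> x = \prod_(i < n) x i ^ v i.
Proof. exact: (@flinU R _ (R^o) (fun v => \prod_(i < n) x i ^ v i) v). Qed.

Lemma laurent_eval_sum (x : 'I_n -> R) (I : Type) (r : seq I) (P : pred I)
    (G : I -> laurent n R) :
  laurent_eval (\sum_(i <- r | P i) G i) x = \sum_(i <- r | P i) laurent_eval (G i) x.
Proof.
exact: (@flin_sum R _ (R^o) (fun v => \prod_(i < n) x i ^ v i) I r P G).
Qed.

Lemma laurent_evalZ (x : 'I_n -> R) k (p : laurent n R) :
  laurent_eval (k *: p) x = k * laurent_eval p x.
Proof. exact: (@flinZ R _ (R^o) (fun v => \prod_(i < n) x i ^ v i) k p). Qed.

Lemma bc_act_comp s s0 e e0 v :
  bc_act s0 e0 (bc_act s e v) =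
  bc_act (s0 * s)%g [ffun i => e0 i (+) e (s0 i)] v.
Proof.
apply/ffunP => i; rewrite !ffunE permM.
by case: (e0 i) (e (s0 i)) => -[] //=; rewrite opprK.
Qed.

Lemma bc_act_inj s e : injective (bc_act s e).
Proof.
move=> v v' eq_v; apply/ffunP => i; have := congr1 (fun f : {ffun _} => f (s^-1%g i)) eq_v.
by rewrite !ffunE permKV; case: (e _) => // /oppr_inj.
Qed.

Lemma mem_bc_orbit v w :
  reflect (exists s e, w = bc_act s e v) (w \in bc_orbit v).
Proof.
rewrite mem_undup; apply: (iffP allpairsP) => [[[s e] /= [_ _ ->]]|[s [e ->]]].
  by exists s, e.
by exists (s, e); rewrite !mem_enum.
Qed.

Lemma bc_act1 v : bc_act 1%g [ffun=> false] v = v.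
Proof. by apply/ffunP => i; rewrite !ffunE perm1. Qed.

Definition stab_card v : nat := \sum_s \sum_e (bc_act s e v == v).

Lemma stab_card_gt0 v : (0 < stab_card v)%N.
Proof.
by rewrite /stab_card (bigD1 1%g) //= (bigD1 [ffun=> false]) //= bc_act1 eqxx.
Qed.

Definition symsum v : laurent n R := \sum_s \sum_e << bc_act s e v >>.

Lemma symsumE v : symsum v = (stab_card v)%:R *: \sum_(w <- bc_orbit v) << w >>.
Proof.
apply/eqP/freeg_eqP => w.
rewrite coeffZ [coeff w (symsum v)]raddf_sum [coeff w (\sum_(w <- _) _)]raddf_sum /=.
have -> : \sum_(i <- bc_orbit v) coeff w (<< i >> : laurent n R)
   = (w \in bc_orbit v)%:R.
  under eq_bigr do rewrite coeffU.
  by rewrite (sum_delta (fun=> 1)) ?undup_uniq //; case: ifP.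
have -> : \sum_s coeff w (\sum_e (<< bc_act s e v >> : laurent n R))
  = (\sum_s \sum_e (bc_act s e v == w))%N%:R.
  rewrite natr_sum; apply: eq_bigr => s _; rewrite raddf_sum natr_sum.
  by apply: eq_bigr => e _ /=; rewrite coeffU mul1r.
case: mem_bc_orbit => [[s0 [e0 ->]]|nw]; last first.
  rewrite mulr0 big1 // => s _; rewrite big1 // => e _; case: eqP => // eq_w.
  by case: nw; exists s, e.
rewrite mulr1; congr _%:R; rewrite /stab_card (reindex_inj (mulgI s0)) /=.
apply: eq_bigr => s _.
have inj_h : injective (fun e => [ffun i => e0 i (+) e (s0 i)]).
  move=> e e' /ffunP eq_e; apply/ffunP => i; have := eq_e (s0^-1%g i).
  by rewrite !ffunE permKV => /addbI.
rewrite (reindex_inj inj_h); apply: eq_bigr => e _.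
by rewrite -bc_act_comp (inj_eq (@bc_act_inj _ _)).
Qed.

(** The orbit sum of la in the variables z_i = x_i + 1/x_i. Summing over the
    signs turns each power of x_i into a Chebyshev polynomial, and the order
    of the stabilizer accounts for repetitions. *)
Definition mz la : {mpoly R[n]} :=
  (stab_card (vec la))%:R^-1 *:
  \sum_(s : {perm 'I_n}) \prod_i unip i (tcheb R (part la (s i).+1)).

Lemma stab_neq0 v : (stab_card v)%:R != 0 :> R.
Proof. by have := stab_card_gt0 v; case: (stab_card v). Qed.

Lemma mz_eval la (x : 'I_n -> R) : (forall i, x i != 0) ->
  (mz la).@[fun i => x i + (x i)^-1] = laurent_eval (mBC R n la) x.
Proof.
move=> x0; apply: (mulfI (stab_neq0 (vec la))).
rewrite /mz mevalZ mulVKf ?stab_neq0 // -laurent_evalZ.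
have := symsumE (vec la); rewrite /vec => <-; rewrite /symsum laurent_eval_sum raddf_sum /=.
apply: eq_bigr => s _; rewrite laurent_eval_sum rmorph_prod /=.
under [RHS]eq_bigr do rewrite laurent_evalU.
transitivity (\prod_i \sum_(b : bool) x i ^ (if b then - (part la (s i).+1)%:Z else (part la (s i).+1)%:Z)).
  apply: eq_bigr => i _; rewrite unip_eval tcheb_eval // big_bool /= addrC.
  by rewrite -invr_expz -!exprnP.
rewrite (bigA_distr_bigA (fun i (b : bool) =>
  x i ^ (if b then - (part la (s i).+1)%:Z else (part la (s i).+1)%:Z))).
by apply: eq_bigr => e _; apply: eq_bigr => i _; rewrite !ffunE.
Qed.

Lemma mz_sym la : mz la \is symmetric.
Proof.
apply/rpredZ/issymP => s; rewrite raddf_sum /= [RHS](reindex_inj (mulgI (s^-1)%g)) /=.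
apply: eq_bigr => s' _; rewrite msym_prod [RHS](reindex_inj (@perm_inj _ s)) /=.
by apply: eq_bigr => i _; rewrite permM permK msym_unip.
Qed.

Lemma mcoeff_mz la m : (mz la)@_m =
  (stab_card (vec la))%:R^-1 *
  \sum_(s : {perm 'I_n}) \prod_i (tcheb R (part la (s i).+1))`_(m i).
Proof.
rewrite /mz mcoeffZ; congr (_ * _); rewrite raddf_sum; apply: eq_bigr => s _.
exact: mcoeff_unip.
Qed.

Lemma mz_supp la m : (size la <= n)%N -> m \in msupp (mz la) ->
  part_incl (part_mnm m) la.
Proof.
move=> le_n; rewrite mcoeff_msupp mcoeff_mz mulf_eq0 negb_or => /andP[_].
have [/existsP[s /forallP le_m] _|] := boolP [exists s : {perm 'I_n},
    [forall i, (m i <= part la (s i).+1)%N]].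
  rewrite -(mnm_partK le_n) -(part_mnm_perm (mnm_part n la) s).
  by apply: part_mnm_incl => i; rewrite !mnmE.
rewrite negb_exists => /forallP nle; rewrite big1 ?eqxx // => s _.
have := nle s; rewrite negb_forall => /existsP[i]; rewrite -ltnNge => lt_i.
rewrite (bigD1 i) //= nth_default ?mul0r //.
exact: leq_trans (tcheb_size _ _) _.
Qed.

Lemma mz_lead la : (mz la)@_(mnm_part n la) != 0.
Proof.
rewrite mcoeff_mz mulf_neq0 ?invr_neq0 ?stab_neq0 //.
pose C : R := \prod_(i < n) (if part la i.+1 == 0%N then 2%:R else 1).
have termE (s : {perm 'I_n}) :
    \prod_i (tcheb R (part la (s i).+1))`_(mnm_part n la i)
    = if [forall i, part la (s i).+1 == part la i.+1] then C else 0.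
  have [/forallP eq_s|ne_s] := boolP [forall i, part la (s i).+1 == part la i.+1].
    by apply: eq_bigr => i _; rewrite mnmE (eqP (eq_s i)) tcheb_lead.
  have [i lt_i] : exists i : 'I_n, (part la (s i).+1 < part la i.+1)%N.
    apply/existsP; apply: contraR ne_s; rewrite negb_exists => /forallP ge_s.
    have le_i (i : 'I_n) : (part la i.+1 <= part la (s i).+1)%N by rewrite leqNgt.
    have eq_sum : (\sum_(i < n) part la (s i).+1 = \sum_(i < n) part la i.+1)%N.
      by rewrite [RHS](reindex_inj (@perm_inj _ s)).
    apply/forallP => i; rewrite eqn_leq le_i andbT leqNgt; apply/negP => lt_i.
    move/eqP: eq_sum; apply/negP; rewrite neq_ltn; apply/orP; right.
    rewrite (bigD1 i) //= [X in (_ < X)%N](bigD1 i) //= -addSn leq_add //.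
    by apply: leq_sum => j _.
  by rewrite (bigD1 i) //= nth_default ?mul0r // mnmE (leq_trans (tcheb_size _ _)).
under eq_bigr do rewrite termE.
rewrite -big_mkcond sumr_const -mulr_natr mulf_neq0 //.
  by apply/prodf_neq0 => i _; case: ifP => _; [exact: (char0 1)|exact: oner_neq0].
have : (0 < #|[pred s : {perm 'I_n} | [forall i, part la (s i).+1 == part la i.+1]]|)%N.
  by apply/card_gt0P; exists 1%g; rewrite inE; apply/forallP => i; rewrite perm1.
by case: #|_| => // k _; apply: char0.
Qed.

Lemma mz_free (c : {freeg intpart / R}) :
  (forall mu, mu \in dom c -> (size mu <= n)%N) -> flin mz c = 0 -> c = 0.
Proof.
move=> le_n; apply: (triangular_free (chi := fun mu (F : {mpoly R[n]}) => F@_(mnm_part n mu))).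
- by move=> mu k v w; rewrite mcoeffD mcoeffZ.
- by move=> mu _; apply: mz_lead.
move=> mu ka /le_n sz_mu /le_n sz_ka; rewrite -mcoeff_msupp => /(mz_supp sz_ka).
by rewrite mnm_partK.
Qed.

Lemma flin_mBC_eval (c : {freeg intpart / R}) (x : 'I_n -> R) :
  (forall i, x i != 0) ->
  laurent_eval (flin (mBC R n) c) x = (flin mz c).@[fun i => x i + (x i)^-1].
Proof.
move=> x0; rewrite /flin laurent_eval_sum raddf_sum; apply: eq_bigr => mu _.
by rewrite laurent_evalZ /= mevalZ mz_eval.
Qed.

Lemma flin_mz_sym (c : {freeg intpart / R}) : flin mz c \is symmetric.
Proof. by apply: rpred_sum => mu _; apply/rpredZ/mz_sym. Qed.

Lemma flin_mz_supp (c : {freeg intpart / R}) m :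
  (forall mu, mu \in dom c -> (size mu <= n)%N) -> m \in msupp (flin mz c) ->
  exists2 mu, mu \in dom c & part_incl (part_mnm m) mu.
Proof.
move=> le_n /msupp_sum_le/flattenP[l /mapP[mu]]; rewrite filter_predT => mu_c ->.
by move=> /msuppZ_le/(mz_supp (le_n _ mu_c)); exists mu.
Qed.

End Laurent.

(** * Interpolation Laurent polynomials and binomial coefficients *)

Section MonicInterp.
Variables (R : fieldType) (V : lmodType R) (e : intpart -> V).
Variable phi : intpart -> V -> R.
Hypothesis phi_lin : forall x k v w, phi x (k *: v + w) = k * phi x v + phi x w.
Variables (la : intpart) (P : intpart -> Prop) (l : seq intpart).
Hypothesis uniq_l : uniq l.
Hypothesis mem_l : forall mu, reflect (P mu) (mu \in l).
Hypothesis unit_l : interp_mx e phi l \in unitmx.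

Definition monic_comb (p : V) := exists c : {freeg intpart / R},
  (forall mu, mu \in dom c -> P mu) /\ p = e la + flin e c.

Lemma monic_interp_exists (r : intpart -> R) :
  exists2 p, monic_comb p & forall mu, P mu -> phi mu p = r mu.
Proof.
have [sub solP] := interp_solP phi_lin (fun mu => r mu - phi mu (e la)) unit_l.
set c := interp_sol _ _ _ _ in sub solP.
exists (e la + flin e c).
  by exists c; split=> // mu /sub/mem_l.
by move=> mu /mem_l mu_l; rewrite (linformD phi_lin) solP // addrC subrK.
Qed.

Lemma monic_interp_unique p p' : monic_comb p -> monic_comb p' ->
  (forall mu, P mu -> phi mu p = phi mu p') -> p = p'.
Proof.
move=> [c [Pc ->]] [c' [Pc' ->]] eq_p; congr (_ + _).
apply/eqP; rewrite -subr_eq0 -flinB; apply/eqP.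
rewrite (_ : c - c' = 0) ?flin0 //.
apply: (interp_unique phi_lin uniq_l unit_l).
  by move=> mu /domB; rewrite mem_cat => /orP[/Pc|/Pc'] /mem_l.
move=> mu /mem_l/eq_p; rewrite !(linformD phi_lin) => /addrI eq_c.
rewrite flinB -[- flin e c']scaleN1r addrC phi_lin eq_c mulN1r.
by rewrite addNr.
Qed.

(** This formula shows that the solution depends rationally on the data. *)
Lemma monic_interp_eq p : monic_comb p -> (forall mu, P mu -> phi mu p = 0) ->
  p = e la - flin e (row_free_elt
    ((\row_(j < size l) phi (elt j) (e la)) *m invmx (interp_mx e phi l))).
Proof.
move=> monic_p p0; apply: (monic_interp_unique monic_p).
  exists (- row_free_elt ((\row_(j < size l) phi (elt j) (e la)) *m invmx (interp_mx e phi l))).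
  split; last by rewrite flinN.
  by move=> mu; rewrite domN => /dom_row/mem_l.
move=> mu Pmu; rewrite p0 //; have /mem_l/eltP[j ->] := Pmu.
rewrite -scaleN1r addrC phi_lin linform_row_mx // mulmxKV // mxE.
by rewrite mulN1r addNr.
Qed.

End MonicInterp.

Section BCInterp.
Variables (R : fieldType) (q t : R).
Hypothesis char0 : forall k, k.+1%:R != 0 :> R.
Implicit Types (s : R) (la mu nu : intpart).

Lemma is_interp_monic n s la (p : laurent n R) :
  is_interp q t s la p <->
  monic_comb (mBC R n) la (fun mu => dom_lt mu la /\ (size mu <= n)%N) p /\
  forall mu, dom_lt mu la /\ (size mu <= n)%N -> laurent_eval p (interp_point q t s mu) = 0.
Proof.
split=> -[monic_p p0]; split=> //; first by move=> mu []; apply: p0.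
by move=> mu lt_mu sz_mu; apply: p0.
Qed.

Definition bc_below n la :=
  parts_with (weight la) (fun mu => dom_lt mu la /\ (size mu <= n)%N).

Lemma bc_belowP n la mu :
  reflect (dom_lt mu la /\ (size mu <= n)%N) (mu \in bc_below n la).
Proof.
apply: (iffP (mem_parts_with _ _ _)) => [[]//|h]; split=> //.
by case: h => -[/dom_le_weight].
Qed.

Definition bc_eval n s mu (p : laurent n R) := laurent_eval p (interp_point q t s mu).

Lemma bc_eval_lin n s mu k (p p' : laurent n R) :
  bc_eval s mu (k *: p + p') = k * bc_eval s mu p + bc_eval s mu p'.
Proof. exact: laurent_eval_lin. Qed.

(** In other words s^2 is multiplicatively independent of q and t. *)
Definition sgeneric s := admissible q t s s^-1.

Lemma interp_point_neq0 n s mu (i : 'I_n) : sgeneric s ->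
  interp_point q t s mu i != 0.
Proof. by case=> s0 _ [q0 t0 _ _]; rewrite !mulf_neq0 ?expf_neq0. Qed.

Lemma zpt_interp n s mu (i : 'I_n) :
  interp_point q t s mu i + (interp_point q t s mu i)^-1 = zpt q t s s^-1 mu i.
Proof.
rewrite /zpt /interp_point -/(ypt q t mu i).
by rewrite [ypt _ _ _ _ * s]mulrC invfM.
Qed.

Lemma flin_mBC_zpt n s mu (c : {freeg intpart / R}) : sgeneric s ->
  laurent_eval (flin (mBC R n) c) (interp_point q t s mu)
  = (flin (mz R n) c).@[zpt q t s s^-1 mu].
Proof.
move=> gen_s; rewrite flin_mBC_eval // => [|i]; last exact: interp_point_neq0.
by apply: meval_eq => i; apply: zpt_interp.
Qed.

Lemma mBC_zpt n s mu la : sgeneric s ->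
  laurent_eval (mBC R n la) (interp_point q t s mu) = (mz R n la).@[zpt q t s s^-1 mu].
Proof. by move=> gen_s; have := flin_mBC_zpt n mu << la >> gen_s; rewrite !flinU. Qed.

(** Orbit sums are symmetric polynomials in the x_i + 1/x_i, to which
    interp_nonsing applies. *)
Lemma bc_mx_unit n s (P : intpart -> Prop) l : sgeneric s -> uniq l ->
  (forall mu, reflect (P mu /\ (size mu <= n)%N) (mu \in l)) ->
  (forall mu la, part_incl mu la -> P la -> P mu) ->
  interp_mx (mBC R n) (bc_eval s) l \in unitmx.
Proof.
move=> gen_s uniq_l mem_l Pdown; apply: (interp_mx_unit (@bc_eval_lin n s)) => //.
move=> c sub c0; have le_n mu : mu \in dom c -> (size mu <= n)%N by move/sub/mem_l => [].
apply: (mz_free char0 le_n); apply: (interp_nonsing (P := P) gen_s) => //.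
- exact: flin_mz_sym.
- by move=> m /(flin_mz_supp le_n)[mu /sub/mem_l[Pmu _] incl]; apply: Pdown incl Pmu.
move=> mu Pmu sz_mu; have /mem_l/c0 : P mu /\ (size mu <= n)%N by [].
by rewrite /bc_eval flin_mBC_zpt.
Qed.

Lemma bc_below_unit n s la : sgeneric s ->
  interp_mx (mBC R n) (bc_eval s) (bc_below n la) \in unitmx.
Proof.
move=> gen_s; apply: (bc_mx_unit (P := fun mu => dom_lt mu la)) => //.
- exact: parts_with_uniq.
- exact: bc_belowP.
by move=> mu nu; apply: dom_lt_incl.
Qed.

Lemma bc_monic_unique n s la (p p' : laurent n R) : sgeneric s ->
  bc_monic la p -> bc_monic la p' ->
  (forall mu, dom_lt mu la -> (size mu <= n)%N ->
    laurent_eval p (interp_point q t s mu) = laurent_eval p' (interp_point q t s mu)) ->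
  p = p'.
Proof.
move=> gen_s mp mp' eq_p.
apply: (monic_interp_unique (@bc_eval_lin n s) (parts_with_uniq _ _) (bc_belowP n la)
  (bc_below_unit n la gen_s) mp mp').
by move=> mu [lt_mu sz_mu]; apply: eq_p.
Qed.

Lemma interpP n s la : sgeneric s -> is_interp q t s la (interp q t n s la).
Proof.
move=> gen_s; rewrite /interp; apply: epsilon_spec.
have [p mp p0] := monic_interp_exists (@bc_eval_lin n s) la (bc_belowP n la)
  (bc_below_unit n la gen_s) (fun=> 0).
by exists p; apply/is_interp_monic.
Qed.

(** The passage from Laurent polynomials to the variables x_i + 1/x_i. *)
Lemma interp_z n s la : sgeneric s -> (size la <= n)%N ->
  exists2 F : {mpoly R[n]}, is_interpz q t s s^-1 la F &
    F@_(mnm_part n la) = (mz R n la)@_(mnm_part n la) /\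
    forall mu, laurent_eval (interp q t n s la) (interp_point q t s mu)
      = F.@[zpt q t s s^-1 mu].
Proof.
move=> gen_s le_n; have [[c [lt_c def_p]] p0] := interpP n la gen_s.
have evalE mu : laurent_eval (interp q t n s la) (interp_point q t s mu)
      = (mz R n la + flin (mz R n) c).@[zpt q t s s^-1 mu].
  rewrite def_p -/(flin (mBC R n) c) mevalD -flin_mBC_zpt // -mBC_zpt //.
  by rewrite -[mBC R n la]scale1r laurent_eval_lin mul1r scale1r.
have le_c mu : mu \in dom c -> (size mu <= n)%N by move/lt_c => [].
have leadE : (mz R n la + flin (mz R n) c)@_(mnm_part n la) = (mz R n la)@_(mnm_part n la).
  rewrite mcoeffD [X in _ + X](_ : _ = 0) ?addr0 //; apply/eqP.
  rewrite mcoeff_eq0; apply/negP => /(flin_mz_supp le_c)[mu mu_c].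
  rewrite mnm_partK // => incl; have [[le_mu ne] _] := lt_c mu mu_c.
  by apply: ne; apply: dom_le_anti => //; apply: incl_dom_le.
exists (mz R n la + flin (mz R n) c) => //; split.
- by rewrite rpredD ?flin_mz_sym ?mz_sym.
- move=> m /msuppD_le; rewrite mem_cat => /orP[/(mz_supp le_n)/incl_dom_le//|].
  move=> /(flin_mz_supp le_c)[mu mu_c incl]; have [[le_mu _] _] := lt_c mu mu_c.
  exact: dom_le_incl incl le_mu.
- by rewrite leadE mz_lead.
by move=> mu lt_mu sz_mu; rewrite -evalE p0.
Qed.

Definition interp_val n s mu la : R :=
  laurent_eval (interp q t n s mu) (interp_point q t s la).

Lemma interpz_ratio n a b mu la (F G : {mpoly R[n]}) : admissible q t a b ->
  (size mu <= n)%N -> is_interpz q t a b mu F -> is_interpz q t a b mu G ->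
  F.@[zpt q t a b la] / F.@[zpt q t a b mu] = G.@[zpt q t a b la] / G.@[zpt q t a b mu].
Proof.
move=> adm le_n isF isG.
have := interpz_unique adm isF (iz_sym isG) (iz_supp isG) (iz_zero isG).
move: (F@_ _) (iz_lead isF) (G@_ _) (iz_lead isG) => f f0 g g0 eqFG.
have nzF := interpz_val_neq0 adm le_n isF; have nzG := interpz_val_neq0 adm le_n isG.
have eqv nu : f * G.@[zpt q t a b nu] = g * F.@[zpt q t a b nu].
  by rewrite -!mevalZ eqFG.
apply/eqP; rewrite eqr_div //; apply/eqP; apply: (mulfI (mulf_neq0 f0 g0)).
have := eqv la; have := eqv mu; move: (F.@[_]) (F.@[_]) (G.@[_]) (G.@[_]) => F1 F2 G1 G2 e1 e2.
transitivity ((g * F1) * (f * G2)); first by ring.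
by rewrite e1 -e2; ring.
Qed.

Lemma interp_val_neq0 n s mu : sgeneric s -> (size mu <= n)%N -> interp_val n s mu mu != 0.
Proof.
move=> gen_s le_n; have [F isF [_ eF]] := interp_z gen_s le_n.
by rewrite /interp_val eF; apply: interpz_val_neq0 isF.
Qed.

Lemma interp_val_zero n s mu la : sgeneric s -> (size mu <= n)%N -> (size la <= n)%N ->
  ~ part_incl mu la -> interp_val n s mu la = 0.
Proof.
move=> gen_s le_mu le_la nincl; have [F isF [_ eF]] := interp_z gen_s le_mu.
by rewrite /interp_val eF; apply: extra_vanishing isF nincl => //; apply: (char0 1).
Qed.

Lemma sgeneric_mulq s (i j : int) : sgeneric s -> sgeneric (q ^ i * t ^ j * s).
Proof.
move=> gen_s; have := admissible_mul i j (- i) (- j) gen_s.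
by rewrite /sgeneric !invfM !invr_expz.
Qed.

Lemma sgeneric_mult s : sgeneric s -> sgeneric (t * s).
Proof. by move/(sgeneric_mulq 0 1); rewrite mul1r. Qed.

(** Fixing the last variable at s lowers the number of variables and replaces
    s by t s. *)
Lemma interp_val_ratioS n s mu la : sgeneric s -> (size mu <= n)%N -> (size la <= n)%N ->
  interp_val n.+1 s mu la / interp_val n.+1 s mu mu = interp_val n (t * s) mu la / interp_val n (t * s) mu mu.
Proof.
move=> gen_s le_mu le_la.
have [F isF [_ eF]] := interp_z gen_s (leqW le_mu).
have [G isG [_ eG]] := interp_z (sgeneric_mult gen_s) le_mu.
have [isF' _ valE] := interpz_restr gen_s le_mu isF.
rewrite /interp_val !eF !eG -!valE // invfM [t^-1 * _]mulrC.
apply: interpz_ratio => //; last by rewrite [s^-1 / t]mulrC -invfM.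
by have := sgeneric_mult gen_s; rewrite /sgeneric invfM [t^-1 * _]mulrC.
Qed.

Lemma interp_val_ratio n d s mu la : sgeneric s -> (size mu <= n)%N -> (size la <= n)%N ->
  interp_val (n + d) s mu la / interp_val (n + d) s mu mu
  = interp_val n (t ^+ d * s) mu la / interp_val n (t ^+ d * s) mu mu.
Proof.
elim: d s => [|d IHd] s gen_s le_mu le_la; first by rewrite addn0 mul1r.
rewrite addnS interp_val_ratioS ?(leq_trans le_mu) ?(leq_trans le_la) ?leq_addr //.
by rewrite IHd // ?exprSr ?mulrA //; apply: sgeneric_mult.
Qed.

(** The number of variables in the definition of the binomial coefficient can
    be raised at will. *)
Lemma binomE n s la mu : sgeneric s -> (size la <= n)%N -> (size mu <= n)%N ->
  binom q t (t ^ (n%:Z - 1) * s) la mu = interp_val n s mu la / interp_val n s mu mu.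
Proof.
move=> gen_s le_la le_mu; rewrite /binom; set k := maxn _ _.
have le_k : (k <= n)%N by rewrite geq_max le_la.
have [_ _ [_ t0 _ _]] := gen_s.
have -> : t ^ (1 - k%:Z) * (t ^ (n%:Z - 1) * s) = t ^+ (n - k) * s.
  rewrite mulrA -expfzDr // exprnP; congr (t ^ _ * _); lia.
rewrite -(subnKC le_k) -/(interp_val k _ mu la) -/(interp_val k _ mu mu).
by rewrite addKn interp_val_ratio // leq_max leqnn ?orbT.
Qed.

(** The constant left open by interpz_diag cancels when two parameters are
    compared. *)
Lemma interp_val_diag n mu s s' : sgeneric s -> sgeneric s' -> (size mu <= n)%N ->
  interp_val n s mu mu * (s ^+ weight mu * Cplus q t mu (t ^ (2 * n%:Z - 2) * s' ^+ 2))
  = interp_val n s' mu mu * (s' ^+ weight mu * Cplus q t mu (t ^ (2 * n%:Z - 2) * s ^+ 2)).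
Proof.
move=> gen_s gen_s' le_n.
have [k k0 diag] := interpz_diag gen_s le_n.
have [F isF [leadF eF]] := interp_z gen_s le_n.
have [F' isF' [leadF' eF']] := interp_z gen_s' le_n.
have [s0 _ _] := gen_s; have [s'0 _ _] := gen_s'.
rewrite /interp_val eF eF' (diag _ _ _ gen_s isF) (diag _ _ _ gen_s' isF') leadF leadF'.
rewrite !invrK -!expr2 !exprVn.
have e0 := expf_neq0 (weight mu) s0; have e'0 := expf_neq0 (weight mu) s'0.
by field; rewrite e0 e'0.
Qed.

Lemma sgenericN s : sgeneric s -> sgeneric (- s).
Proof. by case=> s0 s1 ind; split; rewrite ?oppr_eq0 ?invrN ?oppr_eq0 // mulrNN. Qed.

(** Changing the signs of all the x_i preserves the interpolation conditions.
    Hence binomial coefficients do not depend on the choice of a square root. *)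
Lemma interp_valN_ratio n s mu la : sgeneric s -> (size mu <= n)%N ->
  interp_val n (- s) mu la / interp_val n (- s) mu mu = interp_val n s mu la / interp_val n s mu mu.
Proof.
move=> gen_s le_n; have genN := sgenericN gen_s.
have [F isF [_ eF]] := interp_z gen_s le_n.
have [G isG [_ eG]] := interp_z genN le_n.
pose T : n.-tuple {mpoly R[n]} := [tuple - 'X_i | i < n].
have evalN v : (F \mPo T).@[v] = F.@[fun i => - v i].
  rewrite comp_mpoly_meval; apply: meval_eq => i.
  by rewrite tnth_mktuple mevalN mevalXU.
have zptN nu i : zpt q t (- s) (- s)^-1 nu i = - zpt q t s s^-1 nu (i : 'I_n).
  by rewrite /zpt invrN; ring.
have mcoeffN m : (F \mPo T)@_m = (-1) ^+ mdeg m * F@_m.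
  have monE m' : ('X_[m'] : {mpoly R[n]}) \mPo T = (-1) ^+ mdeg m' *: 'X_[m'].
    rewrite comp_mpolyX mdegE expr_sum [in RHS]mpolyXE_id -scaler_prod; apply: eq_bigr => i _.
    by rewrite tnth_mktuple -scaleN1r exprZn.
  rewrite comp_mpolyE raddf_sum [in RHS](mpolyE F) raddf_sum mulr_sumr /=.
  apply: eq_bigr => m' _; rewrite -comp_mpolyX monE !mcoeffZ mcoeffX.
  by case: eqP => [->|_]; rewrite ?mulr0 // !mulr1 mulrC.
have isF' : is_interpz q t (- s) (- s)^-1 mu (F \mPo T).
  split.
  - apply/issymP => s1; rewrite msym_comp -{2}(issymP _ (iz_sym isF) s1) msym_mPo.
    by apply: eq_comp_mpoly => i; rewrite !tnth_mktuple msymN msymU.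
  - move=> m; rewrite mcoeff_msupp mcoeffN mulf_eq0 negb_or => /andP[_].
    by rewrite -mcoeff_msupp; apply: (iz_supp isF).
  - by rewrite mcoeffN mulf_neq0 ?(iz_lead isF) // expf_neq0 // oppr_eq0 oner_eq0.
  move=> nu lt_nu sz_nu; rewrite evalN -(iz_zero isF lt_nu sz_nu).
  by apply: meval_eq => i; rewrite zptN opprK.
rewrite /interp_val !eG (interpz_ratio la genN le_n isG isF') !evalN !eF.
by congr (_ / _); apply: meval_eq => i; rewrite zptN opprK.
Qed.

End BCInterp.

(** * Generic parameters *)

Section AlgIndep.
Variables (R : fieldType) (n : nat) (x : 'I_n -> R).

Definition alg_indep := forall p : {mpoly int[n]}, p != 0 -> mmap intr x p != 0.
Hypothesis ind_x : alg_indep.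

Lemma indep_neq0 i : x i != 0.
Proof. have := @ind_x 'X_i; rewrite mmapX mmap1U; apply.
by apply/eqP => /(congr1 (mcoeff U_(i))); rewrite mcoeffX eqxx mcoeff0. Qed.

Lemma indep_char0 k : k.+1%:R != 0 :> R.
Proof.
have := @ind_x (k.+1%:Z)%:MP; rewrite mpolyC_eq0 mmapC; exact.
Qed.

(** Multiplication by a high power of all the variables leads to polynomials. *)
Lemma laurent_indep (K : eqType) (l : seq K) (e : K -> 'I_n -> int) (c : K -> int) :
  uniq l -> {in l &, forall k k', e k =1 e k' -> k = k'} ->
  \sum_(k <- l) (c k)%:~R * \prod_i x i ^ e k i = 0 ->
  forall k, k \in l -> c k = 0.
Proof.
move=> uniq_l inj_e sum0.
pose D := (\sum_(k <- l) \sum_i `|e k i|)%N.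
have leD k i : k \in l -> 0 <= e k i + D%:Z.
  move=> kl; have : (`|e k i| <= D)%N.
    rewrite /D (bigD1_seq k) //= (bigD1 i) //= -addnA; exact: leq_addr.
  lia.
pose m k : 'X_{1..n} := [multinom `|(e k i + D%:Z)%R|%N | i < n].
have mE k i : k \in l -> (m k i)%:Z = e k i + D%:Z.
  by move=> kl; rewrite mnmE gez0_abs ?leD.
have inj_m : {in l &, injective m}.
  move=> k k' kl k'l eq_m; apply: inj_e => // i; apply: (addIr D%:Z).
  by rewrite -!mE // eq_m.
pose p : {mpoly int[n]} := \sum_(k <- l) c k *: 'X_[m k].
have p0 : p = 0.
  apply/eqP/negPn/negP => /ind_x/negP; apply; apply/eqP.
  rewrite /p raddf_sum /= big_seq.
  transitivity ((\prod_i x i ^ D%:Z) * \sum_(k <- l) (c k)%:~R * \prod_i x i ^ e k i).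
    rewrite mulr_sumr big_seq; apply: eq_bigr => k kl.
    rewrite mmapZ mmapX mulrCA; congr (_ * _); rewrite /mmap1 -big_split /=.
    apply: eq_bigr => i _; rewrite -expfzDr ?indep_neq0 //.
    by rewrite exprnP mE // addrC.
  by rewrite sum0 mulr0.
move=> k kl; have : p@_(m k) = 0 by rewrite p0 mcoeff0.
rewrite /p raddf_sum /= (bigD1_seq k) //= mcoeffZ mcoeffX eqxx mulr1.
rewrite big_seq_cond big1 ?addr0 // => k' /andP[k'l ne_k].
rewrite mcoeffZ mcoeffX; case: eqP => [/inj_m eq_k|_]; last by rewrite mulr0.
by rewrite eq_k ?eqxx in ne_k.
Qed.

Lemma indep_monom (e : 'I_n -> int) : \prod_i x i ^ e i = 1 -> e =1 (fun=> 0).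
Proof.
move=> prod1 i; apply/eqP/negPn/negP => e_i.
have /(_ isT) := @laurent_indep bool [:: true; false] (fun b i => if b then e i else 0)
  (fun b => if b then 1 else -1).
rewrite !big_cons big_nil /= prod1 big1 ?mulr1 ?addr0 ?subrr // => h.
suff /h/(_ erefl true isT) : {in [:: true; false] &, forall k k' : bool,
    (fun i => if k then e i else 0) =1 (fun i => if k' then e i else 0) -> k = k'} by [].
by move=> [] [] _ _ // /(_ i) e0; move: e_i; rewrite ?e0 -?e0 eqxx.
Qed.

End AlgIndep.

Lemma mcoeff_scaleX (A : comNzRingType) n (eps : 'I_n -> A) (F : {mpoly A[n]}) m :
  (F \mPo [tuple eps i *: 'X_i | i < n])@_m = (\prod_i eps i ^+ m i) * F@_m.
Proof.
rewrite comp_mpolyE raddf_sum [in RHS](mpolyE F) raddf_sum mulr_sumr /=.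
apply: eq_bigr => m' _; rewrite !mcoeffZ mcoeffX.
under eq_bigr => i _ do rewrite tnth_mktuple exprZn.
rewrite scaler_prod -mpolyXE_id mcoeffZ mcoeffX.
by case: eqP => [->|_]; rewrite ?mulr0 // !mulr1 mulrC.
Qed.

Lemma half_diff (a b c d : nat) : odd (a + b + c + d) = false ->
  exists j : int, a%:Z - b%:Z - c%:Z - d%:Z = j * 2.
Proof.
move=> odd4; exists ((a + b + c + d)./2%:Z - b%:Z - c%:Z - d%:Z).
have := odd_double_half (a + b + c + d); rewrite odd4 -muln2 add0n.
by move: (_./2) => k; lia.
Qed.

(** Even powers of h are Laurent monomials in the original parameters. *)
Lemma dual_monom (R : fieldType) (q t t0 t1 t2 t3 h : R) (a b c d1 d2 d3 k : int) :
  q != 0 -> t0 != 0 -> t1 != 0 -> t2 != 0 -> t3 != 0 -> h != 0 ->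
  h ^+ 2 = t0 * t1 * t2 * t3 / q -> c - d1 - d2 - d3 = k * 2 ->
  q ^ a * t ^ b * h ^ c * (t0 * t1 / h) ^ d1 * (t0 * t2 / h) ^ d2 * (t0 * t3 / h) ^ d3
  = q ^ (a - k) * t ^ b * t0 ^ (d1 + d2 + d3 + k) * t1 ^ (d1 + k) * t2 ^ (d2 + k) * t3 ^ (d3 + k).
Proof.
move=> q0 t00 t10 t20 t30 h0 hh ck.
have -> : c = 2 * k + d1 + d2 + d3 by lia.
have hk : h ^ (2 * k) = (t0 * t1 * t2 * t3 / q) ^ k by rewrite -hh exprnP exprz_exp.
rewrite !expfzDr // hk !exprzMl ?unitfE ?invr_eq0 ?mulf_neq0 //.
rewrite !exprz_inv -!invr_expz.
have := expfz_neq0 d1 h0; have := expfz_neq0 d2 h0; have := expfz_neq0 d3 h0.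
have := expfz_neq0 k q0.
move: (h ^ d1) (h ^ d2) (h ^ d3) (q ^ k) => u1 u2 u3 u4 z1 z2 z3 z4.
by field; rewrite z1 z2 z3 z4.
Qed.

Lemma dual_exp_inj (a b c d1 d2 d3 k a' b' c' d1' d2' d3' k' : int) :
  c - d1 - d2 - d3 = k * 2 -> c' - d1' - d2' - d3' = k' * 2 ->
  a - k = a' - k' -> b = b' -> d1 + d2 + d3 + k = d1' + d2' + d3' + k' ->
  d1 + k = d1' + k' -> d2 + k = d2' + k' -> d3 + k = d3' + k' ->
  [/\ a = a', b = b', c = c', d1 = d1' & d2 = d2' /\ d3 = d3'].
Proof.
move=> ec ec' e0 e1 e2 e3 e4 e5; have kk : k = k' by lia.
by do !split; lia.
Qed.

Lemma prod_ord6 (A : comNzRingType) (F : 'I_6 -> A) :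
  \prod_i F i = F (inord 0) * F (inord 1) * F (inord 2) * F (inord 3) * F (inord 4) * F (inord 5).
Proof.
rewrite (eq_bigr (fun i : 'I_6 => (fun k : nat => F (inord k)) i)) => [|i _]; last by rewrite inord_val.
by rewrite -(big_mkord xpredT (fun k => F (inord k))) !big_nat_recr // big_geq //= mul1r.
Qed.

Section Generic.
Variables (R : fieldType) (q t t0 t1 t2 t3 h : R).
Hypothesis gen : generic q t t0 t1 t2 t3.
Hypothesis hh : h ^+ 2 = t0 * t1 * t2 * t3 / q.

Lemma generic_indep : alg_indep (tnth [tuple q; t; t0; t1; t2; t3]).
Proof. exact: gen. Qed.

Lemma generic_char0 k : k.+1%:R != 0 :> R.
Proof. exact: (indep_char0 generic_indep). Qed.

Lemma generic_neq0 : [/\ q != 0, t != 0, t0 != 0, t1 != 0 & t2 != 0 /\ t3 != 0].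
Proof.
have nz k (lt6 : (k < 6)%N) := indep_neq0 generic_indep (Ordinal lt6).
by split; [exact: (nz 0%N) | exact: (nz 1%N) | exact: (nz 2%N) | exact: (nz 3%N) |];
  split; [exact: (nz 4%N) | exact: (nz 5%N)].
Qed.

Lemma generic_monom a b c0 c1 c2 c3 :
  q ^ a * t ^ b * t0 ^ c0 * t1 ^ c1 * t2 ^ c2 * t3 ^ c3 = 1 ->
  [/\ a = 0, b = 0, c0 = 0, c1 = 0 & c2 = 0 /\ c3 = 0].
Proof.
move=> prod1; pose e : 6.-tuple int := [tuple a; b; c0; c1; c2; c3].
have e0 : tnth e =1 (fun=> 0).
  apply: (indep_monom generic_indep).
  by rewrite !big_ord_recl big_ord0 mulr1 !mulrA.
split; last split.
- exact: (e0 (Ordinal (isT : 0 < 6)%N)).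
- exact: (e0 (Ordinal (isT : 1 < 6)%N)).
- exact: (e0 (Ordinal (isT : 2 < 6)%N)).
- exact: (e0 (Ordinal (isT : 3 < 6)%N)).
- exact: (e0 (Ordinal (isT : 4 < 6)%N)).
- exact: (e0 (Ordinal (isT : 5 < 6)%N)).
Qed.

Lemma generic_root_neq0 : h != 0.
Proof.
have [q0 _ t00 t10 [t20 t30]] := generic_neq0.
have : h ^+ 2 != 0 by rewrite hh !mulf_neq0 ?invr_neq0.
by rewrite expf_eq0.
Qed.

(** Replacing h by -h changes the signs of the last four parameters. The
    product of a polynomial relation and its image under these signs only
    involves even powers of h, so it is a relation between Laurent monomials
    in the original parameters; distinct monomials have distinct exponents. *)
Lemma generic_dual : generic q t h (t0 * t1 / h) (t0 * t2 / h) (t0 * t3 / h).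
Proof.
have [q0 tz t00 t10 [t20 t30]] := generic_neq0; have h0 := generic_root_neq0.
rewrite /generic; set y := tnth _.
move=> p p0; apply/eqP => val0.
pose eps (i : 'I_6) : int := if (i < 2)%N then 1 else -1.
pose T := [tuple eps i *: ('X_i : {mpoly int[6]}) | i < 6].
pose chi (m : 'X_{1..6}) : int := \prod_i eps i ^+ m i.
have TK (F : {mpoly int[6]}) : (F \mPo T) \mPo T = F.
  apply/mpolyP => m; rewrite !mcoeff_scaleX mulrA -big_split /= big1 ?mul1r // => i _.
  by rewrite -exprMn_comm ?/eps; [case: ifP; rewrite ?mulrNN mulr1 expr1n|apply: mulrC].
have pT0 : p \mPo T != 0.
  by apply: contra p0 => /eqP pT; rewrite -[p]TK pT comp_mpoly0.
pose N := p * (p \mPo T).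
have N0 : N != 0 by rewrite mulf_neq0.
have NT : N \mPo T = N by rewrite comp_mpolyM TK mulrC.
(* Monomials of odd degree in the last four variables do not occur in N. *)
have chiN m : m \in msupp N -> chi m = 1.
  rewrite mcoeff_msupp -{1}NT mcoeff_scaleX -/(chi m) => nz.
  have : chi m * N@_m = N@_m by rewrite -{2}NT mcoeff_scaleX.
  move: nz; rewrite mulf_eq0 negb_or => /andP[_ nz].
  by rewrite -{2}[N@_m]mul1r => /(mulIf nz).
pose m_ k (m : 'X_{1..6}) : int := (m (inord k))%:Z.
(* The exponent of h^2 after substitution. *)
pose k_ m : int := divz (m_ 2 m - m_ 3 m - m_ 4 m - m_ 5 m) 2.
have kE m : m \in msupp N -> m_ 2 m - m_ 3 m - m_ 4 m - m_ 5 m = k_ m * 2.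
  move=> /chiN; rewrite /chi prod_ord6 /eps !inordK //= !expr1n !mul1r -!exprD -signr_odd.
  case odd4: (odd _) => // _; rewrite /k_ /m_.
  by have [j ->] := half_diff odd4; rewrite mulzK.
pose e m : 6.-tuple int := [tuple m_ 0 m - k_ m; m_ 1 m;
  m_ 3 m + m_ 4 m + m_ 5 m + k_ m; m_ 3 m + k_ m; m_ 4 m + k_ m; m_ 5 m + k_ m].
have monE m : m \in msupp N -> mmap1 y m = \prod_i tnth [tuple q; t; t0; t1; t2; t3] i ^ tnth (e m) i.
  move=> /kE km; rewrite /mmap1 !prod_ord6 /y !(tnth_nth 0) /= !inordK //=.
  by rewrite !exprnP; apply: dual_monom.
have inj_e : {in msupp N &, forall m m', tnth (e m) =1 tnth (e m') -> m = m'}.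
  move=> m m' /kE km /kE km' eq_e.
  have := eq_e (Ordinal (isT : 0 < 6)%N); have := eq_e (Ordinal (isT : 1 < 6)%N).
  have := eq_e (Ordinal (isT : 2 < 6)%N); have := eq_e (Ordinal (isT : 3 < 6)%N).
  have := eq_e (Ordinal (isT : 4 < 6)%N); have := eq_e (Ordinal (isT : 5 < 6)%N).
  rewrite !(tnth_nth 0) /= => e5 e4 e3 e2 e1 e0.
  have eqm k : (k < 6)%N -> m_ k m = m_ k m'.
    have [] := dual_exp_inj km km' e0 e1 e2 e3 e4 e5.
    by move=> ? ? ? ? [? ?]; case: k => [|[|[|[|[|[|]]]]]].
  apply/mnmP => i; have := eqm i (ltn_ord i); rewrite /m_ !inord_val.
  by case.
have val0' : mmap intr y N = 0 by rewrite rmorphM /= val0 mul0r.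
have [m mN] : exists m, m \in msupp N.
  by move: N0; rewrite -msupp_eq0; case: (msupp N) => // m ? _; exists m; rewrite mem_head.
suff /(_ m mN)/eqP : forall m, m \in msupp N -> N@_m = 0 by rewrite mcoeff_eq0 mN.
apply: (laurent_indep generic_indep (msupp_uniq N) inj_e).
rewrite -[RHS]val0'; apply: eq_big_seq => m' m'N.
by rewrite monE.
Qed.

End Generic.

Section GenericMonomials.
Variables (R : fieldType) (q t t0 t1 t2 t3 : R).
Hypothesis gen : generic q t t0 t1 t2 t3.

Lemma generic_sgeneric : sgeneric q t t0.
Proof.
have [q0 tz t00 _ _] := generic_neq0 gen.
split; rewrite ?invr_eq0 //; split; rewrite ?mulf_neq0 ?invr_eq0 // => i j k.
rewrite invrK -expr2 exprnP exprz_exp => eq1.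
have [] := @generic_monom _ q t t0 t1 t2 t3 gen i j (2 * k) 0 0 0.
  by rewrite !expr0z !mulr1.
by move=> -> -> k0 _ _; split=> //; lia.
Qed.

Lemma generic_qt_neq0 (a b : int) : ~~ ((a == 0) && (b == 0)) -> 1 - q ^ a * t ^ b != 0.
Proof.
apply: contraNneq => /eqP; rewrite subr_eq0 => /eqP eq1.
by have [|-> ->] := @generic_monom _ q t t0 t1 t2 t3 gen a b 0 0 0 0; rewrite ?expr0z ?mulr1.
Qed.

Lemma generic_t01_neq0 (a b : int) : 1 - q ^ a * t ^ b * (t0 * t1) != 0.
Proof.
apply/eqP => /eqP; rewrite subr_eq0 => /eqP eq1.
have [|_ _] // := @generic_monom _ q t t0 t1 t2 t3 gen a b 1 1 0 0.
by rewrite ?expr0z ?mulr1 ?expr1z -mulrA.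
Qed.

Lemma generic_t02_neq0 (a b : int) : 1 - q ^ a * t ^ b * (t0 * t2) != 0.
Proof.
apply/eqP => /eqP; rewrite subr_eq0 => /eqP eq1.
have [|_ _] // := @generic_monom _ q t t0 t1 t2 t3 gen a b 1 0 1 0.
by rewrite ?expr0z ?mulr1 ?expr1z -mulrA.
Qed.

Lemma generic_t03_neq0 (a b : int) : 1 - q ^ a * t ^ b * (t0 * t3) != 0.
Proof.
apply/eqP => /eqP; rewrite subr_eq0 => /eqP eq1.
have [|_ _] // := @generic_monom _ q t t0 t1 t2 t3 gen a b 1 0 0 1.
by rewrite ?expr0z ?mulr1 ?expr1z -mulrA.
Qed.

Lemma generic_t0123_neq0 (a b : int) : 1 - q ^ a * t ^ b * (t0 * t1 * t2 * t3) != 0.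
Proof.
apply/eqP => /eqP; rewrite subr_eq0 => /eqP eq1.
have [|_ _] // := @generic_monom _ q t t0 t1 t2 t3 gen a b 1 1 1 1.
by rewrite !expr1z eq1 !mulrA.
Qed.

End GenericMonomials.

Section KZero.
Variables (R : fieldType) (q t t0 t1 t2 t3 : R).
Hypothesis gen : generic q t t0 t1 t2 t3.
Implicit Types la : intpart.

Lemma cell_prod_neq0 la (w : nat -> nat -> R) :
  (forall i j, (0 < i <= size la)%N -> (0 < j <= part la i)%N -> w i j != 0) ->
  cell_prod la w != 0.
Proof.
move=> nz; rewrite /cell_prod !prodf_seq_neq0; apply/allP => i.
rewrite mem_index_iota ltnS => le_i; rewrite prodf_seq_neq0; apply/allP => j.
by rewrite mem_index_iota ltnS => le_j; apply: nz.
Qed.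

Lemma C0_tn_neq0 n la : (size la <= n)%N -> C0 q t la (t ^+ n) != 0.
Proof.
move=> le_n; apply: cell_prod_neq0 => i j le_i le_j.
have [_ tz _ _ _] := generic_neq0 gen.
rewrite -mulrA exprnP -expfzDr //; apply: (generic_qt_neq0 gen); lia.
Qed.

Lemma C0_neq0 n la (a b : R) : (forall i j : int, 1 - q ^ i * t ^ j * (a * b) != 0) ->
  C0 q t la (t ^+ n * a * b / t) != 0.
Proof.
move=> nz; apply: cell_prod_neq0 => i j le_i le_j.
have [_ tz _ _ _] := generic_neq0 gen.
have -> : q ^ (j%:Z - 1) * t ^ (1 - i%:Z) * (t ^+ n * a * b / t)
  = q ^ (j%:Z - 1) * t ^ (n%:Z - i%:Z) * (a * b); last exact: nz.
have -> : n%:Z - i%:Z = (1 - i%:Z) + n%:Z - 1 by ring.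
have -> : t ^ (1 - i%:Z + n%:Z - 1) = t ^ (1 - i%:Z) * t ^+ n / t by rewrite !(expfzDr (1 - i%:Z + n%:Z), expfzDr (1 - i%:Z) n%:Z) // exprN1.
ring.
Qed.

Lemma Cminus_neq0 la : Cminus q t la t != 0.
Proof.
apply: cell_prod_neq0 => i j le_i le_j.
have [_ tz _ _ _] := generic_neq0 gen.
have le_ij : (i <= conj_part la j)%N by move: le_i le_j => /andP[i0 _] /andP[j0]; rewrite leq_part_conj.
have eqt : t ^ ((conj_part la j)%:Z - i%:Z) * t = t ^ ((conj_part la j)%:Z - i%:Z + 1).
  by rewrite (expfzDr _ 1).
rewrite -mulrA eqt; apply: (generic_qt_neq0 gen); lia.
Qed.

Lemma Cplus_neq0 n la :
  Cplus q t la ((t ^+ n) ^+ 2 * t0 * t1 * t2 * t3 / (q * t ^+ 2)) != 0.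
Proof.
apply: cell_prod_neq0 => i j le_i le_j.
have [q0 tz _ _ _] := generic_neq0 gen.
set a := _ - 1; set b := 2 - _ - _.
have -> : q ^ a * t ^ b * ((t ^+ n) ^+ 2 * t0 * t1 * t2 * t3 / (q * t ^+ 2))
  = q ^ (a - 1) * t ^ (b + (n * 2)%N%:Z - 2) * (t0 * t1 * t2 * t3); last exact: (generic_t0123_neq0 gen).
have -> : q ^ (a - 1) = q ^ a / q by rewrite expfzDr // exprN1.
have -> : t ^ (b + (n * 2)%N%:Z - 2) = t ^ b * t ^+ (n * 2) / t ^+ 2.
  by rewrite (expfzDr (b + (n * 2)%N%:Z)) // expfzDr // -invr_expz.
by rewrite -exprM invfM; ring.
Qed.

Lemma k0_neq0 n la : (size la <= n)%N -> k0 q t (t ^+ n) t0 t1 t2 t3 la != 0.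
Proof.
move=> le_n; have [q0 tz t00 _ _] := generic_neq0 gen.
rewrite /k0 !mulf_neq0 ?invr_eq0 ?mulf_neq0 ?expf_neq0 ?mulf_neq0 ?invr_eq0 ?expf_neq0 //.
- exact: C0_tn_neq0.
- exact/C0_neq0/(generic_t01_neq0 gen).
- exact/C0_neq0/(generic_t02_neq0 gen).
- exact/C0_neq0/(generic_t03_neq0 gen).
- exact: Cminus_neq0.
- exact: Cplus_neq0.
Qed.

End KZero.

(** * The binomial formula for Koornwinder polynomials *)

Section SubpartsSum.

Lemma mem_subparts_id la : la \in subparts la.
Proof. by apply/mem_subparts => i. Qed.

Lemma subparts_size mu la : mu \in subparts la -> (size mu <= size la)%N.
Proof. by move/mem_subparts/part_incl_size. Qed.

Lemma eq_sum_subparts (R : zmodType) la mu (F G : intpart -> R) :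
  (forall nu, nu \in subparts la -> ~ part_incl nu mu -> F nu = 0) ->
  (forall nu, nu \in subparts mu -> ~ part_incl nu la -> G nu = 0) ->
  (forall nu, part_incl nu la -> part_incl nu mu -> F nu = G nu) ->
  \sum_(nu <- subparts la) F nu = \sum_(nu <- subparts mu) G nu.
Proof.
move=> F0 G0 FG.
have -> : \sum_(nu <- subparts la) F nu = \sum_(nu <- [seq x <- subparts la | x \in subparts mu]) F nu.
  rewrite big_filter (bigID (mem (subparts mu))) /= [X in _ + X]big_seq_cond [X in _ + X]big1 ?addr0 //.
  by move=> nu /andP[nu_la nin]; apply: F0 => // /mem_subparts nu_mu; rewrite nu_mu in nin.
have -> : \sum_(nu <- subparts mu) G nu = \sum_(nu <- [seq x <- subparts mu | x \in subparts la]) G nu.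
  rewrite big_filter (bigID (mem (subparts la))) /= [X in _ + X]big_seq_cond [X in _ + X]big1 ?addr0 //.
  by move=> nu /andP[nu_la nin]; apply: G0 => // /mem_subparts nu_mu; rewrite nu_mu in nin.
have eq_perm : perm_eq [seq x <- subparts la | x \in subparts mu] [seq x <- subparts mu | x \in subparts la].
  by apply: uniq_perm; rewrite ?filter_uniq ?subparts_uniq // => nu; rewrite !mem_filter andbC.
rewrite (perm_big _ eq_perm) /=; apply: eq_big_seq => nu; rewrite mem_filter.
by move=> /andP[/mem_subparts ? /mem_subparts ?]; apply: FG.
Qed.

End SubpartsSum.

Section BCSpan.
Variables (R : fieldType) (n : nat).
Implicit Types (la mu : intpart) (p : laurent n R).

Definition bc_lower la p := exists2 c : {freeg intpart / R},
  forall mu, mu \in dom c -> dom_lt mu la /\ (size mu <= n)%N & p = flin (mBC R n) c.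

Lemma bc_lower0 la : bc_lower la 0.
Proof. by exists 0; rewrite ?flin0 // => mu; rewrite dom0. Qed.

Lemma bc_lower_lin la k p p' : bc_lower la p -> bc_lower la p' -> bc_lower la (k *: p + p').
Proof.
move=> [c lt_c ->] [c' lt_c' ->]; exists (k *: c + c'); last by rewrite flin_linear.
move=> mu /domD_subset; rewrite mem_cat => /orP[/domZ_subset/lt_c|/lt_c'] //.
Qed.

Lemma bc_lower_sum la (I : eqType) (r : seq I) (k : I -> R) (F : I -> laurent n R) :
  (forall i, i \in r -> bc_lower la (F i)) -> bc_lower la (\sum_(i <- r) k i *: F i).
Proof.
elim: r => [|i r IHr] lowF; first by rewrite big_nil; apply: bc_lower0.
rewrite big_cons; apply: bc_lower_lin; first by apply: lowF; rewrite mem_head.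
by apply: IHr => j j_r; apply: lowF; rewrite inE j_r orbT.
Qed.

Lemma bc_monicP la p : bc_monic la p <-> exists2 p', bc_lower la p' & p = mBC R n la + p'.
Proof.
split=> [[c [lt_c ->]]|[_ [c lt_c ->] ->]]; first by exists (flin (mBC R n) c) => //; exists c.
by exists c.
Qed.

Lemma bc_monic_lower la mu p : dom_lt mu la -> (size mu <= n)%N -> bc_monic mu p -> bc_lower la p.
Proof.
move=> lt_mu sz_mu /bc_monicP[_ [c lt_c ->] ->]; exists (<< mu >> + c); last first.
  by rewrite flinD flinU.
move=> nu /domD_subset; rewrite mem_cat => /orP[|/lt_c[lt_nu sz_nu]].
  by rewrite domU1 inE => /eqP ->.
by split=> //; apply: dom_lt_trans lt_mu.
Qed.

Lemma bc_monicD la p p' : bc_monic la p -> bc_lower la p' -> bc_monic la (p + p').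
Proof.
move=> /bc_monicP[p0 low0 ->] low'; apply/bc_monicP; exists (p0 + p'); last by rewrite addrA.
by rewrite -[p0]scale1r; apply: bc_lower_lin.
Qed.

End BCSpan.

Section Koornwinder.
Variables (R : fieldType) (n : nat) (q t : R).
Implicit Types la mu nu : intpart.

(** What the lifted Koornwinder polynomial becomes in n variables, for T =
    t^n. *)
Definition binomial_koornwinder (t0 t1 t2 t3 h : R) la : laurent n R :=
  \sum_(mu <- subparts la)
    (binom q t (t ^ (n%:Z - 1) * h) la mu
     * (k0 q t (t ^+ n) t0 t1 t2 t3 la / k0 q t (t ^+ n) t0 t1 t2 t3 mu))
    *: interp q t n t0 mu.

Section Fixed.
Variables (t0 t1 t2 t3 h : R).
Hypothesis gen : generic q t t0 t1 t2 t3.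
Hypothesis hh : h ^+ 2 = t0 * t1 * t2 * t3 / q.

Lemma generic_sgeneric_root : sgeneric q t h.
Proof. exact: generic_sgeneric (generic_dual gen hh). Qed.

Let char0 := generic_char0 gen.
Let gen_t0 := generic_sgeneric gen.
Let gen_h := generic_sgeneric_root.

Lemma binomial_koornwinder_monic la : (size la <= n)%N -> bc_monic la (binomial_koornwinder t0 t1 t2 t3 h la).
Proof.
move=> le_la; rewrite /binomial_koornwinder (bigD1_seq la) ?mem_subparts_id ?subparts_uniq //=.
rewrite binomE // !divff ?mul1r ?k0_neq0 ?interp_val_neq0 // scale1r.
apply: bc_monicD; first by have [] := interpP char0 n la gen_t0.
rewrite -big_filter; apply: bc_lower_sum => mu; rewrite mem_filter => /andP[ne_mu mu_la].
have le_mu := leq_trans (subparts_size mu_la) le_la.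
apply: bc_monic_lower le_mu _; last by have [] := interpP char0 n mu gen_t0.
by move/mem_subparts: mu_la => mu_la; apply: incl_dom_lt => // eq_mu; rewrite eq_mu eqxx in ne_mu.
Qed.

Lemma binomial_koornwinder_eval la mu : (size la <= n)%N -> (size mu <= n)%N ->
  laurent_eval (binomial_koornwinder t0 t1 t2 t3 h la) (interp_point q t t0 mu) / k0 q t (t ^+ n) t0 t1 t2 t3 la
  = \sum_(nu <- subparts la) interp_val q t n h nu la / interp_val q t n h nu nu
      * interp_val q t n t0 nu mu / k0 q t (t ^+ n) t0 t1 t2 t3 nu.
Proof.
move=> le_la le_mu; rewrite /binomial_koornwinder laurent_eval_sum mulr_suml; apply: eq_big_seq => nu nu_la.
have le_nu := leq_trans (subparts_size nu_la) le_la.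
rewrite laurent_evalZ binomE // -/(interp_val q t n t0 nu mu).
have := k0_neq0 gen le_la; have := k0_neq0 gen le_nu; have := interp_val_neq0 char0 gen_h le_nu.
move: (k0 _ _ _ _ _ _ _ la) (k0 _ _ _ _ _ _ _ nu) (interp_val _ _ _ h nu nu) => kl kn i1 z1 z2 z3.
by field; rewrite z1 z2 z3.
Qed.

Lemma binomial_koornwinderN la : (size la <= n)%N -> binomial_koornwinder t0 t1 t2 t3 (- h) la = binomial_koornwinder t0 t1 t2 t3 h la.
Proof.
move=> le_la; apply: eq_big_seq => nu nu_la; congr (_ * _ *: _).
have le_nu := leq_trans (subparts_size nu_la) le_la.
by rewrite !binomE ?interp_valN_ratio //; apply: sgenericN.
Qed.

(** The diagonal values of the interpolation polynomials make up for the
    change of normalization under duality; therefore the two sides of the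
    duality equation agree term by term. *)
Lemma interp_val_k0_dual nu : (size nu <= n)%N ->
  interp_val q t n h nu nu * k0 q t (t ^+ n) t0 t1 t2 t3 nu
  = interp_val q t n t0 nu nu * k0 q t (t ^+ n) h (t0 * t1 / h) (t0 * t2 / h) (t0 * t3 / h) nu.
Proof.
move=> le_nu; have diag := interp_val_diag char0 gen_h gen_t0 le_nu.
have gen' := generic_dual gen hh.
have [q0 tz t00 t10 [t20 t30]] := generic_neq0 gen; have h0 := generic_root_neq0 gen hh.
have := Cplus_neq0 gen n nu; have := Cplus_neq0 gen' n nu; have := Cminus_neq0 gen nu.
rewrite /k0.
have e1 x : t ^+ n * h * (t0 * x / h) / t = t ^+ n * t0 * x / t by field; rewrite tz h0.
have tn0 : t ^+ n != 0 by rewrite expf_neq0.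
have tE : t ^ (2 * n%:Z - 2) = (t ^+ n) ^+ 2 / t ^+ 2.
  by rewrite expfzDr // -invr_expz; congr (_ / _); rewrite mulrC -exprnP -exprM exprnP.
have e2 : (t ^+ n) ^+ 2 * t0 * t1 * t2 * t3 / (q * t ^+ 2) = t ^ (2 * n%:Z - 2) * h ^+ 2.
  by rewrite hh tE; field; rewrite q0 tz.
have e3 : (t ^+ n) ^+ 2 * h * (t0 * t1 / h) * (t0 * t2 / h) * (t0 * t3 / h) / (q * t ^+ 2)
   = t ^ (2 * n%:Z - 2) * t0 ^+ 2.
  transitivity ((t ^+ n) ^+ 2 * t0 ^+ 2 * (t0 * t1 * t2 * t3 / q) / (h ^+ 2 * t ^+ 2)).
    by field; rewrite q0 tz h0.
  by rewrite -hh tE; field; rewrite tz h0.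
rewrite !e1 e2 e3; move: diag.
move: (Cplus _ _ _ _) (Cplus _ _ _ _) => c1 c2.
set A := t ^+ nstat nu; set B := _ * C0 _ _ _ _; set C := Cminus _ _ _ _ => diag z3 z2 z1.
rewrite !expr_div_n !exprMn.
have := expf_neq0 (weight nu) t00; have := expf_neq0 (weight nu) h0; have := expf_neq0 (weight nu) tz.
have := expf_neq0 (weight nu) tn0.
move: diag; move: (t0 ^+ weight nu) (h ^+ _) (t ^+ weight nu) (t ^+ n ^+ weight nu) => u1 u2 u3 u4.
move: (interp_val _ _ _ h _ _) (interp_val _ _ _ t0 _ _) => i1 i2 diag z4 z5 z6 z7.
apply/eqP; rewrite -subr_eq0; apply/eqP.
transitivity ((i1 * (u2 * c2) - i2 * (u1 * c1)) * A * B * u3 / (u1 * u2 * u4 * c1 * c2 * C)).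
  by field; rewrite ?z1 ?z2 ?z3 ?z4 ?z5 ?z6 ?z7.
by rewrite diag subrr !mul0r.
Qed.

End Fixed.

(** An arbitrary root is chosen, since the binomial formula is even in h. *)
Definition binomial_family : koornwinder_family R n := fun t0 t1 t2 t3 =>
  binomial_koornwinder t0 t1 t2 t3 (epsilon (inhabits 0) (fun h => h ^+ 2 = t0 * t1 * t2 * t3 / q)).

Lemma binomial_familyE t0 t1 t2 t3 h la : generic q t t0 t1 t2 t3 ->
  h ^+ 2 = t0 * t1 * t2 * t3 / q -> (size la <= n)%N ->
  binomial_family t0 t1 t2 t3 la = binomial_koornwinder t0 t1 t2 t3 h la.
Proof.
move=> gen hh le_la; rewrite /binomial_family; set h' := epsilon _ _.
have /eqP : h' ^+ 2 = h ^+ 2.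
  by rewrite hh; apply: (epsilon_spec (inhabits 0) (fun h => h ^+ 2 = _)); exists h.
by rewrite eqf_sqr => /orP[/eqP->|/eqP->] //; rewrite binomial_koornwinderN.
Qed.

Lemma dual_root t0 t1 t2 t3 h : generic q t t0 t1 t2 t3 ->
  h ^+ 2 = t0 * t1 * t2 * t3 / q ->
  t0 ^+ 2 = h * (t0 * t1 / h) * (t0 * t2 / h) * (t0 * t3 / h) / q.
Proof.
move=> gen hh; have [q0 tz t00 t10 [t20 t30]] := generic_neq0 gen; have h0 := generic_root_neq0 gen hh.
transitivity (t0 ^+ 2 * (t0 * t1 * t2 * t3 / q) / h ^+ 2); last by field; rewrite q0 h0.
by rewrite -hh mulfK // expf_neq0.
Qed.

Lemma binomial_family_koornwinder : is_koornwinder q t binomial_family.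
Proof.
move=> t0 t1 t2 t3 h gen hh h1 h2 h3 la le_la.
have gen' := generic_dual gen hh; have hh' := dual_root gen hh.
split=> [|mu lt_mu le_mu]; first by rewrite (binomial_familyE gen hh) //; apply: binomial_koornwinder_monic.
rewrite (binomial_familyE gen hh) // (binomial_familyE gen' hh') // binomial_koornwinder_eval // binomial_koornwinder_eval //.
have char0 := generic_char0 gen.
have gen_t := generic_sgeneric gen; have gen_h := generic_sgeneric_root gen hh.
apply: eq_sum_subparts => nu.
- move=> nu_la nincl; rewrite (interp_val_zero char0 gen_t) ?mulr0 ?mul0r //.
  exact: leq_trans (subparts_size nu_la) le_la.
- move=> nu_la nincl; rewrite (interp_val_zero char0 gen_h) ?mulr0 ?mul0r //.
  exact: leq_trans (subparts_size nu_la) le_mu.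
move=> nu_la _; have le_nu := leq_trans (part_incl_size nu_la) le_la.
have := interp_val_k0_dual gen hh le_nu.
have := k0_neq0 gen le_nu; have := k0_neq0 gen' le_nu.
have := interp_val_neq0 char0 gen_h le_nu; have := interp_val_neq0 char0 gen_t le_nu.
rewrite -/h1 -/h2 -/h3.
move: (interp_val _ _ _ h nu nu) (interp_val _ _ _ t0 nu nu) (k0 _ _ _ _ _ _ _ _) (k0 _ _ _ _ _ _ _ _).
move=> i1 i2 k1 k2 z1 z2 z3 z4 e.
transitivity (interp_val q t n h nu la * interp_val q t n t0 nu mu / (i1 * k1)); first by field; rewrite z2 z4.
by rewrite e; field; rewrite z1 z3.
Qed.

(** The right-hand side of the duality equation concerns a smaller partition,
    and dual parameters are again generic. So induction along dominance
    determines the values at all the points below la, and with them the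
    polynomial. *)
Lemma koornwinder_unique (K K' : koornwinder_family R n) :
  is_koornwinder q t K -> is_koornwinder q t K' ->
  forall la t0 t1 t2 t3 h, generic q t t0 t1 t2 t3 -> h ^+ 2 = t0 * t1 * t2 * t3 / q ->
  (size la <= n)%N -> K t0 t1 t2 t3 la = K' t0 t1 t2 t3 la.
Proof.
move=> isK isK' la; have [N] := ubnP (weight la); move E : (rank N la) => k.
elim/ltn_ind: k la E => k IHk la rk_la lt_N t0 t1 t2 t3 h gen hh le_la.
have [mon val] := isK _ _ _ _ _ gen hh la le_la.
have [mon' val'] := isK' _ _ _ _ _ gen hh la le_la.
apply: (bc_monic_unique (generic_char0 gen) (generic_sgeneric gen) mon mon') => mu lt_mu le_mu.
have := val mu lt_mu le_mu; have := val' mu lt_mu le_mu.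
have wt_mu := dom_le_weight (proj1 lt_mu).
rewrite (IHk (rank N mu) _ mu erefl _ _ _ _ _ t0) //.
- by move=> <- /(mulIf (invr_neq0 (k0_neq0 gen le_la))).
- by rewrite -rk_la; apply: rank_lt => //; apply: ltnW.
- exact: leq_ltn_trans wt_mu lt_N.
- exact: generic_dual.
exact: dual_root.
Qed.

Lemma koornwinderE t0 t1 t2 t3 h la : generic q t t0 t1 t2 t3 ->
  h ^+ 2 = t0 * t1 * t2 * t3 / q -> (size la <= n)%N ->
  koornwinder n q t t0 t1 t2 t3 la = binomial_koornwinder t0 t1 t2 t3 h la.
Proof.
move=> gen hh le_la; rewrite -(binomial_familyE gen hh) //.
have isK : is_koornwinder q t (koornwinder n q t).
  by apply: epsilon_spec; exists binomial_family; apply: binomial_family_koornwinder.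
exact: (koornwinder_unique isK binomial_family_koornwinder gen hh le_la).
Qed.

End Koornwinder.

(** * Power sums and values of symmetric functions *)

Section PowerSums.
Variable R : fieldType.
Implicit Types (la mu nu ka : intpart).

Definition psums N d : d.-tuple {mpoly R[N]} := [tuple power_sum R N i.+1 | i < d].

Lemma mderiv_comp N d (T : d.-tuple {mpoly R[N]}) (j : 'I_N) (g : {mpoly R[d]}) :
  mderiv j (g \mPo T) = \sum_i (mderiv i g \mPo T) * mderiv j (tnth T i).
Proof.
elim/mpoly_ring_ind: g => [c|k|p p' IHp IHp'|p p' IHp IHp'].
- rewrite comp_mpolyC mderivC big1 // => i _.
  by rewrite mderivC comp_mpoly0 mul0r.
- rewrite comp_mpolyU (bigD1 k) //= mderivX mnm1E eqxx scale1r.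
  rewrite (_ : U_(k) - U_(k) = 0)%MM; last by apply/mnmP => i; rewrite mnmBE subnn mnmE.
  rewrite mpolyX0 comp_mpolyC mul1r big1 ?addr0 // => i ne.
  by rewrite mderivX mnm1E eq_sym (negPf ne) scale0r comp_mpoly0 mul0r.
- rewrite raddfD mderivD IHp IHp' -big_split; apply: eq_bigr => i _ /=.
  by rewrite mderivD raddfD mulrDl.
rewrite comp_mpolyM mderivM IHp IHp' mulr_suml mulr_sumr -big_split.
apply: eq_bigr => i _ /=; rewrite mderivM raddfD /= !comp_mpolyM; ring.
Qed.

Lemma mderiv_power_sum N k (j : 'I_N) :
  mderiv j (power_sum R N k.+1) = (k.+1)%:R *: 'X_j ^+ k.
Proof.
rewrite /power_sum raddf_sum (bigD1 j) //= big1 ?addr0 => [|i ne].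
  rewrite !mpolyXn mderivX mulmnE mnm1E eqxx mul1n; congr (_ *: 'X_[_]).
  by apply/mnmP => i; rewrite mnmBE !mulmnE; case: (U_(j)%MM i) => [|[|?]] //=; lia.
by rewrite mpolyXn mderivX mulmnE mnm1E (negPf ne) mul0n scale0r.
Qed.

Hypothesis char0 : forall k, k.+1%:R != 0 :> R.

(** Differentiate a relation of low degree with respect to each x_j. By the
    chain rule the x_j are d distinct roots of a polynomial of degree less
    than d whose coefficients are, up to integers, the partial derivatives of
    the relation at the power sums; these derivatives are then relations of
    lower degree. *)
Lemma psums_indep d (g : {mpoly R[d]}) : g \mPo psums d d = 0 -> g = 0.
Proof.
have [K] : exists K, forall m, g@_m != 0 -> (mdeg m < K)%N.
  by exists (msize g) => m; rewrite -mcoeff_msupp; apply: msize_mdeg_lt.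
elim: K g => [|K IHK] g lt_g g0.
  by apply/mpolyP => m; rewrite mcoeff0; apply/eqP/negPn/negP => /lt_g.
have dg0 i : mderiv i g = 0.
  apply: IHK => [m|].
    rewrite mcoeff_mderiv => nz; have := lt_g (m + U_(i))%MM.
    rewrite mdegD mdeg1 addn1 ltnS; apply.
    by apply: contraNneq nz => ->; rewrite mul0rn.
  pose c i := mderiv i g \mPo psums d d.
  (* The chain rule, as a polynomial in x_j. *)
  pose P := \poly_(k < d) (if insub k is Some i then (c i) *+ k.+1 else 0).
  have P_roots j : root P ('X_j : {mpoly R[d]}).
    have /eqP := congr1 (mderiv j) g0.
    rewrite mderiv_comp mderiv0 => /eqP sum0; rewrite /root horner_poly.
    rewrite -[X in X == 0]subr0 -[X in _ - X]sum0 subr_eq0; apply/eqP; apply: eq_bigr => k _.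
    rewrite (insubT (fun k => k < d)%N (ltn_ord k)) /= tnth_mktuple mderiv_power_sum.
    rewrite -/(c (Sub _ _)) (_ : Sub _ _ = k); last by apply: val_inj.
    by rewrite scaler_nat mulrnAl mulrnAr.
  have P0 : P = 0.
    apply/eqP/negPn/negP => P_n0.
    pose rs := [seq ('X_j : {mpoly R[d]}) | j <- enum 'I_d].
    have := @max_poly_roots _ P rs P_n0.
    rewrite size_map size_enum_ord ltnNge size_poly => h.
    have all_r : all (root P) rs by apply/allP => _ /mapP[j _ ->].
    have uniq_r : uniq rs.
      rewrite map_inj_uniq ?enum_uniq // => j j' /(congr1 (mcoeff U_(j)%MM)).
      rewrite !mcoeffX eqxx; case: eqP => [/(congr1 (fun m : 'X_{1..d} => m j)) | _ /eqP].
        by rewrite !mnm1E eqxx; case: eqP => // ->.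
      by rewrite oner_eq0.
    by have := h all_r uniq_r.
  have := congr1 (fun p : {poly _} => p`_i) P0; rewrite coef_poly ltn_ord coef0.
  rewrite (insubT (fun k => k < d)%N (ltn_ord i)) /= (_ : Sub _ _ = i); last by apply: val_inj.
  move/eqP; rewrite -scaler_nat scaler_eq0 => /orP[/eqP e|/eqP //].
  by have := char0 i; rewrite e eqxx.
have gC : g = (g@_0%MM)%:MP.
  apply/mpolyP => m; rewrite mcoeffC; have [->|ne] := eqVneq; first by rewrite mulr1.
  rewrite mulr0; have [i m_i] : exists i, (0 < m i)%N.
    apply/existsP; apply: contraNT ne => /existsPn m0; apply/eqP/mnmP => i.
    by rewrite mnmE; apply/eqP; rewrite -leqn0 leqNgt.
  have := congr1 (mcoeff (m - U_(i))%MM) (dg0 i); rewrite mcoeff_mderiv mcoeff0 submK ?lep1mP -?lt0n //.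
  move/eqP; rewrite -mulr_natr mulf_eq0 => /orP[/eqP //|/eqP e].
  by have := char0 ((m - U_(i))%MM i); rewrite e eqxx.
by move: g0; rewrite gC comp_mpolyC => ->.
Qed.

Definition widen_mp d D (le_d : (d <= D)%N) (g : {mpoly R[d]}) : {mpoly R[D]} :=
  g \mPo [tuple 'X_(widen_ord le_d i) | i < d].

Lemma widen_mp_psums d D (le_d : (d <= D)%N) (g : {mpoly R[d]}) N :
  widen_mp le_d g \mPo psums N D = g \mPo psums N d.
Proof.
rewrite comp_mpolyA; apply: eq_comp_mpoly => i.
by rewrite !tnth_mktuple comp_mpolyU tnth_mktuple.
Qed.

Lemma widen_mp_eval d D (le_d : (d <= D)%N) (g : {mpoly R[d]}) (a : nat -> R) :
  (widen_mp le_d g).@[fun i => a i.+1] = g.@[fun i => a i.+1].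
Proof.
rewrite comp_mpoly_meval; apply: meval_eq => i.
by rewrite tnth_mktuple mevalXU.
Qed.

Lemma expansion_unique (f : symfun R) d d' (g : {mpoly R[d]}) (g' : {mpoly R[d']}) a :
  power_sum_expansion f g -> power_sum_expansion f g' ->
  g.@[fun i : 'I_d => a i.+1] = g'.@[fun i : 'I_d' => a i.+1].
Proof.
move=> exp_g exp_g'.
rewrite -(widen_mp_eval (leq_addr d' d)) -(widen_mp_eval (leq_addl d d') g').
congr meval; apply/eqP; rewrite -subr_eq0; apply/eqP; apply: psums_indep.
by rewrite raddfB /= !widen_mp_psums exp_g exp_g' subrr.
Qed.

Lemma sym_homE (f : symfun R) d (g : {mpoly R[d]}) a :
  power_sum_expansion f g -> sym_hom a f = g.@[fun i : 'I_d => a i.+1].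
Proof.
move=> exp_g; rewrite /sym_hom.
set P := fun v : R => _.
have [d' [g' [exp_g' ->]]] : P (epsilon (inhabits 0) P).
  by apply: epsilon_spec; exists (g.@[fun i : 'I_d => a i.+1]), d, g.
exact: expansion_unique.
Qed.

Lemma sympoly_lin N k (f f' : symfun R) : sympoly N (k *: f + f') = k *: sympoly N f + sympoly N f'.
Proof. exact: flin_linear. Qed.

Lemma sympolyU N la : sympoly N << la >> = monomial_sympoly R N la.
Proof. exact: flinU. Qed.

(** A compatible system of symmetric polynomials, one for each number of
    variables, is a symmetric function as soon as the degrees are bounded. *)
Lemma symfun_of_stable (F : forall N, {mpoly R[N]}) (D : nat) :
  (forall N N' (m : 'X_{1..N}) (m' : 'X_{1..N'}), part_mnm m = part_mnm m' ->
    (F N)@_m = (F N')@_m') ->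
  (forall N m, (F N)@_m != 0 -> (mdeg m <= D)%N) ->
  exists f : symfun R, forall N, sympoly N f = F N.
Proof.
move=> uniF degF.
pose c nu := (F (size nu))@_(mnm_part (size nu) nu).
exists (\sum_(nu <- parts_with D (fun=> True)) c nu *: << nu >>) => N.
apply/mpolyP => m; rewrite mcoeff_sympoly raddf_sum /=.
have eq_c : (F N)@_m = c (part_mnm m) by apply: uniF; rewrite mnm_partK.
under eq_bigr => nu _ do rewrite coeffZ coeffU mul1r.
rewrite sum_delta ?parts_with_uniq //; case: ifP => // /negbT in_m.
apply/esym/eqP/negPn/negP => nz; case/mem_parts_with: in_m; split=> //.
by rewrite mdeg_part_mnm; apply: degF nz.
Qed.

Lemma mcoeff_XnM N (i : 'I_N) k (F : {mpoly R[N]}) m :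
  ('X_i ^+ k * F)@_m = if (k <= m i)%N then F@_(m - U_(i) *+ k)%MM else 0.
Proof.
rewrite mpolyXn mulrC; case: leqP => le_k.
  have le_m : (U_(i) *+ k <= m)%MM.
    apply/mnm_lepP => j; rewrite mulmnE mnm1E; case: eqP => [<-|] /=; rewrite ?mul1n ?mul0n //.
  by rewrite -{1}(submK le_m) addmC mcoeffMX.
rewrite [F]mpolyE mulr_suml raddf_sum big1 // => m' _ /=.
rewrite -scalerAl -mpolyXD mcoeffZ mcoeffX; case: eqP => [eq_m|_]; last by rewrite mulr0.
by move: le_k; rewrite -eq_m mnmDE mulmnE mnm1E eqxx mul1n ltnNge leq_addl.
Qed.

Lemma conj_sub N (m : 'X_{1..N}) (i : 'I_N) k j : (0 < j)%N -> (k <= m i)%N ->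
  (conj_part (part_mnm (m - U_(i) *+ k)%MM) j + (j <= m i)
   = conj_part (part_mnm m) j + (j <= m i - k))%N.
Proof.
move=> j0 le_k; rewrite !conj_part_mnm // (bigD1 i) // [in RHS](bigD1 i) //=.
rewrite mnmBE mulmnE mnm1E eqxx mul1n.
have -> : (\sum_(l < N | l != i) (j <= (m - U_(i) *+ k)%MM l) = \sum_(l < N | l != i) (j <= m l))%N.
  apply: eq_bigr => l ne; rewrite mnmBE mulmnE mnm1E eq_sym (negPf ne) mul0n subn0 //.
by rewrite addnC [RHS]addnC addnCA.
Qed.

(** Multiplication by a power sum does not depend on the number of variables,
    since a last variable with exponent zero contributes nothing. *)
Lemma power_sum_mul (f : symfun R) k : (0 < k)%N ->
  exists h : symfun R, forall N, sympoly N h = power_sum R N k * sympoly N f.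
Proof.
move=> k0; pose D := (k + \max_(ka <- dom f) weight ka)%N.
pose F N := power_sum R N k * sympoly N f.
have FE N m : (F N)@_m = \sum_(i < N) if (k <= m i)%N then coeff (part_mnm (m - U_(i) *+ k)%MM) f else 0.
  rewrite /F /power_sum mulr_suml raddf_sum; apply: eq_bigr => i _ /=.
  by rewrite mcoeff_XnM mcoeff_sympoly.
have F_sym N : F N \is symmetric.
  rewrite rpredM ?sympoly_sym //; apply/issymP => s; rewrite /power_sum raddf_sum /=.
  rewrite [RHS](reindex_inj (@perm_inj _ s)); apply: eq_bigr => i _.
  by rewrite rmorphXn /= msymU.
have F_stable N m : size (m : intpart) = size m -> (size m <= N)%N -> (F N.+1)@_(mnm_part N.+1 m) = (F N)@_(mnm_part N m).
  move=> _ le_N; rewrite !FE big_ord_recr /= mnmE part_default //= leqNgt k0 addr0.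
  apply: eq_bigr => i _; rewrite !mnmE /=; case: leqP => // le_k; congr (coeff _ f).
  apply: conj_inj => j j0; rewrite !conj_part_mnm // big_ord_recr /=.
  rewrite [X in (_ + X)%N](_ : _ = 0)%N ?addn0; last first.
    by rewrite mnmBE mnmE part_default //= sub0n leqNgt j0.
  apply: eq_bigr => l _; rewrite !mnmBE !mulmnE !mnm1E !mnmE /=.
  by rewrite -(inj_eq val_inj) /= -[in RHS](inj_eq val_inj).
have F_add N d nu : (size nu <= N)%N -> (F (N + d)%N)@_(mnm_part (N + d)%N nu) = (F N)@_(mnm_part N nu).
  move=> le_N; elim: d => [|d IHd]; first by rewrite addn0.
  by rewrite addnS F_stable // (leq_trans le_N) ?leq_addr.
have F_part N m : (F N)@_m = (F (size (part_mnm m)))@_(mnm_part _ (part_mnm m)).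
  have le_N := size_part_mnm m.
  have [s def_m] := part_mnm_eq (esym (mnm_partK le_N)).
  rewrite [in LHS]def_m -mcoeff_sym (issymP _ (F_sym N)).
  by have := F_add _ (N - size (part_mnm m))%N _ (leqnn (size (part_mnm m))); rewrite subnKC.
have [||h hE] := @symfun_of_stable F D.
- by move=> N N' m m' eq_m; rewrite F_part [RHS]F_part eq_m.
- move=> N m; rewrite FE => nz.
  have [i] : exists i : 'I_N, (if (k <= m i)%N then coeff (part_mnm (m - U_(i) *+ k)%MM) f else 0) != 0.
    by apply/existsP; apply: contraNT nz => /existsPn z; rewrite big1 // => i _; apply/eqP/negPn/z.
  case: leqP => [le_k nzi|_]; last by rewrite eqxx.
  have le_m : (U_(i) *+ k <= m)%MM.
    apply/mnm_lepP => j; rewrite mulmnE mnm1E; case: eqP => [<-|] /=; rewrite ?mul1n ?mul0n //.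
  rewrite -(submK le_m) mdegD mdegMn mdeg1 mul1n addnC leq_add2l -mdeg_part_mnm.
  by apply: (leq_bigmax_seq (F := fun ka => weight ka)) => //; rewrite mem_dom.
by exists h.
Qed.


Definition expandable (f : symfun R) := exists d (g : {mpoly R[d]}), power_sum_expansion f g.

Lemma expandable_widen (f : symfun R) : expandable f ->
  exists d, forall D, (d <= D)%N -> exists g : {mpoly R[D]}, power_sum_expansion f g.
Proof.
move=> [d [g exp_g]]; exists d => D le_D; exists (widen_mp le_D g) => N.
by rewrite widen_mp_psums exp_g.
Qed.

Lemma expandable_lin k (f f' : symfun R) : expandable f -> expandable f' -> expandable (k *: f + f').
Proof.
move=> /expandable_widen[d exp_d] /expandable_widen[d' exp_d'].
have [g exp_g] := exp_d _ (leq_addr d' d); have [g' exp_g'] := exp_d' _ (leq_addl d d').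
exists (d + d')%N, (k *: g + g') => N.
by rewrite raddfD /= comp_mpolyZ exp_g exp_g' sympoly_lin.
Qed.

Lemma expandable_sum (I : eqType) (r : seq I) (k : I -> R) (F : I -> symfun R) :
  (forall i, i \in r -> expandable (F i)) -> expandable (\sum_(i <- r) k i *: F i).
Proof.
elim: r => [|i r IHr] expF; last first.
  rewrite big_cons; apply: expandable_lin; first by apply: expF; rewrite mem_head.
  by apply: IHr => j j_r; apply: expF; rewrite inE j_r orbT.
by rewrite big_nil; exists 0%N, 0 => N; rewrite comp_mpoly0 /sympoly dom0 big_nil.
Qed.

Lemma flin_id (f : symfun R) : flin (fun la => << la >>) f = f.
Proof.
rewrite -[RHS]freeg_sumE; apply: eq_bigr => la _.
by apply/eqP/freeg_eqP => nu; rewrite coeffZ !coeffU mul1r.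
Qed.

Lemma expandable_mul (f h : symfun R) k : (0 < k)%N -> expandable f ->
  (forall N, sympoly N h = power_sum R N k * sympoly N f) -> expandable h.
Proof.
move=> k0 /expandable_widen[d exp_d] hE.
have [g exp_g] := exp_d _ (leq_addr k d).
have lt_k : (k.-1 < d + k)%N by case: (k) k0 => // k' _; rewrite addnS ltnS leq_addl.
exists (d + k)%N, ('X_(Ordinal lt_k) * g) => N.
by rewrite comp_mpolyM exp_g hE comp_mpolyU tnth_mktuple /= prednK.
Qed.

Lemma size_conj la : size la = conj_part la 1.
Proof.
rewrite /conj_part -[LHS](count_predT la); apply: eq_in_count => x x_la /=.
by rewrite lt0n; apply/esym; apply: contraTneq x_la => ->; apply: intpart_neq0.
Qed.

(** Induction on the number of parts. Let k be the last part of la and w the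
    partition formed by the others; then p_k m_w is a nonzero multiple of m_la
    plus terms with fewer parts. *)
Lemma expandableU la : expandable << la >>.
Proof.
have [L] := ubnP (size la); elim: L la => // L IHL la; rewrite ltnS leq_eqVlt.
case/predU1P => [sz_la|]; last exact: IHL.
case: L sz_la IHL => [|L] sz_la IHL.
  exists 0%N, 1 => N; apply/mpolyP => m.
  rewrite comp_mpoly1 sympolyU mcoeff_monomial_sympoly mcoeff1; congr (_ : bool)%:R.
  apply/eqP/eqP => [->|eq_m].
    apply: conj_inj => j j0; rewrite conj_part_mnm // big1 => [|i _]; last first.
      by rewrite mnmE leqNgt j0.
    by rewrite /conj_part (size0nil sz_la).
  apply/mnmP => i; have : (conj_part (part_mnm m) 1 = 0)%N by rewrite eq_m -size_conj.
  rewrite conj_part_mnm // (bigD1 i) //= mnmE => /eqP.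
  by rewrite addn_eq0 => /andP[]; case: (m i).
pose m := mnm_part L.+1 la; pose w := part_mnm (mnm_widen m); pose k := m ord_max.
have k0 : (0 < k)%N by rewrite /k /m mnmE part_pos // sz_la.
have sz_w : (size w <= L)%N by apply: size_part_mnm.
have conj_la j : (0 < j)%N -> (conj_part la j = conj_part w j + (j <= k))%N.
  move=> j0; rewrite -(mnm_partK (eq_leq sz_la)) !conj_part_mnm // big_ord_recr /=.
  by congr (_ + _)%N; apply: eq_bigr => i _; rewrite [in RHS]mnmE.
have sz_wL : size w = L.
  by have := conj_la 1%N isT; rewrite -!size_conj sz_la k0 addn1 => -[].
have [h hE] := power_sum_mul << w >> k0.
have exp_h : expandable h by apply: expandable_mul hE => //; apply: IHL; rewrite sz_wL.
have coefh N m' : coeff (part_mnm m') h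
    = (\sum_(i < N) ((k <= m' i)%N && (part_mnm (m' - U_(i) *+ k)%MM == w)))%N%:R.
  rewrite -mcoeff_sympoly hE /power_sum mulr_suml raddf_sum natr_sum; apply: eq_bigr => i _ /=.
  rewrite mcoeff_XnM mcoeff_sympoly; case: leqP => //= _.
  by rewrite coeffU mul1r eq_sym.
have coef_long ka : (L < size ka)%N -> ka <> la -> coeff ka h = 0.
  move=> lt_ka ne_ka; rewrite -(mnm_partK (leqnn (size ka))) coefh big1 // => i _.
  case: leqP => //= le_k; case: eqP => //= eq_w; case: ne_ka.
  apply: conj_inj => j j0; rewrite conj_la //.
  have := conj_sub j0 le_k; rewrite eq_w mnm_partK // => ej.
  have := conj_sub (isT : 0 < 1)%N le_k; rewrite eq_w mnm_partK // -!size_conj sz_wL => e1.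
  have m_k : mnm_part (size ka) ka i = k.
    by move: e1 lt_ka le_k k0; clear; case: leqP; case: leqP; lia.
  move: ej; rewrite m_k subnn [(j <= 0)%N]leqNgt j0 /=; lia.
have coef_la : coeff la h != 0.
  rewrite -(mnm_partK (eq_leq sz_la)) coefh (bigD1 ord_max) //= -/m.
  rewrite leqnn (_ : _ == w) ?add1n //; apply/eqP/conj_inj => j j0.
  have := conj_sub j0 (leqnn (m ord_max)); rewrite -/k subnn [(j <= 0)%N]leqNgt j0 addn0.
  by rewrite mnm_partK ?sz_la // conj_la //; lia.
pose r := [seq x <- dom h | x != la].
have exp_r : expandable (\sum_(ka <- r) (- coeff ka h) *: << ka >>).
  apply: expandable_sum => ka; rewrite mem_filter => /andP[ne_ka ka_h]; apply: IHL.
  rewrite ltnNge; apply/negP => lt_ka; move: ka_h; rewrite mem_dom coef_long ?eqxx //.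
  exact/eqP.
have -> : << la >> = (coeff la h)^-1 *: (1 *: h + \sum_(ka <- r) (- coeff ka h) *: << ka >>) + 0.
  rewrite addr0 scale1r -[h in h + _]flin_id /flin (bigD1_seq la) ?uniq_dom ?mem_dom //=.
  rewrite -[in RHS]big_filter -/r -addrA -big_split /= [X in _ + X]big1 ?addr0 => [|ka _].
    by rewrite scalerA mulVf // scale1r.
  by rewrite -scalerDl subrr scale0r.
apply: expandable_lin; last by exists 0%N, 0 => N; rewrite comp_mpoly0 /sympoly dom0 big_nil.
exact: expandable_lin.
Qed.

Lemma expandable_all f : expandable f.
Proof. by rewrite -[f]flin_id; apply: expandable_sum => la _; apply: expandableU. Qed.

Lemma sym_hom_lin a k (f f' : symfun R) : sym_hom a (k *: f + f') = k * sym_hom a f + sym_hom a f'.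
Proof.
have [d exp_d] := expandable_widen (expandable_all f).
have [d' exp_d'] := expandable_widen (expandable_all f').
have [g exp_g] := exp_d _ (leq_addr d' d); have [g' exp_g'] := exp_d' _ (leq_addl d d').
rewrite (sym_homE _ exp_g) (sym_homE _ exp_g') -mevalZ -mevalD; apply: sym_homE => N.
by rewrite raddfD /= comp_mpolyZ exp_g exp_g' sympoly_lin.
Qed.

Lemma sym_hom_eval N (x : 'I_N -> R) (a : nat -> R) f :
  (forall k, a k.+1 = \sum_i x i ^+ k.+1) -> sym_hom a f = (sympoly N f).@[x].
Proof.
move=> aE; have [d [g exp_g]] := expandable_all f.
rewrite (sym_homE _ exp_g) -exp_g comp_mpoly_meval; apply: meval_eq => i.
rewrite tnth_mktuple aE /power_sum raddf_sum; apply: eq_bigr => j _ /=.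
by rewrite rmorphXn /= mevalXU.
Qed.

End PowerSums.

(** * Adding a letter to the alphabet *)

Section Translate.
Variable R : fieldType.
Hypothesis char0 : forall k, k.+1%:R != 0 :> R.
Implicit Types (la mu nu ka : intpart).

Definition mnm_ext N (m : 'X_{1..N}) k : 'X_{1..N.+1} :=
  [multinom if unlift ord_max i is Some j then m j else k | i < N.+1].

Lemma mnm_ext_widen N (m : 'X_{1..N}) k i : mnm_ext m k (widen_ord (leqnSn N) i) = m i.
Proof. by rewrite mnmE -lift_max_widen liftK. Qed.

Lemma mnm_ext_max N (m : 'X_{1..N}) k : mnm_ext m k ord_max = k.
Proof. by rewrite mnmE unlift_none. Qed.

Lemma mnm_ext_eq N (m' : 'X_{1..N.+1}) m k :
  (m' == mnm_ext m k) = (mnm_widen m' == m) && (m' ord_max == k).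
Proof.
apply/eqP/andP => [->|[/eqP <- /eqP <-]].
  split; last by rewrite mnm_ext_max.
  by apply/eqP/mnmP => i; rewrite mnmE mnm_ext_widen.
apply/mnmP => i; rewrite mnmE; case: unliftP => [j ->|->] //.
by rewrite mnmE lift_max_widen.
Qed.

Lemma mcoeff_restr N c (F : {mpoly R[N.+1]}) m K :
  (forall m', m' \in msupp F -> (m' ord_max < K)%N) ->
  (restr c F)@_m = \sum_(k < K) c ^+ k * F@_(mnm_ext m k).
Proof.
move=> lt_K; rewrite restrE raddf_sum /=.
transitivity (\sum_(m' <- msupp F) \sum_(k < K) (F@_m' * c ^+ k) * (m' == mnm_ext m k)%:R).
  apply: eq_big_seq => m' m'F; rewrite mcoeffZ mcoeffX (bigD1 (Ordinal (lt_K m' m'F))) //=.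
  rewrite mnm_ext_eq eqxx andbT big1 ?addr0 // => k ne_k.
  rewrite mnm_ext_eq (_ : (m' ord_max == k) = false) ?andbF ?mulr0 //.
  by apply: contraNF ne_k => /eqP e; apply/eqP/val_inj.
rewrite exchange_big; apply: eq_bigr => k _ /=.
rewrite (sum_delta (fun m' => F@_m' * c ^+ k)) ?msupp_uniq // mulrC.
by case: ifP => // /negbT/memN_msupp_eq0 ->; rewrite mulr0.
Qed.

Lemma conj_ext N (m : 'X_{1..N}) k j : (0 < j)%N ->
  conj_part (part_mnm (mnm_ext m k)) j = (conj_part (part_mnm m) j + (j <= k))%N.
Proof.
move=> j0; rewrite !conj_part_mnm // big_ord_recr /= mnm_ext_max; congr (_ + _)%N.
by apply: eq_bigr => i _; rewrite mnm_ext_widen.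
Qed.

(** Adding one letter y to the alphabet acts on symmetric functions by an
    operator that does not see the other letters. *)
Lemma translate y (f : symfun R) : exists f' : symfun R,
  forall N, sympoly N f' = restr y (sympoly N.+1 f).
Proof.
pose D := \max_(ka <- dom f) weight ka.
have lt_D N m : m \in msupp (sympoly N f) -> (mdeg m <= D)%N.
  rewrite mcoeff_msupp mcoeff_sympoly -mem_dom -mdeg_part_mnm => m_f.
  exact: (leq_bigmax_seq (F := fun ka => weight ka)).
have restrF N m : (restr y (sympoly N.+1 f))@_m
    = \sum_(k < D.+1) y ^+ k * coeff (part_mnm (mnm_ext m k)) f.
  rewrite (@mcoeff_restr _ _ _ _ D.+1) => [|m' /lt_D le_m'].
    by apply: eq_bigr => k _; rewrite mcoeff_sympoly.
  by rewrite ltnS (leq_trans _ le_m') // mdegE (bigD1 ord_max) //= leq_addr.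
apply: (@symfun_of_stable _ (fun N => restr y (sympoly N.+1 f)) D).
- move=> N N' m m' eq_m; rewrite !restrF; apply: eq_bigr => k _; congr (_ * coeff _ f).
  by apply: conj_inj => j j0; rewrite !conj_ext // eq_m.
move=> N m; rewrite -mcoeff_msupp => /msupp_restr[m' /lt_D le_m' ->].
apply: leq_trans le_m'; rewrite !mdegE big_ord_recr /= -[X in (X <= _)%N]addn0 leq_add //.
by apply: leq_sum => i _; rewrite mnmE.
Qed.

(** In terms of power sums a new letter means p_k |-> p_k + y^k, which makes
    sense for arbitrary values of the p_k. *)
Lemma sym_hom_translate y (f f' : symfun R) a b :
  (forall N, sympoly N f' = restr y (sympoly N.+1 f)) ->
  (forall k, b k.+1 = a k.+1 + y ^+ k.+1) -> sym_hom b f = sym_hom a f'.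
Proof.
move=> f'E bE; have [d [g exp_g]] := expandable_all char0 f.
pose g' : {mpoly R[d]} := g \mPo [tuple 'X_i + (y ^+ i.+1)%:MP | i < d].
have exp_g' : power_sum_expansion f' g'.
  move=> N; rewrite f'E -exp_g /g' /restr !comp_mpolyA; apply: eq_comp_mpoly => i.
  rewrite !tnth_mktuple raddfD /= comp_mpolyC comp_mpolyU tnth_mktuple.
  rewrite /power_sum raddf_sum big_ord_recr /=; congr (_ + _).
    apply: eq_bigr => j _; rewrite rmorphXn /=.
    by rewrite comp_mpolyU tnth_fix_last.
  by rewrite [RHS]rmorphXn /= comp_mpolyU tnth_fix_max rmorphXn.
rewrite (sym_homE char0 _ exp_g) (sym_homE char0 _ exp_g') comp_mpoly_meval.
by apply: meval_eq => i; rewrite tnth_mktuple mevalD mevalXU mevalC.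
Qed.

Lemma translate_seq (Y : seq R) (P : intpart -> Prop) (f : symfun R) :
  (forall mu la, part_incl mu la -> P la -> P mu) -> (forall nu, nu \in dom f -> P nu) ->
  exists2 f' : symfun R, forall nu, nu \in dom f' -> P nu &
    forall a b, (forall k, b k.+1 = a k.+1 + \sum_(y <- Y) y ^+ k.+1) ->
      sym_hom b f = sym_hom a f'.
Proof.
move=> Pdown; elim: Y f => [|y Y IHY] f Pf.
  exists f => // a b ab; have [d [g exp_g]] := expandable_all char0 f.
  rewrite !(sym_homE char0 _ exp_g); apply: meval_eq => i.
  by rewrite ab big_nil addr0.
have [f1 f1E] := translate y f.
have Pf1 nu : nu \in dom f1 -> P nu.
  rewrite mem_dom -{1}(mnm_partK (leqnn (size nu))) -mcoeff_sympoly f1E -mcoeff_msupp.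
  case/msupp_restr => m m_f eq_m.
  have /Pf : part_mnm m \in dom f.
    by move: m_f; rewrite mcoeff_msupp mcoeff_sympoly mem_dom.
  apply: Pdown; have := part_mnm_widen m.
  by rewrite -eq_m mnm_partK.
have [f' Pf' f'E] := IHY f1 Pf1; exists f' => // a b ab.
pose c k := a k + \sum_(z <- Y) z ^+ k.
rewrite (@sym_hom_translate y f f1 c b) // => [|k]; first exact: f'E.
by rewrite ab big_cons /c [y ^+ _ + _]addrC addrA.
Qed.

End Translate.

(** * Symmetric functions of x and 1/x *)

Section SymPM.
Variables (R : fieldType) (n : nat).
Implicit Types (la mu nu ka : intpart) (f : symfun R).

(** The exponents of a monomial after x_(n+i) becomes 1 / x_i. *)
Definition fold_mnm (m : 'X_{1..n + n}) : {ffun 'I_n -> int} :=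
  [ffun i : 'I_n => (m (lshift n i))%:Z - (m (rshift n i))%:Z].

Lemma sym_pm_sum f : sym_pm n f = \sum_(m <- msupp (sympoly (n + n) f))
  coeff (part_mnm m) f *: << fold_mnm m >>.
Proof. by apply: eq_bigr => m _; rewrite mcoeff_sympoly. Qed.

Definition pm_point (x : 'I_n -> R) (i : 'I_(n + n)) : R :=
  match split i with inl j => x j | inr j => (x j)^-1 end.

Lemma sym_pm_eval f (x : 'I_n -> R) : (forall i, x i != 0) ->
  laurent_eval (sym_pm n f) x = (sympoly (n + n) f).@[pm_point x].
Proof.
move=> x0; rewrite /sym_pm laurent_eval_sum mevalE; apply: eq_bigr => m _.
rewrite laurent_evalZ laurent_evalU; congr (_ * _).
rewrite big_split_ord /= -big_split /=; apply: eq_bigr => i _.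
rewrite ffunE /pm_point split_lshift split_rshift.
by rewrite expfzDr // -invr_expz -!exprnP exprVn.
Qed.

Lemma coeff_sym_pm f v : coeff v (sym_pm n f)
  = \sum_(m <- msupp (sympoly (n + n) f)) coeff (part_mnm m) f * (fold_mnm m == v)%:R.
Proof.
rewrite sym_pm_sum raddf_sum; apply: eq_bigr => m _ /=.
by rewrite coeffZ coeffU mul1r.
Qed.

Section Lift.
Variables (s : {perm 'I_n}) (e : {ffun 'I_n -> bool}).

Lemma fold_perm (m : 'X_{1..n + n}) : fold_mnm [multinom m (pm_perm s e i) | i < n + n] = bc_act s e (fold_mnm m).
Proof.
apply/ffunP => i; rewrite !ffunE !mnmE !permE /pm_fun split_lshift split_rshift.
by case: (e i) => //; rewrite opprB.
Qed.

(** The symmetry in n + n variables contains the action of BC_n. *)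
Lemma sym_pm_inv f v : coeff (bc_act s e v) (sym_pm n f) = coeff v (sym_pm n f).
Proof.
rewrite !coeff_sym_pm; set S := msupp _.
pose g (m : 'X_{1..n + n}) := [multinom m (pm_perm s e i) | i < n + n].
have g_inj : injective g.
  move=> m m' eq_g; apply/mnmP => i; have := congr1 (fun m : 'X_{1..n + n} => m ((pm_perm s e)^-1%g i)) eq_g.
  by rewrite !mnmE permKV.
have memg m : (g m \in S) = (m \in S).
  by rewrite !mcoeff_msupp !mcoeff_sympoly /g part_mnm_perm.
have perm_g : perm_eq [seq g m | m <- S] S.
  apply: uniq_perm => [||m]; rewrite ?(map_inj_uniq g_inj) ?msupp_uniq //.
  apply/mapP/idP => [[m' m'S ->]|mS]; first by rewrite memg.
  exists [multinom m ((pm_perm s e)^-1%g i) | i < n + n].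
    rewrite -memg (_ : g _ = m) //; apply/mnmP => i; by rewrite !mnmE permK.
  by apply/mnmP => i; rewrite !mnmE permK.
rewrite -(perm_big _ perm_g) big_map; apply: eq_bigr => m _ /=.
by rewrite /g part_mnm_perm fold_perm (inj_eq (@bc_act_inj _ s e)).
Qed.

End Lift.

(** The partition that indexes the orbit of v. *)
Definition abs_part (v : {ffun 'I_n -> int}) : intpart := part_mnm [multinom `|v i|%N | i < n].

Lemma abs_part_act s e v : abs_part (bc_act s e v) = abs_part v.
Proof.
rewrite /abs_part -[RHS](part_mnm_perm _ s); congr part_mnm; apply/mnmP => i.
by rewrite !mnmE ffunE; case: (e i); rewrite ?abszN.
Qed.

Lemma abs_part_vec nu : (size nu <= n)%N -> abs_part (vec n nu) = nu.
Proof.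
move=> le_nu; rewrite -[RHS](mnm_partK le_nu); congr part_mnm; apply/mnmP => i.
by rewrite !mnmE ffunE.
Qed.

Lemma orbit_part v : exists s e, v = bc_act s e (vec n (abs_part v)).
Proof.
pose m := [multinom `|v i|%N | i < n].
have [s def_m] := part_mnm_eq (esym (mnm_partK (size_part_mnm m))).
exists s, [ffun i => v i < 0]; apply/ffunP => i; rewrite !ffunE.
have := congr1 (fun m : 'X_{1..n} => m i) def_m; rewrite !mnmE => <-.
by case: (v i) => k.
Qed.

Lemma coeff_mBC nu v : coeff v (mBC R n nu) = (v \in bc_orbit (vec n nu))%:R.
Proof.
rewrite /mBC -/(vec n nu) raddf_sum /=.
under eq_bigr => w _ do rewrite coeffU.
by rewrite (sum_delta (fun=> 1)) ?undup_uniq //; case: ifP.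
Qed.

Lemma sym_pm_incl f nu : (size nu <= n)%N -> coeff (vec n nu) (sym_pm n f) != 0 ->
  exists2 ka, ka \in dom f & part_incl nu ka.
Proof.
move=> le_nu; rewrite coeff_sym_pm => nz.
have [m mS /eqP eq_v] : exists2 m, m \in msupp (sympoly (n + n) f) & fold_mnm m == vec n nu.
  apply/hasP; apply: contraNT nz => /hasPn no; apply/eqP; rewrite big1_seq // => m /= /no/negPf->.
  by rewrite mulr0.
exists (part_mnm m).
  by move: mS; rewrite mcoeff_msupp mcoeff_sympoly mem_dom.
rewrite -(mnm_partK le_nu); apply/part_incl_conj => j j0; rewrite !conj_part_mnm //.
rewrite [X in (_ <= X)%N]big_split_ord /=; apply: leq_trans (leq_addr _ _).
apply: leq_sum => i _; rewrite mnmE; have := congr1 (fun v : {ffun _ -> int} => v i) eq_v.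
rewrite !ffunE => e; have le_i : (part nu i.+1 <= m (lshift n i))%N by lia.
by case: (leqP j (part nu i.+1)) => // le_j; rewrite (leq_trans le_j).
Qed.

(** A monomial that contributes to x^ka has the same degree as x^ka, so it
    contains no inverse variable, and it is unique. *)
Lemma sym_pm_top f ka : (size ka <= n)%N ->
  (forall nu, nu \in dom f -> part_incl ka nu -> nu = ka) ->
  coeff (vec n ka) (sym_pm n f) = coeff ka f.
Proof.
move=> le_ka top; rewrite coeff_sym_pm.
have le2 : (size ka <= n + n)%N := leq_trans le_ka (leq_addr _ _).
pose m0 := mnm_part (n + n) ka.
transitivity (\sum_(m <- msupp (sympoly (n + n) f)) coeff (part_mnm m) f * (m == m0)%:R).
  apply: eq_big_seq => m mS; congr (_ * (_ : bool)%:R).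
  apply/eqP/eqP => [eq_v|->]; last first.
    apply/ffunP => i; rewrite !ffunE !mnmE /= [X in _ - X%:Z]part_default ?subr0 //.
    by rewrite ltnS (leq_trans le_ka) ?leq_addr.
  have le_l (i : 'I_n) : (part ka i.+1 + m (rshift n i) = m (lshift n i))%N.
    by have := congr1 (fun v : {ffun _ -> int} => v i) eq_v; rewrite !ffunE; lia.
  have eq_ka : part_mnm m = ka.
    apply: top; first by move: mS; rewrite mcoeff_msupp mcoeff_sympoly mem_dom.
    rewrite -(mnm_partK le_ka); apply/part_incl_conj => j j0; rewrite !conj_part_mnm //.
    rewrite [X in (_ <= X)%N]big_split_ord /=; apply: leq_trans (leq_addr _ _).
    apply: leq_sum => i _; rewrite mnmE -le_l.
    by case: (leqP j (part ka i.+1)) => // le_j; rewrite (leq_trans le_j) ?leq_addr.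
  have : (\sum_(i < n) m (rshift n i) = 0)%N.
    have := mdeg_part_mnm m; rewrite eq_ka (weight_mnm le_ka) mdegE big_split_ord /=.
    under [X in _ = (X + _)%N -> _]eq_bigr do rewrite -le_l.
    by rewrite big_split /=; lia.
  move/eqP; rewrite sum_nat_eq0 => /forallP r0.
  have r0' i : m (rshift n i) = 0%N by apply/eqP; have := r0 i.
  apply/mnmP => i; rewrite -[i]splitK; case: (split i) => j /=; rewrite mnmE /=.
    by rewrite -le_l r0' addn0.
  by rewrite r0' part_default // ltnS (leq_trans le_ka) ?leq_addr.
have cm0 : coeff (part_mnm m0) f = coeff ka f by rewrite mnm_partK.
rewrite (sum_delta (fun m : 'X_{1..n + n} => coeff (part_mnm m) f)) ?msupp_uniq //.
by case: ifP => // /negbT/memN_msupp_eq0; rewrite mcoeff_sympoly cm0.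
Qed.

Lemma sym_pm_flin f : exists d : {freeg intpart / R},
  [/\ sym_pm n f = flin (mBC R n) d,
    forall nu, nu \in dom d -> (size nu <= n)%N /\ exists2 ka, ka \in dom f & part_incl nu ka &
    forall ka, (size ka <= n)%N -> (forall nu, nu \in dom f -> part_incl ka nu -> nu = ka) ->
      coeff ka d = coeff ka f].
Proof.
pose D := \max_(ka <- dom f) weight ka.
pose l := parts_with D (fun nu => (size nu <= n)%N).
pose d : {freeg intpart / R} := \sum_(nu <- l) coeff (vec n nu) (sym_pm n f) *: << nu >>.
have coef_out nu : (size nu <= n)%N -> nu \notin l -> coeff (vec n nu) (sym_pm n f) = 0.
  move=> le_nu; apply: contraNeq => /(sym_pm_incl le_nu)[ka ka_f incl].
  apply/mem_parts_with; split=> //; apply: leq_trans (incl_weight incl) _.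
  exact: (leq_bigmax_seq (F := fun ka => weight ka)).
have coef_d nu : (size nu <= n)%N -> coeff nu d = coeff (vec n nu) (sym_pm n f).
  move=> le_nu; rewrite /d raddf_sum /=.
  under eq_bigr => ka _ do rewrite coeffZ coeffU mul1r.
  rewrite sum_delta ?parts_with_uniq //.
  by case: ifP => // /negbT/(coef_out nu le_nu).
have dom_d nu : nu \in dom d -> (size nu <= n)%N.
  move/dom_sum_subset/flattenP => [s /mapP[ka]]; rewrite filter_predT => ka_l -> /domZ_subset.
  by rewrite domU1 inE => /eqP->; have /mem_parts_with[] := ka_l.
exists d; split.
- apply/eqP/freeg_eqP => v; have [s [e def_v]] := orbit_part v.
  have le_nu : (size (abs_part v) <= n)%N by apply: size_part_mnm.
  rewrite def_v sym_pm_inv -coef_d // -def_v; set nu := abs_part v in def_v le_nu *; rewrite /flin [RHS]raddf_sum /=.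
  transitivity (\sum_(mu <- dom d) coeff mu d * (mu == nu)%:R); last first.
    apply: eq_big_seq => mu mu_d /=; rewrite coeffZ coeff_mBC; congr (_ * (_ : bool)%:R).
    apply/eqP/mem_bc_orbit => [->|[s' [e' eq_v]]]; first by exists s, e.
    by rewrite /nu eq_v abs_part_act abs_part_vec // dom_d.
  rewrite (sum_delta (fun mu => coeff mu d)) ?uniq_dom //.
  by case: ifP => // /negbT/coeff_outdom ->.
- move=> nu nu_d; split; first exact: dom_d.
  by move: (nu_d); rewrite mem_dom coef_d ?dom_d //; apply: sym_pm_incl; apply: dom_d.
by move=> ka le_ka top; rewrite coef_d // sym_pm_top.
Qed.

Lemma sym_pm_lin k f f' : sym_pm n (k *: f + f') = k *: sym_pm n f + sym_pm n f'.
Proof.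
pose Phi (p : {mpoly R[n + n]}) : laurent n R := \sum_(m <- msupp p) p@_m *: << fold_mnm m >>.
have PhiE (l : seq 'X_{1..n + n}) p : uniq l -> {subset msupp p <= l} ->
    Phi p = \sum_(m <- l) p@_m *: << fold_mnm m >>.
  move=> uniq_l sub; rewrite [RHS](bigID (mem (msupp p))) /= [X in _ + X]big1 ?addr0 => [|m].
    rewrite -[RHS]big_filter; apply: perm_big; apply: uniq_perm; rewrite ?filter_uniq ?msupp_uniq //.
    by move=> m; rewrite mem_filter; case: (boolP (m \in msupp p)) => // /sub ->.
  by move/memN_msupp_eq0 ->; rewrite scale0r.
pose l := undup (msupp (sympoly (n + n) f) ++ msupp (sympoly (n + n) f')).
rewrite -[LHS]/(Phi _) -[sym_pm n f]/(Phi _) -[sym_pm n f']/(Phi _).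
rewrite !(PhiE l) ?undup_uniq // => [|m mS|m mS|m mS].
- rewrite scaler_sumr -big_split; apply: eq_bigr => m _ /=.
  by rewrite sympoly_lin mcoeffD mcoeffZ scalerDl scalerA.
- by rewrite mem_undup mem_cat mS orbT.
- by rewrite mem_undup mem_cat mS.
rewrite mem_undup mem_cat; move: mS; rewrite sympoly_lin => /msuppD_le.
by rewrite mem_cat => /orP[/msuppZ_le->|->] //; rewrite orbT.
Qed.

End SymPM.

(** * Lifted interpolation at a power of t *)

Section LiftedPoints.
Variable R : fieldType.
Implicit Types (q t s T : R) (la mu nu ka : intpart).

(** The part of a lifted power sum that involves positive powers of s.
    Inverting q, t, T and s gives the other part. *)
Definition half_power_sum q t T s mu k : R :=
  \sum_(1 <= i < (size mu).+1) (q ^+ (k * part mu i) - 1) * t ^- (k * i) * (s * T) ^+ k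
  + s ^+ k * ((1 - T ^+ k) / (1 - t ^+ k)).

Lemma lifted_half q t T s mu k : lifted_power_sum q t T s mu k =
  half_power_sum q t T s mu k + half_power_sum q^-1 t^-1 T^-1 s^-1 mu k.
Proof.
rewrite /lifted_power_sum /half_power_sum big_split /= -!addrA; congr (_ + _).
rewrite [LHS]addrCA; congr (_ + _); rewrite -!exprVn; congr (_ + _).
by apply: eq_bigr => i _; rewrite -!exprVn invrK invfM.
Qed.

Lemma geom_sum (y : R) n : 1 - y != 0 -> (1 - y ^+ n) / (1 - y) = \sum_(i < n) y ^+ i.
Proof.
move=> y1; apply: (mulIf y1); rewrite mulfVK // mulrC.
by rewrite -[1 - y ^+ n]opprB subrX1 -mulNr opprB.
Qed.

(** The geometric series is the power sum of the point of the empty partition;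
    the other summands correct it row by row. *)
Lemma half_tn q t s N mu k : t != 0 -> 1 - t ^+ k != 0 -> (size mu <= N)%N ->
  half_power_sum q t (t ^+ N) s mu k = \sum_(i < N) interp_point q t s mu i ^+ k.
Proof.
move=> t0 tk le_N; rewrite /half_power_sum -exprM mulnC exprM geom_sum //.
have -> : \sum_(1 <= i < (size mu).+1) (q ^+ (k * part mu i) - 1) * t ^- (k * i) * (s * t ^+ N) ^+ k
   = \sum_(i < N) (q ^+ (k * part mu i.+1) - 1) * (t ^+ (N - i.+1) * s) ^+ k.
  rewrite -(big_mkord xpredT (fun i => (q ^+ (k * part mu i.+1) - 1) * (t ^+ (N - i.+1) * s) ^+ k)).
  rewrite [RHS](big_cat_nat (n := size mu)) //= [X in _ + X]big_nat [X in _ + X]big1 ?addr0; last first.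
    by move=> i /andP[le_i _]; rewrite part_default ?ltnS // muln0 expr0 subrr mul0r.
  rewrite big_add1 big_nat [RHS]big_nat; apply: eq_bigr => i /andP[_ lt_i] /=.
  rewrite -mulrA; congr (_ * _); rewrite mulrC mulnC exprM -exprVn -exprMn; congr (_ ^+ _).
  have -> : t ^+ N = t ^+ (N - i.+1) * t ^+ i.+1 by rewrite -exprD subnK // (leq_trans lt_i).
  by rewrite mulrA mulfK ?expf_neq0 // mulrC.
rewrite mulr_sumr (reindex_inj rev_ord_inj) /= -big_split [RHS](reindex_inj rev_ord_inj) /=.
apply: eq_bigr => i _; rewrite /interp_point.
rewrite (_ : N - (N - i.+1).+1 = i)%N; last by have := ltn_ord i; lia.
rewrite /=; have -> : (t ^+ k) ^+ i = (t ^+ i) ^+ k by rewrite -!exprM mulnC.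
rewrite [(k * _)%N]mulnC exprM !exprMn; ring.
Qed.

Lemma half_shift q t s n d mu k : 1 - t ^+ k != 0 ->
  half_power_sum q t (t ^+ (n + d)) s mu k
  = half_power_sum q t (t ^+ n) (t ^+ d * s) mu k + \sum_(j < d) (t ^+ j * s) ^+ k.
Proof.
move=> tk; rewrite /half_power_sum -addrA.
have -> : t ^+ d * s * t ^+ n = s * t ^+ (n + d) by rewrite exprD; ring.
congr (_ + _).
have -> : \sum_(j < d) (t ^+ j * s) ^+ k = s ^+ k * ((1 - (t ^+ k) ^+ d) / (1 - t ^+ k)).
  rewrite geom_sum // mulr_sumr; apply: eq_bigr => j _.
  by rewrite exprMn mulrC -!exprM mulnC.
rewrite !exprD !exprMn -!exprM [(d * k)%N]mulnC; field.
exact: tk.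
Qed.

Lemma interp_pointV q t s n mu (i : 'I_n) :
  interp_point q^-1 t^-1 s^-1 mu i = (interp_point q t s mu i)^-1.
Proof. by rewrite /interp_point !exprVn -!invfM. Qed.

Hypothesis char0 : forall k, k.+1%:R != 0 :> R.
Variables q t : R.

Lemma sgeneric_tk s k : sgeneric q t s -> 1 - t ^+ k.+1 != 0.
Proof.
case=> _ _ [_ _ _ ind]; apply/eqP => /eqP; rewrite subr_eq0 => /eqP e.
by have [|_ //] := ind 0 k.+1%:Z 0; rewrite ?expr0z ?mulr1 ?mul1r -?e.
Qed.

Lemma sgeneric_tVk s k : sgeneric q t s -> 1 - t^-1 ^+ k.+1 != 0.
Proof.
move=> gen; have [_ _ [_ t0 _ _]] := gen; apply/eqP => /eqP; rewrite subr_eq0 => /eqP e.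
have /eqP := sgeneric_tk k gen; apply; apply/eqP; rewrite subr_eq0; apply/eqP.
by rewrite -[RHS]invrK -exprVn -e invr1.
Qed.

Definition lifted_eval T s mu (f : symfun R) := sym_hom (lifted_power_sum q t T s mu) f.

Lemma lifted_eval_lin T s mu k (f f' : symfun R) : lifted_eval T s mu (k *: f + f') = k * lifted_eval T s mu f + lifted_eval T s mu f'.
Proof. exact: sym_hom_lin. Qed.

(** For T = t^N the lifted power sums are the power sums of the coordinates of
    the interpolation point and of their inverses. *)
Lemma lifted_eval_tn s N mu f : sgeneric q t s -> (size mu <= N)%N ->
  lifted_eval (t ^+ N) s mu f = laurent_eval (sym_pm N f) (interp_point q t s mu).
Proof.
move=> gen le_N; have [_ _ [_ t0 _ _]] := gen.
rewrite sym_pm_eval => [|i]; last exact: (interp_point_neq0 mu i gen).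
apply: (sym_hom_eval char0) => k.
rewrite lifted_half -exprVn !half_tn ?invr_eq0 ?(sgeneric_tk k gen) ?(sgeneric_tVk k gen) //.
rewrite big_split_ord /=; congr (_ + _); apply: eq_bigr => i _; rewrite /pm_point.
  by rewrite split_lshift.
by rewrite interp_pointV split_rshift.
Qed.

(** When N is large, passing to Laurent polynomials is unitriangular from
    monomial symmetric functions to orbit sums, so the problem reduces to that
    for orbit sums. *)
Lemma lifted_eval_mx_big s N (P : intpart -> Prop) l : sgeneric q t s -> uniq l ->
  (forall mu, reflect (P mu) (mu \in l)) -> (forall mu la, part_incl mu la -> P la -> P mu) ->
  (forall mu, mu \in l -> (size mu <= N)%N) ->
  interp_mx (fun la => << la >> : symfun R) (lifted_eval (t ^+ N) s) l \in unitmx.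
Proof.
move=> gen uniq_l mem_l Pdown le_N; apply: (interp_mx_unit (@lifted_eval_lin _ s)) => // c sub c0.
have [d [pmE dom_d top_d]] := sym_pm_flin N c.
have mem_l' mu : reflect (P mu /\ (size mu <= N)%N) (mu \in l).
  by apply: (iffP idP) => [mu_l|[/mem_l]] //; split; [apply/mem_l|apply: le_N].
have d0 : d = 0.
  apply: (interp_unique (@bc_eval_lin _ q t N s) uniq_l (bc_mx_unit char0 gen uniq_l mem_l' Pdown)).
    by move=> nu /dom_d[_ [ka /sub/mem_l Pka incl]]; apply/mem_l; apply: Pdown Pka.
  by move=> mu mu_l; rewrite /bc_eval -pmE -lifted_eval_tn ?le_N // -{1}[c]flin_id c0.
apply/eqP; rewrite -dom_eq0; apply/negPn/negP => /weight_argmax[ka ka_c max_ka].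
have := top_d ka (le_N _ (sub _ ka_c)); rewrite d0 coeff0.
move=> h; move: ka_c; rewrite mem_dom -h ?eqxx // => nu nu_c incl.
by apply/esym; apply: incl_weight_eq incl (max_ka _ nu_c).
Qed.

(** Going from T = t^n to T = t^(n+d) adds letters to the alphabet, which
    multiplies the matrix of the problem by a square matrix. The product is
    nonsingular for large d; hence so is the matrix at T = t^n, even if some
    partitions have more than n parts. *)
Lemma lifted_eval_mx_unit s n (P : intpart -> Prop) l : sgeneric q t s -> uniq l ->
  (forall mu, reflect (P mu) (mu \in l)) -> (forall mu la, part_incl mu la -> P la -> P mu) ->
  interp_mx (fun la => << la >> : symfun R) (lifted_eval (t ^+ n) s) l \in unitmx.
Proof.
move=> gen uniq_l mem_l Pdown.
pose d := \max_(mu <- l) size mu.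
have [_ _ [_ t0 _ _]] := gen.
pose s' := t ^- d * s.
have gen' : sgeneric q t s'.
  by have := sgeneric_mulq 0 (- d%:Z) gen; rewrite expr0z mul1r -invr_expz -exprnP.
have s'E : t ^+ d * s' = s by rewrite /s' mulVKf // expf_neq0.
(* The letters that are added between T = t^n and T = t^(n+d). *)
pose Y := [seq t ^+ j * s' | j <- iota 0 d] ++ [seq (t ^+ j * s')^-1 | j <- iota 0 d].
have shift mu k : lifted_power_sum q t (t ^+ (n + d)) s' mu k.+1
    = lifted_power_sum q t (t ^+ n) s mu k.+1 + \sum_(y <- Y) y ^+ k.+1.
  rewrite !lifted_half -!exprVn !half_shift ?(sgeneric_tk k gen) ?(sgeneric_tVk k gen) //.
  have -> : t^-1 ^+ d / s' = s^-1 by rewrite exprVn -invfM s'E.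
  rewrite s'E big_cat /= !big_map addrACA; congr (_ + (_ + _)).
    by rewrite -(big_mkord xpredT (fun j => (t ^+ j * s') ^+ k.+1)) /index_iota subn0.
  rewrite -(big_mkord xpredT (fun j => (t^-1 ^+ j / s') ^+ k.+1)) /index_iota subn0.
  by apply: eq_bigr => j _; rewrite exprVn -invfM.
have unitB : interp_mx (fun la => << la >> : symfun R) (lifted_eval (t ^+ (n + d)) s') l \in unitmx.
  apply: (lifted_eval_mx_big gen' uniq_l mem_l Pdown) => mu mu_l.
  by apply: leq_trans (leq_addl _ _); apply: (leq_bigmax_seq (F := fun mu => size (mu : intpart))).
have trans (ka : intpart) : ka \in l -> exists f' : symfun R, (forall nu, nu \in dom f' -> nu \in l) /\
    forall mu, lifted_eval (t ^+ (n + d)) s' mu << ka >> = lifted_eval (t ^+ n) s mu f'.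
  move=> /mem_l Pka; have [|f' Pf' f'E] := translate_seq char0 Y (f := << ka >>) Pdown.
    by move=> nu; rewrite domU1 inE => /eqP->.
  exists f'; split=> [nu /Pf'/mem_l //|mu]; apply: f'E => k; exact: shift.
pose good (i : 'I_(size l)) (f' : symfun R) := (forall nu, nu \in dom f' -> nu \in l) /\
    forall mu, lifted_eval (t ^+ (n + d)) s' mu << elt i >> = lifted_eval (t ^+ n) s mu f'.
pose f_ i := epsilon (inhabits 0) (good i).
have f_P i : good i (f_ i) by apply: epsilon_spec; apply: trans; apply: elt_mem.
have : interp_mx (fun la => << la >> : symfun R) (lifted_eval (t ^+ (n + d)) s') l
    = (\matrix_(i, j) coeff (elt j) (f_ i)) *m interp_mx (fun la => << la >> : symfun R) (lifted_eval (t ^+ n) s) l.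
  apply/matrixP => i j; rewrite !mxE; have [dom_i ->] := f_P i.
  transitivity (lifted_eval (t ^+ n) s (elt j) (flin (fun la => << la >> : symfun R)
      (row_free_elt (\row_(k < size l) coeff (elt k) (f_ i))))).
    by rewrite -row_of_coeff // flin_id.
  rewrite (linform_row_mx _ (lifted_eval_lin (t ^+ n) s)) mxE.
  by apply: eq_bigr => k _; rewrite !mxE.
by move=> e; move: unitB; rewrite e unitmx_mul => /andP[].
Qed.

End LiftedPoints.

Section LiftedInterp.
Variables (R : fieldType) (q t : R).
Hypothesis char0 : forall k, k.+1%:R != 0 :> R.
Implicit Types (T s : R) (la mu nu ka : intpart).

Definition dom_below la := parts_with (weight la) (fun mu => dom_lt mu la).

Lemma dom_belowP la mu : reflect (dom_lt mu la) (mu \in dom_below la).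
Proof.
apply: (iffP (mem_parts_with _ _ _)) => [[]//|lt_mu]; split=> //.
by case: lt_mu => /dom_le_weight.
Qed.

Definition lifted_mx T s la := interp_mx (fun la => << la >> : symfun R) (lifted_eval q t T s) (dom_below la).

Lemma is_lifted_interp_monic T s la f : is_lifted_interp q t T s la f <->
  monic_comb (fun la => << la >> : symfun R) la (fun mu => dom_lt mu la) f /\
  forall mu, dom_lt mu la -> lifted_eval q t T s mu f = 0.
Proof.
by split=> -[[c [lt_c ->]] f0]; split=> //; exists c; rewrite flin_id.
Qed.

Lemma lifted_interpP T s la : lifted_mx T s la \in unitmx ->
  is_lifted_interp q t T s la (lifted_interp q t T s la).
Proof.
move=> unitA; rewrite /lifted_interp; apply: epsilon_spec.
have [f mf f0] := monic_interp_exists (lifted_eval_lin char0 q t T s) la (dom_belowP la) unitA (fun=> 0).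
by exists f; apply/is_lifted_interp_monic.
Qed.

Lemma lifted_mx_unit s n la : sgeneric q t s -> lifted_mx (t ^+ n) s la \in unitmx.
Proof.
move=> gen; apply: (lifted_eval_mx_unit char0 n gen (parts_with_uniq _ _) (dom_belowP la)).
by move=> mu nu; apply: dom_lt_incl.
Qed.

(** Both polynomials satisfy the same interpolation conditions. If la has more
    than n parts, there is no leading term and the conditions force zero. *)
Lemma sym_pm_lifted s n la : sgeneric q t s ->
  sym_pm n (lifted_interp q t (t ^+ n) s la)
  = if (size la <= n)%N then interp q t n s la else 0.
Proof.
move=> gen; have [[c [lt_c def_f]] f0] := lifted_interpP (lifted_mx_unit n la gen).
set f := lifted_interp _ _ _ _ _ in def_f f0 *.
have dom_f nu : nu \in dom f -> dom_le nu la.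
  rewrite def_f => /domD_subset; rewrite mem_cat domU1 inE => /orP[/eqP -> //|/lt_c[]//].
have [d [pmE dom_d top_d]] := sym_pm_flin n f.
have low_d nu : nu \in dom d -> dom_le nu la /\ (size nu <= n)%N.
  move=> /dom_d[sz_nu [ka /dom_f le_ka incl]]; split=> //.
  exact: dom_le_incl incl le_ka.
have zero mu : dom_lt mu la -> (size mu <= n)%N ->
    laurent_eval (sym_pm n f) (interp_point q t s mu) = 0.
  by move=> lt_mu sz_mu; rewrite -(lifted_eval_tn char0) //; apply: f0.
case: ifP => [le_la|/negbT gt_la].
  have la_d : coeff la d = 1.
    rewrite top_d // => [|nu /dom_f le_nu incl].
      rewrite def_f coeffD coeffU eqxx mulr1 coeff_outdom ?addr0 //.
      by apply/negP => /lt_c[].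
    by apply: dom_le_anti => //; apply: incl_dom_le.
  have [mon_i i0] := interpP char0 n la gen.
  apply: (bc_monic_unique char0 gen (la := la)) => // [|mu lt_mu sz_mu]; last first.
    by rewrite zero // i0.
  exists (d - << la >>); split=> [nu|].
    move=> nu_d; have ne_nu : nu <> la.
      move=> eq_nu; move: nu_d; rewrite mem_dom eq_nu coeffB la_d coeffU eqxx mulr1.
      by rewrite subrr eqxx.
    move: nu_d => /domB; rewrite mem_cat domU1 inE => /orP[/low_d[]//|/eqP //].
  by rewrite -/(flin (mBC R n) _) flinB flinU addrC subrK.
rewrite pmE (_ : d = 0) ?flin0 //.
apply: (interp_unique (@bc_eval_lin _ q t n s) (parts_with_uniq _ _) (bc_below_unit char0 n la gen)).
  move=> nu /low_d[le_nu sz_nu]; apply/bc_belowP; split=> //; split=> // eq_nu.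
  by move: gt_la; rewrite -eq_nu sz_nu.
by move=> mu /bc_belowP[lt_mu sz_mu]; rewrite /bc_eval -pmE; apply: zero.
Qed.

End LiftedInterp.

(** * Regularity and values of rational functions *)

Section RatfunValue.
Variables (R : fieldType) (a : R).
Local Notation K := (ratfun R).
Local Notation reg r v := (ratfun_value r a v).

Lemma tofrac_neq0 (d : {poly R}) : d.[a] != 0 -> tofrac d != 0 :> K.
Proof. by apply: contraNneq => /eqP; rewrite tofrac_eq0 => /eqP->; rewrite horner0. Qed.

Lemma reg_poly (p : {poly R}) : reg (tofrac p) p.[a].
Proof. by exists p, 1; split; rewrite ?hornerC ?oner_neq0 ?tofrac1 ?divr1. Qed.

Lemma regC c : reg (ratfunC c) c.
Proof. by have := reg_poly c%:P; rewrite hornerC. Qed.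

Lemma regT : reg (ratfunT R) a.
Proof. by have := reg_poly 'X; rewrite hornerX. Qed.

Lemma reg0 : reg (0 : K) 0.
Proof. by have := reg_poly 0; rewrite tofrac0 horner0. Qed.

Lemma reg1 : reg (1 : K) 1.
Proof. by have := reg_poly 1; rewrite tofrac1 hornerC. Qed.

Lemma regD r v r' v' : reg r v -> reg r' v' -> reg (r + r') (v + v').
Proof.
move=> [p [d [d0 -> ->]]] [p' [d' [d'0 -> ->]]]; exists (p * d' + p' * d), (d * d').
rewrite !hornerE mulf_neq0 //; split=> //; last by rewrite addf_div.
by rewrite tofracD !tofracM addf_div ?tofrac_neq0.
Qed.

Lemma regM r v r' v' : reg r v -> reg r' v' -> reg (r * r') (v * v').
Proof.
move=> [p [d [d0 -> ->]]] [p' [d' [d'0 -> ->]]]; exists (p * p'), (d * d').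
split; first by rewrite hornerM mulf_neq0.
  by rewrite !tofracM mulf_div.
by rewrite !hornerM mulf_div.
Qed.

Lemma regN r v : reg r v -> reg (- r) (- v).
Proof.
by move=> [p [d [d0 -> ->]]]; exists (- p), d; rewrite hornerN tofracN !mulNr.
Qed.

Lemma regB r v r' v' : reg r v -> reg r' v' -> reg (r - r') (v - v').
Proof. by move=> h /regN; apply: regD. Qed.

Lemma reg_eq0 v : reg (0 : K) v -> v = 0.
Proof.
move=> [p [d [d0 e ->]]]; have /eqP : tofrac p = 0 :> K.
  by rewrite -[tofrac p](divfK (tofrac_neq0 d0)) -e mul0r.
by rewrite tofrac_eq0 => /eqP->; rewrite horner0 mul0r.
Qed.

Lemma reg_neq0 r v : reg r v -> v != 0 -> r != 0.
Proof. by move=> h; apply: contraNneq => r0; move: h; rewrite r0 => /reg_eq0 ->. Qed.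

Lemma regV r v : reg r v -> v != 0 -> reg r^-1 v^-1.
Proof.
move=> h v0; have r0 := reg_neq0 h v0; move: h => [p [d [d0 e ev]]].
move: v0; rewrite ev mulf_eq0 negb_or => /andP[p0 _].
by exists d, p; rewrite e !invf_div.
Qed.

Lemma reg_div r v r' v' : reg r v -> reg r' v' -> v' != 0 -> reg (r / r') (v / v').
Proof. by move=> h /regV h' /h'; apply: regM. Qed.

Lemma reg_sum (I : Type) (s : seq I) (P : pred I) (F : I -> K) (G : I -> R) :
  (forall i, reg (F i) (G i)) -> reg (\sum_(i <- s | P i) F i) (\sum_(i <- s | P i) G i).
Proof.
move=> h; elim/big_rec2: _ => [|i v r _ IH]; [exact: reg0 | exact: regD].
Qed.

Lemma reg_prod (I : Type) (s : seq I) (P : pred I) (F : I -> K) (G : I -> R) :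
  (forall i, reg (F i) (G i)) -> reg (\prod_(i <- s | P i) F i) (\prod_(i <- s | P i) G i).
Proof.
move=> h; elim/big_rec2: _ => [|i v r _ IH]; [exact: reg1 | exact: regM].
Qed.

Lemma regX r v k : reg r v -> reg (r ^+ k) (v ^+ k).
Proof.
by move=> h; elim: k => [|k IHk]; [exact: reg1 | rewrite !exprS; exact: regM].
Qed.

Lemma regXz r v (k : int) : reg r v -> v != 0 -> reg (r ^ k) (v ^ k).
Proof.
move=> h v0; case: k => k; first exact: regX.
by rewrite NegzE -!invr_expz; apply: regV; [exact: regX|rewrite expf_neq0].
Qed.

Lemma reg_nat k : reg (k%:R : K) (k%:R).
Proof. by elim: k => [|k IHk]; [exact: reg0 | rewrite !mulrS; apply: regD reg1 IHk]. Qed.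

Lemma reg_det n (A : 'M[K]_n) (A0 : 'M[R]_n) :
  (forall i j, reg (A i j) (A0 i j)) -> reg (\det A) (\det A0).
Proof.
move=> h; apply: reg_sum => s; apply: regM; last exact: reg_prod.
by apply: regX; apply: regN reg1.
Qed.

Lemma reg_invmx n (A : 'M[K]_n) (A0 : 'M[R]_n) : A0 \in unitmx ->
  (forall i j, reg (A i j) (A0 i j)) ->
  A \in unitmx /\ forall i j, reg (invmx A i j) (invmx A0 i j).
Proof.
move=> unitA0 h; have detA := reg_det h.
have det0 : \det A0 != 0 by move: unitA0; rewrite unitmxE unitfE.
have unitA : A \in unitmx by rewrite unitmxE unitfE (reg_neq0 detA).
split=> // i j; rewrite /invmx unitA unitA0 !mxE; apply: regM; first exact: regV.
apply: regM; first by apply: regX; apply: regN reg1.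
by apply: reg_det => i' j'; rewrite !mxE.
Qed.

Section Transfer.
Variables (VK : lmodType K) (VR : lmodType R) (eK : intpart -> VK) (eR : intpart -> VR).
Variables (phiK : intpart -> VK -> K) (phiR : intpart -> VR -> R).
Hypothesis phiK_lin : forall x k v w, phiK x (k *: v + w) = k * phiK x v + phiK x w.
Hypothesis phiR_lin : forall x k v w, phiR x (k *: v + w) = k * phiR x v + phiR x w.
Variables (la : intpart) (P : intpart -> Prop) (l : seq intpart).
Hypothesis uniq_l : uniq l.
Hypothesis mem_l : forall mu, reflect (P mu) (mu \in l).
Hypothesis reg_phi : forall mu nu, reg (phiK mu (eK nu)) (phiR mu (eR nu)).
Hypothesis unitR : interp_mx eR phiR l \in unitmx.

Lemma reg_mx : interp_mx eK phiK l \in unitmx /\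
  forall i j, reg (invmx (interp_mx eK phiK l) i j) (invmx (interp_mx eR phiR l) i j).
Proof. by apply: reg_invmx => // i j; rewrite !mxE. Qed.

(** By Cramer's rule the solution of a linear interpolation problem is regular
    where its determinant does not vanish. The linear form psi extracts from
    the solution a coefficient, or a value at some other point. *)
Lemma reg_interp pK pR (psiK : VK -> K) (psiR : VR -> R) :
  (forall k v w, psiK (k *: v + w) = k * psiK v + psiK w) ->
  (forall k v w, psiR (k *: v + w) = k * psiR v + psiR w) ->
  (forall nu, reg (psiK (eK nu)) (psiR (eR nu))) ->
  monic_comb eK la P pK -> (forall mu, P mu -> phiK mu pK = 0) ->
  monic_comb eR la P pR -> (forall mu, P mu -> phiR mu pR = 0) ->
  reg (psiK pK) (psiR pR).
Proof.
move=> psiK_lin psiR_lin reg_psi monK pK0 monR pR0; have [unitK reg_inv] := reg_mx.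
rewrite (monic_interp_eq phiK_lin uniq_l mem_l unitK monK pK0).
rewrite (monic_interp_eq phiR_lin uniq_l mem_l unitR monR pR0).
set rK := _ *m _; set rR := _ *m _.
have psiKE (v w : VK) : psiK (v - w) = psiK v - psiK w.
  by rewrite -scaleN1r addrC psiK_lin mulN1r addrC.
have psiRE (v w : VR) : psiR (v - w) = psiR v - psiR w.
  by rewrite -scaleN1r addrC psiR_lin mulN1r addrC.
rewrite psiKE psiRE.
rewrite (@linform_row _ _ _ eK (fun=> psiK) (fun=> psiK_lin) l rK la).
rewrite (@linform_row _ _ _ eR (fun=> psiR) (fun=> psiR_lin) l rR la).
apply: regB => //; apply: reg_sum => i; apply: regM => //.
by rewrite !mxE; apply: reg_sum => j; rewrite !mxE; apply: regM.
Qed.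

End Transfer.
End RatfunValue.

Section BaseChange.
Variable R : fieldType.
Local Notation K := (ratfun R).
Local Notation reg r a v := (ratfun_value r a v).

Definition iota_ratfun : {rmorphism R -> K} := @tofrac {poly R} \o @polyC R.

Lemma ratfunCE c : ratfunC c = iota_ratfun c. Proof. by []. Qed.

Lemma map_comp_mpoly d N (T : d.-tuple {mpoly R[N]}) (g : {mpoly R[d]}) :
  map_mpoly iota_ratfun (g \mPo T)
  = map_mpoly iota_ratfun g \mPo [tuple map_mpoly iota_ratfun (tnth T i) | i < d].
Proof.
elim/mpoly_ring_ind: g => [c|i|p p' IHp IHp'|p p' IHp IHp'].
- by rewrite comp_mpolyC !map_mpolyC comp_mpolyC.
- by rewrite comp_mpolyU map_mpolyX comp_mpolyU tnth_mktuple.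
- by rewrite !raddfD /= IHp IHp'.
by rewrite comp_mpolyM !rmorphM /= IHp IHp'.
Qed.

Lemma expansion_map mu d (g : {mpoly R[d]}) :
  power_sum_expansion << mu >> g -> power_sum_expansion << mu >> (map_mpoly iota_ratfun g).
Proof.
move=> exp_g N; rewrite sympolyU.
transitivity (map_mpoly iota_ratfun (monomial_sympoly R N mu)).
  rewrite -sympolyU -exp_g map_comp_mpoly; apply: eq_comp_mpoly => i.
  rewrite !tnth_mktuple /power_sum raddf_sum; apply: eq_bigr => j _ /=.
  by rewrite rmorphXn /= map_mpolyX.
rewrite /monomial_sympoly raddf_sum; apply: eq_bigr => m _ /=.
by rewrite map_mpolyX.
Qed.

Hypothesis char0 : forall k, k.+1%:R != 0 :> R.

Lemma ratfun_char0 k : k.+1%:R != 0 :> K.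
Proof. exact: reg_neq0 (reg_nat 0 _) (char0 k). Qed.

(** The same expansion in power sums is valid over R and over the field of
    rational functions. *)
Lemma reg_sym_hom a (bK : nat -> K) (b : nat -> R) mu :
  (forall k, reg (bK k.+1) a (b k.+1)) -> reg (sym_hom bK << mu >>) a (sym_hom b << mu >>).
Proof.
move=> h; have [d [g exp_g]] := expandableU char0 mu.
rewrite (sym_homE char0 _ exp_g) (sym_homE ratfun_char0 _ (expansion_map exp_g)).
elim/mpoly_ring_ind: g {exp_g} => [c|i|p p' IHp IHp'|p p' IHp IHp'].
- by rewrite map_mpolyC !mevalC; apply: regC.
- by rewrite map_mpolyX !mevalXU.
- by rewrite raddfD /= !mevalD; apply: regD.
by rewrite rmorphM /= !mevalM; apply: regM.
Qed.

End BaseChange.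

(** * Specialization of the lifted binomial formula *)

Lemma sgenericI (F : fieldType) (q t s : F) : q != 0 -> t != 0 -> s != 0 ->
  (forall i j k : int, q ^ i * t ^ j * (s * s) ^ k = 1 -> [/\ i = 0, j = 0 & k = 0]) ->
  sgeneric q t s.
Proof.
move=> q0 t0 s0 ind; split; rewrite ?invr_eq0 //.
by rewrite invrK; split; rewrite ?mulf_neq0.
Qed.

Lemma sqr_mulX (F : comNzRingType) (x y : F) k :
  (x * y * (x * y)) ^+ k = x ^+ (2 * k) * y ^+ (2 * k).
Proof. by rewrite !exprM -exprMn -exprMn -expr2. Qed.

Lemma cancel_ratio (F : fieldType) (c d x y : F) : c != 0 -> c * d * x / (c * y) = d * (x / y).
Proof. by move=> c0; rewrite -[c * d * x]mulrA -mulf_div divff // mul1r mulrA. Qed.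

Section Lifted.
Variables (R : fieldType) (q t t0 t1 t2 t3 h : R).
Hypothesis gen : generic q t t0 t1 t2 t3.
Hypothesis hh : h ^+ 2 = t0 * t1 * t2 * t3 / q.
Variable n : nat.
Local Notation K := (ratfun R).
Local Notation reg r v := (ratfun_value r (t ^+ n) v).
Local Notation C := (@ratfunC R).
Local Notation T := (ratfunT R).
Implicit Types la mu nu : intpart.

Let char0 := generic_char0 gen.
Let char0K := ratfun_char0 char0.
Let gen_t := generic_sgeneric gen.
Let gen_h := generic_sgeneric_root gen hh.

Let q0 : q != 0. Proof. by have [] := generic_neq0 gen. Qed.
Let tz : t != 0. Proof. by have [] := generic_neq0 gen. Qed.
Let t00 : t0 != 0. Proof. by have [] := generic_neq0 gen. Qed.
Let h0 : h != 0. Proof. exact: generic_root_neq0 gen hh. Qed.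
Let tn0 : t ^+ n != 0. Proof. exact: expf_neq0. Qed.

Lemma reg_lifted_power_sum mu k :
  reg (lifted_power_sum (C q) (C t) T (C t0) mu k.+1) (lifted_power_sum q t (t ^+ n) t0 mu k.+1).
Proof.
have rq := regC (t ^+ n) q; have rt := regC (t ^+ n) t; have rs := regC (t ^+ n) t0.
have rT := regT (t ^+ n); have r1 := reg1 (t ^+ n).
have tk := sgeneric_tk k gen_t; have tVk := sgeneric_tVk k gen_t.
rewrite exprVn in tVk.
apply: regD; first apply: regD.
- apply: reg_sum => i; apply: regD; apply: regM.
  + apply: regM; first by apply: regB => //; apply: regX.
    by apply: regV; [apply: regX | rewrite expf_neq0].
  + by apply: regX; apply: regM.
  + apply: regM; last exact: regX.
    apply: regB => //; apply: regV; [exact: regX | by rewrite expf_neq0].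
  + by apply: regV; [apply: regX; apply: regM | rewrite expf_neq0 // mulf_neq0].
- by apply: regM; [apply: regX | apply: reg_div => //; apply: regB => //; apply: regX].
apply: regM; first by apply: regV; [apply: regX | rewrite expf_neq0].
by apply: reg_div => //; apply: regB => //; apply: regV; rewrite ?expf_neq0 //; apply: regX.
Qed.

Lemma reg_lifted_eval mu nu : reg (lifted_eval (C q) (C t) T (C t0) mu << nu >>) (lifted_eval q t (t ^+ n) t0 mu << nu >>).
Proof. by apply: (reg_sym_hom char0) => k; apply: reg_lifted_power_sum. Qed.

Lemma reg_lifted_interp mu nu :
  reg (coeff nu (lifted_interp (C q) (C t) T (C t0) mu)) (coeff nu (lifted_interp q t (t ^+ n) t0 mu)).
Proof.
have unitR := lifted_mx_unit char0 n mu gen_t.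
have [unitK _] := reg_mx (l := dom_below mu) reg_lifted_eval unitR.
have /is_lifted_interp_monic[monK zK] := lifted_interpP char0K unitK.
have /is_lifted_interp_monic[monR zR] := lifted_interpP char0 unitR.
apply: (reg_interp (lifted_eval_lin char0K (C q) (C t) T (C t0)) (lifted_eval_lin char0 q t (t ^+ n) t0)
  (parts_with_uniq _ _) (dom_belowP mu) reg_lifted_eval unitR _ _ _ monK zK monR zR).
- by move=> k v w; rewrite coeffD coeffZ.
- by move=> k v w; rewrite coeffD coeffZ.
by move=> ka; rewrite !coeffU !mul1r; apply: reg_nat.
Qed.

Lemma ratfunCM c d : C (c * d) = C c * C d.
Proof. by rewrite /ratfunC polyCM tofracM. Qed.

Lemma ratfunCV c : C c^-1 = (C c)^-1.
Proof. by rewrite !ratfunCE fmorphV. Qed.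

Lemma ratfunCX c (k : int) : C (c ^ k) = C c ^ k.
Proof. by rewrite !ratfunCE fmorphXz. Qed.

Lemma ratfunCXn c k : C (c ^+ k) = C c ^+ k.
Proof. by rewrite !ratfunCE rmorphXn. Qed.

Lemma ratfunC_inj : injective C.
Proof. by move=> x y; rewrite !ratfunCE => /fmorph_inj. Qed.

(** The degree in T separates the powers of the parameter from q and t. *)
Lemma sgeneric_ratfun c : c != 0 -> sgeneric (C q) (C t) (C c * T).
Proof.
move=> c0; have T0 : T != 0 by rewrite /ratfunT tofrac_eq0 polyX_eq0.
have Cn0 x : x != 0 -> C x != 0.
  by move=> x0; rewrite ratfunCE fmorph_eq0.
have cT0 : C c * T != 0 by rewrite mulf_neq0 ?Cn0.
apply: sgenericI; [exact: Cn0 | exact: Cn0 | exact: cT0 |] => i j k eq1.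
have Tpow (u : R) (m : nat) : C u * T ^+ m = 1 -> m = 0%N.
  rewrite /ratfunC /ratfunT -tofracXn -tofracM -tofrac1 => /eqP; rewrite tofrac_eq => /eqP e.
  have u0 : u != 0 by apply: contra_eq_neq e => ->; rewrite mul0r eq_sym oner_neq0.
  by have := congr1 (fun p : {poly R} => size p) e; rewrite size_poly1 mul_polyC size_scale // size_polyXn => -[].
have k0 : k = 0.
  case: k eq1 => k; rewrite ?NegzE => eq1.
    have := @Tpow (q ^ i * t ^ j * c ^+ (2 * k)) (2 * k)%N.
    suff -> : C (q ^ i * t ^ j * c ^+ (2 * k)) * T ^+ (2 * k) = 1 by move=> /(_ erefl); case: k {eq1}.
    by rewrite !ratfunCM !ratfunCX ratfunCXn -mulrA -sqr_mulX.
  have := @Tpow (q ^ (- i) * t ^ (- j) * c ^+ (2 * k.+1)) (2 * k.+1)%N.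
  suff -> : C (q ^ (- i) * t ^ (- j) * c ^+ (2 * k.+1)) * T ^+ (2 * k.+1) = 1 by move=> /(_ erefl).
  rewrite -[RHS]invr1 -eq1 !invfM !invr_expz opprK.
  by rewrite !ratfunCM !ratfunCX ratfunCXn -mulrA -sqr_mulX.
move: eq1; rewrite k0 expr0z mulr1 -!ratfunCX -ratfunCM => /(@ratfunC_inj _ 1) e1.
have [_ _ [_ _ _ ind]] := gen_t.
by have [|-> -> _] := ind i j 0; rewrite ?expr0z ?mulr1.
Qed.

Section Binom.
Variables (m : nat) (c : R).
Hypothesis c0 : c != 0.
Hypothesis gen_c : sgeneric q t (c * t ^+ n).

Lemma reg_bc_eval mu nu :
  reg (bc_eval (C q) (C t) (C c * T) mu (mBC K m nu)) (bc_eval q t (c * t ^+ n) mu (mBC R m nu)).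
Proof.
rewrite /bc_eval /mBC !laurent_eval_sum; apply: reg_sum => v; rewrite !laurent_evalU.
apply: reg_prod => i; apply: regXz; last exact: interp_point_neq0.
rewrite /interp_point; apply: regM; first by apply: regM; apply: regX; apply: regC.
by apply: regM; [apply: regC | apply: regT].
Qed.

Lemma reg_interp_val mu la :
  reg (interp_val (C q) (C t) m (C c * T) mu la) (interp_val q t m (c * t ^+ n) mu la).
Proof.
have gen_cT := sgeneric_ratfun c0.
have /is_interp_monic[monK zK] := interpP char0K m mu gen_cT.
have /is_interp_monic[monR zR] := interpP char0 m mu gen_c.
apply: (reg_interp (@bc_eval_lin K (C q) (C t) m (C c * T)) (@bc_eval_lin R q t m (c * t ^+ n))
  (parts_with_uniq _ _) (bc_belowP m mu) reg_bc_eval (bc_below_unit char0 m mu gen_c)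
  (psiK := bc_eval (C q) (C t) (C c * T) la) (psiR := bc_eval q t (c * t ^+ n) la)
  _ _ _ monK zK monR zR).
- exact: bc_eval_lin.
- exact: bc_eval_lin.
exact: reg_bc_eval.
Qed.

End Binom.

Lemma reg_binom la mu : part_incl mu la ->
  reg (binom (C q) (C t) (T / C t * C h) la mu) (binom q t (t ^ (n%:Z - 1) * h) la mu).
Proof.
move=> incl; rewrite /binom (maxn_idPl (part_incl_size incl)); set m := size la.
pose c := t ^ (1 - m%:Z) / t * h.
have c0 : c != 0 by rewrite !mulf_neq0 ?invr_eq0 ?expfz_neq0.
have -> : C t ^ (1 - m%:Z) * (T / C t * C h) = C c * T.
  by rewrite /c !ratfunCM ratfunCV ratfunCX; ring.
have eq_c : t ^ (1 - m%:Z) * (t ^ (n%:Z - 1) * h) = c * t ^+ n.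
  by rewrite /c [t ^ (n%:Z - 1)]expfzDr // exprN1 -exprnP; ring.
have gen_c : sgeneric q t (c * t ^+ n).
  by rewrite -eq_c mulrA -expfzDr // -[t ^ _]mul1r -(expr0z q); apply: sgeneric_mulq.
rewrite eq_c; apply: reg_div; try exact: reg_interp_val.
by apply: interp_val_neq0; rewrite // part_incl_size.
Qed.

Lemma reg_cell_prod a la (wK : nat -> nat -> K) (w : nat -> nat -> R) :
  (forall i j, ratfun_value (wK i j) a (w i j)) -> ratfun_value (cell_prod la wK) a (cell_prod la w).
Proof. by move=> reg_w; apply: reg_prod => i; apply: reg_prod => j. Qed.

Lemma reg_C0 la xK x : reg xK x -> reg (C0 (C q) (C t) la xK) (C0 q t la x).
Proof.
move=> reg_x; apply: reg_cell_prod => i j; apply: regB; first exact: reg1.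
by do !apply: regM => //; apply: regXz => //; apply: regC.
Qed.

Lemma reg_Cminus la xK x : reg xK x -> reg (Cminus (C q) (C t) la xK) (Cminus q t la x).
Proof.
move=> reg_x; apply: reg_cell_prod => i j; apply: regB; first exact: reg1.
by do !apply: regM => //; apply: regXz => //; apply: regC.
Qed.

Lemma reg_Cplus la xK x : reg xK x -> reg (Cplus (C q) (C t) la xK) (Cplus q t la x).
Proof.
move=> reg_x; apply: reg_cell_prod => i j; apply: regB; first exact: reg1.
by do !apply: regM => //; apply: regXz => //; apply: regC.
Qed.

(** The factor C0(T), which is left out here, is the only one that may vanish
    at T = t^n. *)
Definition k0unit (F : fieldType) (q t T t0 t1 t2 t3 : F) la : F :=
  (t0 * T / t) ^- weight la * t ^+ nstat la
  * (C0 q t la (T * t0 * t1 / t) * C0 q t la (T * t0 * t2 / t) * C0 q t la (T * t0 * t3 / t))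
  / (Cminus q t la t * Cplus q t la (T ^+ 2 * t0 * t1 * t2 * t3 / (q * t ^+ 2))).

Lemma k0_unit (F : fieldType) (q' t' T' t0' t1' t2' t3' : F) la :
  k0 q' t' T' t0' t1' t2' t3' la = C0 q' t' la T' * k0unit q' t' T' t0' t1' t2' t3' la.
Proof. by rewrite /k0 /k0unit; ring. Qed.

Lemma k0unit_neq0 la : k0unit q t (t ^+ n) t0 t1 t2 t3 la != 0.
Proof.
rewrite /k0unit !mulf_neq0 ?invr_eq0 ?mulf_neq0 ?expf_neq0 ?mulf_neq0 ?invr_eq0 ?expf_neq0 //.
- exact/(C0_neq0 gen)/(generic_t01_neq0 gen).
- exact/(C0_neq0 gen)/(generic_t02_neq0 gen).
- exact/(C0_neq0 gen)/(generic_t03_neq0 gen).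
- exact: Cminus_neq0 gen _.
- exact: Cplus_neq0 gen _ _.
Qed.

Lemma reg_k0unit la : reg (k0unit (C q) (C t) T (C t0) (C t1) (C t2) (C t3) la)
  (k0unit q t (t ^+ n) t0 t1 t2 t3 la).
Proof.
have rC := regC (t ^+ n); have rT := regT (t ^+ n).
have rx x : reg (T * C t0 * C x / C t) (t ^+ n * t0 * x / t).
  by apply: reg_div => //; do !apply: regM.
rewrite /k0unit; apply: reg_div.
- apply: regM; last by apply: regM; first (apply: regM); apply: reg_C0; apply: rx.
  apply: regM; last exact: regX.
  apply: regV; last by rewrite expf_neq0 // !mulf_neq0 ?invr_eq0.
  by apply: regX; apply: reg_div => //; apply: regM.
- apply: regM; first exact: reg_Cminus.
  apply: reg_Cplus; apply: reg_div; last by rewrite mulf_neq0 ?expf_neq0.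
    by do !apply: regM => //; apply: regX.
  by apply: regM => //; apply: regX.
by rewrite mulf_neq0 ?(Cminus_neq0 gen) ?(Cplus_neq0 gen).
Qed.

Lemma reg_k0 la : reg (k0 (C q) (C t) T (C t0) (C t1) (C t2) (C t3) la)
  (k0 q t (t ^+ n) t0 t1 t2 t3 la).
Proof. by rewrite !k0_unit; apply: regM; [apply/reg_C0/regT | apply: reg_k0unit]. Qed.

Lemma k0_long la : (n < size la)%N -> k0 q t (t ^+ n) t0 t1 t2 t3 la = 0.
Proof.
move=> lt_n; rewrite k0_unit (_ : C0 _ _ _ _ = 0) ?mul0r //; apply/eqP.
rewrite /C0 /cell_prod prodf_seq_eq0; apply/hasP; exists n.+1.
  by rewrite mem_index_iota /= ltnS.
rewrite /= prodf_seq_eq0; apply/hasP; exists 1%N.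
  by rewrite mem_index_iota /= ltnS part_pos.
rewrite /= subrr expr0z mul1r exprnP -expfzDr // (_ : 1 - n.+1%:Z + n%:Z = 0) ?expr0z ?subrr //.
lia.
Qed.

(** C0_la(T) is the product of C0_mu(T) and of factors for the cells of la
    outside mu, so the zeros of C0_mu(T) cancel. *)
Lemma reg_k0_ratio la mu : part_incl mu la -> exists v,
  reg (k0 (C q) (C t) T (C t0) (C t1) (C t2) (C t3) la / k0 (C q) (C t) T (C t0) (C t1) (C t2) (C t3) mu) v.
Proof.
move=> incl; pose w i j : K := 1 - C q ^ (j%:Z - 1) * C t ^ (1 - i%:Z) * T.
pose D := \prod_(1 <= i < (size la).+1) \prod_((part mu i).+1 <= j < (part la i).+1) w i j.
have C0D : C0 (C q) (C t) la T = C0 (C q) (C t) mu T * D.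
  rewrite /C0 /cell_prod /D.
  have -> : \prod_(1 <= i < (size mu).+1) \prod_(1 <= j < (part mu i).+1) w i j
      = \prod_(1 <= i < (size la).+1) \prod_(1 <= j < (part mu i).+1) w i j.
    rewrite [RHS](big_cat_nat (n := (size mu).+1)) //=; last by rewrite ltnS part_incl_size.
    rewrite [X in _ * X]big_nat [X in _ * X]big1 ?mulr1 // => i /andP[lt_i _].
    by rewrite part_default // big_geq.
  rewrite -big_split big_nat [RHS]big_nat; apply: eq_bigr => i /andP[i0 _] /=.
  by rewrite -big_cat_nat //= ltnS incl.
have w0 i j : w i j != 0.
  apply: (reg_neq0 (a := 0) (v := 1 - q ^ (j%:Z - 1) * t ^ (1 - i%:Z) * 0)); last first.
    by rewrite mulr0 subr0 oner_neq0.
  apply: regB; first exact: reg1.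
  by apply: regM; [apply: regM; apply: regXz => //; apply: regC | apply: regT].
have C0mu : C0 (C q) (C t) mu T != 0 by apply: cell_prod_neq0 => i j _ _; apply: w0.
have kmu := reg_neq0 (reg_k0unit mu) (k0unit_neq0 mu).
have [v reg_D] : exists v, reg D v.
  exists (\prod_(1 <= i < (size la).+1) \prod_((part mu i).+1 <= j < (part la i).+1)
    (1 - q ^ (j%:Z - 1) * t ^ (1 - i%:Z) * t ^+ n)).
  apply: reg_prod => i; apply: reg_prod => j; apply: regB; first exact: reg1.
  by apply: regM; [apply: regM; apply: regXz => //; apply: regC | apply: regT].
exists (v * (k0unit q t (t ^+ n) t0 t1 t2 t3 la / k0unit q t (t ^+ n) t0 t1 t2 t3 mu)).
rewrite !k0_unit C0D.
set kl := k0unit _ _ _ _ _ _ _ la; set km := k0unit _ _ _ _ _ _ _ mu in kmu *.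
rewrite cancel_ratio //.
by apply: regM => //; apply: reg_div; rewrite ?k0unit_neq0 //; apply: reg_k0unit.
Qed.

Lemma sym_pm_sumZ (I : Type) (r : seq I) (k : I -> R) (F : I -> symfun R) :
  sym_pm n (\sum_(i <- r) k i *: F i) = \sum_(i <- r) k i *: sym_pm n (F i).
Proof.
elim: r => [|i r IHr]; last by rewrite !big_cons sym_pm_lin IHr.
rewrite !big_nil; have := sym_pm_lin n (-1) (0 : symfun R) 0.
by rewrite scaler0 addr0 scaleN1r addNr.
Qed.

(** If mu has more than n parts, this is not the quotient of the values of
    k0_la and k0_mu, as both are zero. *)
Definition k0_value la mu : R := epsilon (inhabits 0) (fun v =>
  reg (k0 (C q) (C t) T (C t0) (C t1) (C t2) (C t3) la / k0 (C q) (C t) T (C t0) (C t1) (C t2) (C t3) mu) v).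

Lemma ratfun_value_unique (r : K) a v v' : ratfun_value r a v -> ratfun_value r a v' -> v = v'.
Proof.
move=> rv rv'; apply/eqP; rewrite -subr_eq0; apply/eqP; apply: (@reg_eq0 _ a).
by rewrite -(subrr r); apply: regB.
Qed.

Lemma k0_valueP la mu : part_incl mu la ->
  reg (k0 (C q) (C t) T (C t0) (C t1) (C t2) (C t3) la / k0 (C q) (C t) T (C t0) (C t1) (C t2) (C t3) mu) (k0_value la mu).
Proof. by move=> incl; apply: epsilon_spec; apply: reg_k0_ratio. Qed.

Lemma k0_valueE la mu : part_incl mu la -> (size mu <= n)%N ->
  k0_value la mu = k0 q t (t ^+ n) t0 t1 t2 t3 la / k0 q t (t ^+ n) t0 t1 t2 t3 mu.
Proof.
move=> incl le_mu; apply: ratfun_value_unique (k0_valueP incl) _.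
by apply: reg_div; rewrite ?k0_neq0 //; apply: reg_k0.
Qed.

(** If la has more than n parts, every term becomes zero: for mu with at most
    n parts because of k0_la, for the other mu because of the interpolation
    polynomial. *)
Lemma lifted_specialization la : exists f : symfun R,
  specializes_to (lifted_koornwinder (C q) (C t) T (C t0) (C t1) (C t2) (C t3) (C h) la) (t ^+ n) f
  /\ sym_pm n f = if (size la <= n)%N then koornwinder n q t t0 t1 t2 t3 la else 0.
Proof.
exists (\sum_(mu <- subparts la) (binom q t (t ^ (n%:Z - 1) * h) la mu * k0_value la mu)
  *: lifted_interp q t (t ^+ n) t0 mu); split.
  move=> nu; rewrite /lifted_koornwinder !raddf_sum /= big_seq [X in ratfun_value _ _ X]big_seq.
  elim/big_rec2: _ => [|mu v r mu_la IH]; first exact: reg0.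
  have incl : part_incl mu la by apply/mem_subparts.
  apply: regD => //; rewrite !coeffZ; apply: regM; last exact: reg_lifted_interp.
  by apply: regM; [apply: reg_binom | apply: k0_valueP].
rewrite sym_pm_sumZ; under eq_bigr => mu _ do rewrite sym_pm_lifted //.
case: ifP => [le_la|/negbT]; last rewrite -ltnNge => gt_la.
  rewrite (koornwinderE gen hh) // /binomial_koornwinder; apply: eq_big_seq => mu mu_la.
  have le_mu := leq_trans (subparts_size mu_la) le_la.
  by rewrite le_mu k0_valueE //; apply/mem_subparts.
rewrite big1_seq // => mu /= /mem_subparts incl; case: ifP => [le_mu|_]; last by rewrite scaler0.
by rewrite k0_valueE // k0_long // mul0r mulr0 scale0r.
Qed.

End Lifted.

Theorem theorem7p1 (R : fieldType) (q t t0 t1 t2 t3 h : R)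
    (hgen : generic q t t0 t1 t2 t3)
    (hh : h ^+ 2 = t0 * t1 * t2 * t3 / q)
    (n : nat) (hn : (0 < n)%N) (la : intpart) :
  exists f : symfun R,
    specializes_to
      (lifted_koornwinder (ratfunC q) (ratfunC t) (ratfunT R)
         (ratfunC t0) (ratfunC t1) (ratfunC t2) (ratfunC t3) (ratfunC h) la)
      (t ^+ n) f
    /\ sym_pm n f
       = if (size la <= n)%N then koornwinder n q t t0 t1 t2 t3 la else 0.
Proof. exact: lifted_specialization. Qed.
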